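(* Let $0<p<q\le1$ and let $K\subset\mathbb{R}^n$ be a convex body. Then $$\lambda(q)\,\mathrm{Vol}_n(K)^{-\frac1q}F_qK\subseteq\lambda(p)\,\mathrm{Vol}_n(K)^{-\frac1p}F_pK,$$ where $$\lambda(p)=\begin{cases}\left(\dfrac{\binom{2n-p}{2n}}{\Gamma(p+1)\cos\left(\frac{\pi p}{2}\right)}\right)^{\frac1p},&p\in(0,1),\\[2mm] \dfrac{1}{\pi n},&p=1.\end{cases}$$
   Context: A convex body is a compact convex set with non-empty interior. Here $\binom{2n-p}{2n}=\frac{\Gamma(2n-p+1)}{\Gamma(2n+1)\Gamma(1-p)}$. For $p>0$ the Fourier $p$th mean body $F_pK$ is the origin-symmetric star-shaped set $\{t\theta:\theta\in\mathbb{S}^{n-1},\,0\le t<\infty,\,t\le\rho_{F_pK}(\theta)\}$ with radial function $$\rho_{F_pK}(\theta)=\left(\frac{p}{\mathrm{Vol}_n(K)}\int_0^\infty|\widehat{\chi_K}(r\theta)|^2r^{p-1}dr\right)^{1/p},\quad\theta\in\mathbb{S}^{n-1},$$ where $\chi_K$ is the indicator function of $K$ and $\hat f(y)=\int_{\mathbb{R}^n}e^{-i\langle x,y\rangle}f(x)dx$. *)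

(* Defs.v *)
From HB Require Import structures.
From mathcomp Require Import all_boot all_order all_algebra.
From mathcomp Require Import all_classical all_reals all_analysis.
From mathcomp Require Import complex.

Set Implicit Arguments.
Unset Strict Implicit.
Unset Printing Implicit Defensive.

Import Order.TTheory GRing.Theory Num.Theory.
Import numFieldNormedType.Exports.

Local Open Scope classical_set_scope.
Local Open Scope ring_scope.

Definition rV_display : measure_display.
Proof. exact. Qed.

Section measurable_rV.
Context {R : realType} (n : nat).

(* The sigma-algebra generated by the coordinates, as the library does for
   tuples; it is the Borel sigma-algebra of R^n. *)
Definition rV_coord (i : 'I_n) (x : 'rV[R]_n) : measurableTypeR R := x ord0 i.

Let rV_set0 : g_sigma_preimage rV_coord set0.
Proof. exact: sigma_algebra0. Qed.

Let rV_setC A : g_sigma_preimage rV_coord A -> g_sigma_preimage rV_coord (~` A).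
Proof. exact: sigma_algebraC. Qed.

Let rV_bigcup (F : _^nat) : (forall i, g_sigma_preimage rV_coord (F i)) ->
  g_sigma_preimage rV_coord (\bigcup_i (F i)).
Proof. exact: sigma_algebra_bigcup. Qed.

HB.instance Definition _ := @isMeasurable.Build rV_display
  'rV[R]_n (g_sigma_preimage rV_coord) rV_set0 rV_setC rV_bigcup.

End measurable_rV.

Lemma measurable_rV_coord (R : realType) (n : nat) (i : 'I_n) :
  measurable_fun [set: 'rV[R]_n] (@rV_coord R n i).
Proof.
move=> _ Y mY; rewrite setTI; apply: sub_sigma_algebra => /=.
rewrite -bigcup_seq/=; exists i => /=; first by rewrite mem_index_enum.
by exists Y => //; rewrite setTI.
Qed.

Lemma measurable_fun_rV d (T : measurableType d) (R : realType) (n : nat)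
    (f : T -> 'rV[R]_n) :
  (forall i, measurable_fun [set: T] (@rV_coord R n i \o f)) ->
  measurable_fun [set: T] f.
Proof.
move=> mf; pose S := [set A : set 'rV[R]_n | measurable (f @^-1` A)].
suff sub : measurable `<=` S by move=> _ A /sub; rewrite setTI.
apply: smallest_sub.
  split; rewrite /S /=.
  - by rewrite preimage_set0.
  - by move=> A mA; rewrite setTD preimage_setC; exact: measurableC.
  - by move=> F mF; rewrite preimage_bigcup; exact: bigcup_measurable.
rewrite -bigcup_seq; apply: bigcup_sub => i _ A [B mB <-].
by rewrite /S /= setTI -comp_preimage -[X in measurable X]setTI; exact: mf.
Qed.

(* (a, (x_1, .., x_n)) |-> (a, x_1, .., x_n) *)
Definition rV_cons (R : realType) (n : nat) (x : measurableTypeR R * 'rV[R]_n) :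
    'rV[R]_n.+1 :=
  row_mx (const_mx x.1 : 'rV[R]_1) x.2.

Lemma measurable_rV_cons (R : realType) (n : nat) :
  measurable_fun [set: measurableTypeR R * 'rV[R]_n] (@rV_cons R n).
Proof.
apply: measurable_fun_rV => i.
case: (@split_ordP 1 n i) => j ->.
  rewrite (_ : _ \o _ = fst) //.
  apply/funext => x.
  by apply: etrans (@row_mxEl _ 1 1 n _ _ ord0 j) _; rewrite mxE.
rewrite (_ : _ \o _ = @rV_coord R n j \o snd).
  by apply: measurableT_comp => //; exact: measurable_rV_coord.
by apply/funext => x; exact: (@row_mxEr _ 1 1 n _ _ ord0 j).
Qed.

Section lebesgue_rV_succ.
Context (R : realType) (n : nat).
Variable mu : {sigma_finite_measure set 'rV[R]_n -> \bar R}.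

Definition lebesgue_rV_succ : set 'rV[R]_n.+1 -> \bar R :=
  pushforward ((@lebesgue_measure R) \x mu)%E (@rV_cons R n).

Let rV_succ0 : lebesgue_rV_succ set0 = 0%E.
Proof. by rewrite /lebesgue_rV_succ /pushforward preimage_set0 measure0. Qed.

Let rV_succ_ge0 A : (0 <= lebesgue_rV_succ A)%E.
Proof. by rewrite /lebesgue_rV_succ /pushforward measure_ge0. Qed.

Let rV_succ_sigma_additive : semi_sigma_additive lebesgue_rV_succ.
Proof.
apply: (@measure_semi_sigma_additive _ _ _ (pushforward _ _)).
exact: measurable_rV_cons.
Qed.

HB.instance Definition _ := isMeasure.Build _ _ _ lebesgue_rV_succ
  rV_succ0 rV_succ_ge0 rV_succ_sigma_additive.

Let rV_succ_sigma_finite : sigma_finite setT lebesgue_rV_succ.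
Proof.
have /sigma_finiteP[F [FT ndF Foo]] := sigma_finiteT (@lebesgue_measure R).
have /sigma_finiteP[G [GT ndG Goo]] := sigma_finiteT mu.
pose tl (x : 'rV[R]_n.+1) : measurableTypeR R * 'rV[R]_n :=
  (x ord0 ord0, rsubmx (x : 'rV[R]_(1 + n))).
have tlK : cancel (@rV_cons R n) tl.
  move=> [a x]; rewrite /tl /rV_cons /= row_mxKr; congr (_, _).
  rewrite (_ : ord0 = lshift n (ord0 : 'I_1)); last exact: val_inj.
  by apply: etrans (@row_mxEl _ 1 1 n _ _ ord0 ord0) _; rewrite mxE.
have mtl : measurable_fun setT tl.
  apply/measurable_fun_pairP; split.
    exact: (@measurable_rV_coord R n.+1 ord0).
  apply: measurable_fun_rV => i.
  rewrite (_ : _ \o _ = @rV_coord R n.+1 (rshift 1 i)).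
    exact: measurable_rV_coord.
  by apply/funext => x; rewrite /rV_coord /= mxE.
exists (fun k => tl @^-1` (F k `*` G k)).
  apply/esym/seteqP; split => // x _.
  have [k _ Fk] : (\bigcup_k F k) (tl x).1 by rewrite -FT.
  have [l _ Gl] : (\bigcup_k G k) (tl x).2 by rewrite -GT.
  exists (maxn k l) => //; split.
    by move: Fk; exact/subsetPset/ndF/leq_maxl.
  by move: Gl; exact/subsetPset/ndG/leq_maxr.
move=> k; have [mFk Fkoo] := Foo k; have [mGk Gkoo] := Goo k; split.
  by rewrite -[X in measurable X]setTI; apply: mtl => //; exact: measurableX.
rewrite /lebesgue_rV_succ /pushforward -comp_preimage.
rewrite (_ : tl \o _ = id); last by apply/funext => x /=; rewrite tlK.
by rewrite preimage_id product_measure1E// lte_mul_pinfty// ge0_fin_numE.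
Qed.

HB.instance Definition _ := Measure_isSigmaFinite.Build _ _ _ lebesgue_rV_succ
  rV_succ_sigma_finite.

End lebesgue_rV_succ.

(* Lebesgue measure on R^n, as the n-fold product of the one on R. *)
Fixpoint lebesgue_rV (R : realType) (n : nat) :
    {sigma_finite_measure set 'rV[R]_n -> \bar R} :=
  match n with
  | 0 => @dirac rV_display 'rV[R]_0 0 R
  | n'.+1 => lebesgue_rV_succ (lebesgue_rV R n')
  end.

Lemma lebesgue_rV_box (R : realType) (n : nat) (a b : 'I_n -> R) :
  (forall i, a i <= b i) ->
  lebesgue_rV R n [set x | forall i, x ord0 i \in `[a i, b i]] =
  (\prod_(i < n) (b i - a i))%:E.
Proof.
elim: n a b => [|n IH] a b ab.
  by rewrite big_ord0 /= diracE mem_set //= => -[].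
have E0 : ord0 = @lshift 1 n ord0 :> 'I_n.+1 by exact: val_inj.
have ES j : lift ord0 j = @rshift 1 n j :> 'I_n.+1 by exact: val_inj.
rewrite big_ord_recl /= /lebesgue_rV_succ /pushforward.
pose B : set 'rV[R]_n :=
  [set x | forall i, x ord0 i \in `[a (lift ord0 i), b (lift ord0 i)]].
have -> : @rV_cons R n @^-1` [set x | forall i, x ord0 i \in `[a i, b i]] =
    `[a ord0, b ord0]%classic `*` B.
  apply/seteqP; split => [[x y] H|[x y] [H1 H2] i] /=.
    split => [|i].
      by have := H ord0; rewrite {1}E0 /rV_cons (@row_mxEl _ 1 1 n) mxE.
    by have := H (lift ord0 i); rewrite {1}ES /rV_cons (@row_mxEr _ 1 1 n).
  rewrite /rV_cons /=; case: (unliftP ord0 i) => [j|] ->.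
    by rewrite {1}ES (@row_mxEr _ 1 1 n); exact: H2.
  by rewrite {1}E0 (@row_mxEl _ 1 1 n) mxE.
rewrite product_measure1E //=; last first.
  rewrite (_ : B = \bigcap_(i in [set: 'I_n])
      (@rV_coord R n i @^-1` `[a (lift ord0 i), b (lift ord0 i)]%classic)).
    apply: fin_bigcap_measurable => // i _.
    by rewrite -[X in measurable X]setTI; exact: measurable_rV_coord.
  by apply/seteqP; split => [x H i _|x H i] /=; [exact: H|exact: (H i I)].
rewrite IH // EFinM lebesgue_measure_itv /= lte_fin.
case: ltP => // h.
have -> : b ord0 = a ord0 by apply/eqP; rewrite eq_le h ab.
by rewrite subrr.
Qed.

Definition vol (R : realType) (n : nat) (K : set 'rV[R]_n) : R :=
  fine (lebesgue_rV R n K).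

(* The library's norm on 'rV[R]_n is the sup norm, so the Euclidean structure
   is given explicitly; the topology is the same. *)
Definition dotp (R : realType) (n : nat) (x y : 'rV[R]_n) : R :=
  \sum_(i < n) x ord0 i * y ord0 i.

Definition enorm (R : realType) (n : nat) (x : 'rV[R]_n) : R :=
  Num.sqrt (dotp x x).

Definition unit_sphere (R : realType) (n : nat) : set 'rV[R]_n :=
  [set theta | enorm theta = 1].

Definition convex_body (R : realType) (n : nat) (K : set 'rV[R]_n) : Prop :=
  [/\ compact K, @convex_set R 'rV[R]_n K & interior K !=set0].

Definition expi (R : realType) (t : R) : R[i] := Complex (cos t) (sin t).

Definition Cintegral d (T : measurableType d) (R : realType)
    (mu : {measure set T -> \bar R}) (f : T -> R[i]) : R[i] :=
  Complex (\int[mu]_x complex.Re (f x)) (\int[mu]_x complex.Im (f x)).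

Definition fourier (R : realType) (n : nat) (f : 'rV[R]_n -> R[i])
    (y : 'rV[R]_n) : R[i] :=
  Cintegral (lebesgue_rV R n) (fun x => expi (- dotp x y) * f x).

Definition char_fun (R : realType) (n : nat) (K : set 'rV[R]_n)
    (x : 'rV[R]_n) : R[i] :=
  Complex (\1_K x) 0.

(* Extended-real valued: +oo when the integral diverges. *)
Definition fourier_radial (R : realType) (n : nat) (p : R)
    (K : set 'rV[R]_n) (theta : 'rV[R]_n) : \bar R :=
  (((p / vol K)%:E *
    \int[@lebesgue_measure R]_(r in `]0%R, +oo[)
      (ComplexField.Normc.normc (fourier (char_fun K) (r *: theta)) ^+ 2
         * r `^ (p - 1))%:E) `^ p^-1)%E.

Definition star_shaped_set (R : realType) (n : nat)
    (rho : 'rV[R]_n -> \bar R) : set 'rV[R]_n :=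
  [set x | exists theta t, [/\ unit_sphere theta, 0 <= t,
                               (t%:E <= rho theta)%E & x = t *: theta]].

Definition fourier_mean_body (R : realType) (n : nat) (p : R)
    (K : set 'rV[R]_n) : set 'rV[R]_n :=
  star_shaped_set (fourier_radial p K).

Definition dilate (R : realType) (n : nat) (c : R) (A : set 'rV[R]_n) :
    set 'rV[R]_n :=
  [set c *: x | x in A].

(* Euler's integral; only meaningful for x > 0. *)
Definition Gamma (R : realType) (x : R) : R :=
  \int[@lebesgue_measure R]_(t in `]0, +oo[) (t `^ (x - 1) * expR (- t)).

Definition gbinom (R : realType) (a b : R) : R :=
  Gamma (a + 1) / (Gamma (b + 1) * Gamma (a - b + 1)).

(* For 0 < p <= 1; the value at 1 is the limit as p tends to 1 from below. *)
Definition lambda_const (R : realType) (n : nat) (p : R) : R :=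
  if p == 1 then (pi * n%:R)^-1
  else (gbinom ((2 * n)%:R - p) (2 * n)%:R
          / (Gamma (p + 1) * cos (pi * p / 2))) `^ p^-1.

(* Main.v *)
From HB Require Import structures.
Require Import Defs.
From mathcomp Require Import all_boot all_order all_algebra.
From mathcomp Require Import all_classical all_reals all_analysis.
From mathcomp Require Import measurable_realfun ring lra.
From mathcomp Require complex.

Set Implicit Arguments.
Unset Strict Implicit.
Unset Printing Implicit Defensive.

Import Order.TTheory GRing.Theory Num.Theory.
Import numFieldNormedType.Exports.

Local Open Scope classical_set_scope.
Local Open Scope ring_scope.

(* Write [m = 2n] and let [T s] be the measure of the pairs of points of [K]
   whose difference has component at least [s] along [theta]. The difference of
   two independent uniform points of [K] makes [|chi_K^|^2] a cosine transform,
   so for [p < 1] the integral defining the radial function is a multiple of the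
   moment of order [-p] of that component, that is, of
   [\int s^(-p-1) (1 - T s / T 0) ds]; for [p = 1] only an upper bound, in terms
   of the slope of [T] at [0], is needed. By the Brunn-Minkowski inequality in
   dimension [m], [(T s / T 0)^(1/m)] lies above its chords from [s = 0]. Hence it
   crosses each cone [max (1 - s / w) 0] at most once, from above to below, and
   choosing [w] so that the moments of order [-q] agree gives an inequality
   between those of order [-p]. The constants [lambda] are those for which
   cones, raised to the power [m], have normalised moments [1 / w]. *)

(** * Layer-cake formulas *)

(** The double integral of the cosine against r^(p-1) does not converge absolutely, so Fubini is
    applied only after damping by [expR (- (a * r))]. The damped inner integral is the real part of
    [Gamma p] times a complex power, found here through a real differential equation. As [a] tends
    to 0 one side converges monotonically, because a squared modulus is nonnegative, and the other
    by domination. Domination needs the moment of order -p to be finite; a single chord of the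
    profile gives this, since it bounds 1 - T s / T 0 near 0. At p = 1 this formula degenerates,
    cos(pi/2) = 0 meeting an infinite moment, and the damped integral is estimated directly. An
    upper bound suffices since only [q] can equal 1. The infimum [sigma] of the chord slopes at 0
    then links the two bodies: it controls the radius for q = 1 from above, while the cone 1 - sigma
    s lies above the profile and makes [sigma] a lower bound for the scaled radius at [p].
    Brunn-Minkowski is derived from a functional inequality proved by induction on the dimension for
    positive exponents only; indicators satisfy it for every exponent, and the extra exponent is
    sent to 0 at the end. *)

Section affine_substitution.
Context {R : realType}.
Notation mu := (@lebesgue_measure R).

(** Uniqueness of Lebesgue measure: [c] times its image under [x |-> c * x + s] gives each interval
    []a, b]] its length. *)
Lemma ge0_integral_affine (c s : R) (f : R -> \bar R) : 0 < c ->
  measurable_fun [set: R] f -> (forall x, (0 <= f x)%E) ->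
  (\int[mu]_x f (c * x + s)%R = c^-1%:E * \int[mu]_x f x)%E.
Proof.
move=> c0 mf f0; pose phi (x : measurableTypeR R) : measurableTypeR R := c * x + s.
have mphi : measurable_fun setT phi.
  by apply: measurable_funD => //; exact: measurable_funM.
pose k : {nonneg R} := NngNum (ltW c0).
pose nu_ : {measure set (measurableTypeR R) -> \bar R} :=
  mscale k (pushforward mu phi : {measure set (measurableTypeR R) -> \bar R}).
pose nu := nu_ mphi.
have munu A : measurable A -> mu A = nu A.
  move=> mA; apply: lebesgue_measure_unique => //= _ [[a b]] _ <-.
  rewrite /nu /nu_ /mscale /= /pushforward.
  rewrite (_ : phi @^-1` _ = `](a - s) / c, (b - s) / c]%classic); last first.
    apply/seteqP; split => x; rewrite /phi /= !in_itv /= ltr_pdivrMr// ler_pdivlMr//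
      (mulrC c);
      by rewrite ltrBlDr lerBrDr.
  rewrite !lebesgue_measure_itv /= !lte_fin ltr_pM2r ?invr_gt0// ltrD2r.
  case: ifPn => ab; last by rewrite mule0.
  rewrite -EFinM; congr EFin.
  by rewrite -mulrBl opprB addrA subrK mulrC divfK// gt_eqF.
rewrite [in RHS](eq_measure_integral nu); last by move=> A mA _; exact: munu.
rewrite /nu /nu_ ge0_integral_mscale//= ge0_integral_pushforward//=.
by rewrite muleA -EFinM mulVf ?gt_eqF// mul1e.
Qed.

Lemma ge0_integral_scale (c : R) (f : R -> \bar R) : 0 < c ->
  measurable_fun [set: R] f -> (forall x, (0 <= f x)%E) ->
  (\int[mu]_(x in `]0%R, +oo[) f (c * x)%R = c^-1%:E * \int[mu]_(x in `]0%R, +oo[) f x)%E.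
Proof.
move=> c0 mf f0; rewrite integral_mkcond [in RHS]integral_mkcond.
rewrite -(@ge0_integral_affine c 0)//; last 2 first.
  by apply/(measurable_restrictT _ _).1 => //; exact: measurable_funTS.
  by move=> x; rewrite erestrict_ge0.
apply: eq_integral => x _; rewrite addr0 /patch.
by rewrite !mem_setE !in_itv /= !andbT pmulr_rgt0.
Qed.

End affine_substitution.

Lemma measurable_set_ltr d (T : measurableType d) (R : realType) (f g : T -> R) :
  measurable_fun setT f -> measurable_fun setT g ->
  measurable [set x | f x < g x].
Proof.
move=> mf mg; rewrite -[X in measurable X]setTI.
exact: (measurable_fun_ltr mf mg measurableT (Y := [set true])).
Qed.

Lemma measurable_set_ler d (T : measurableType d) (R : realType) (f g : T -> R) :
  measurable_fun setT f -> measurable_fun setT g ->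
  measurable [set x | f x <= g x].
Proof.
move=> mf mg; rewrite -[X in measurable X]setTI.
exact: (measurable_fun_ler mf mg measurableT (Y := [set true])).
Qed.

Section layer_cake.
Context d (T : measurableType d) (R : realType).
Variable nu : {sigma_finite_measure set T -> \bar R}.
Notation mu := (@lebesgue_measure R).

(** Both weights are kept because both are used: [v = 1] yields the layer-cake formulas, and two
    genuine weights evaluate [integral_powR_1BexpRN]. *)
Lemma tonelli_weight (A : set (T * measurableTypeR R)) (v : T -> \bar R) (w : R ->
  \bar R) :
  measurable A -> measurable_fun setT v -> measurable_fun [set: R] w ->
  (forall z, 0 <= v z)%E -> (forall s, 0 <= w s)%E ->
  (\int[nu]_z (v z * \int[mu]_(s in [set s | A (z, s)]) w s) =
   \int[mu]_s (w s * \int[nu]_(z in [set z | A (z, s)]) v z))%E.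
Proof.
move=> mA mv mw v0 w0.
pose g (zs : T * measurableTypeR R) := (v zs.1 * w zs.2 * (\1_A zs)%:E)%E.
have mg : measurable_fun setT g.
  apply: emeasurable_funM; last by apply/measurable_EFinP; exact: measurable_indic.
  by apply: emeasurable_funM; [exact: (measurableT_comp mv)|exact: (measurableT_comp mw)].
have g0 zs : (0 <= g zs)%E by rewrite mule_ge0 ?mule_ge0// lee_fin.
have gE z s : g (z, s) = (if (z, s) \in A then v z * w s else 0)%E.
  by rewrite /g indicE; case: (_ \in A); rewrite ?mule1 ?mule0.
have xsec z : measurable [set s | A (z, s)].
  by have := measurable_xsection z mA; rewrite xsectionE.
have ysec s : measurable [set z | A (z, s)].
  by have := measurable_ysection s mA; rewrite ysectionE.
transitivity (\int[nu]_z \int[mu]_s g (z, s))%E.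
  apply: eq_integral => z _; rewrite -ge0_integralZl//; last exact: measurable_funTS.
  rewrite integral_mkcond; apply: eq_integral => s _.
  by rewrite gE /patch; congr (if _ then _ else _); apply/idP/idP => /set_mem h;
    exact/mem_set.
rewrite (@fubini_tonelli _ _ _ _ _ nu mu _ mg)//.
apply: eq_integral => s _; rewrite -ge0_integralZl//; last exact: measurable_funTS.
rewrite [RHS]integral_mkcond; apply: eq_integral => z _.
rewrite gE /patch muleC; congr (if _ then _ else _).
Qed.

Lemma tonelli_section (A : set (T * measurableTypeR R)) (w : R -> \bar R) :
  measurable A -> measurable_fun [set: R] w -> (forall s, (0 <= w s)%E) ->
  (\int[nu]_z \int[mu]_(s in [set s | A (z, s)]) w s =
   \int[mu]_s (w s * nu [set z | A (z, s)]))%E.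
Proof.
move=> mA mw w0; have := @tonelli_weight A (cst 1%E) w mA (measurable_cst _) mw.
move=> /(_ (fun _ => lee01) w0); under eq_integral do rewrite mul1e.
move=> ->; apply: eq_integral => s _; rewrite integral_cst ?mul1e//.
by have := measurable_ysection s mA; rewrite ysectionE.
Qed.

Lemma integral_superlevel (f : T -> R) : measurable_fun setT f ->
  (forall z, 0 <= f z) ->
  (\int[nu]_z (f z)%:E = \int[mu]_(t in `]0%R, +oo[) nu [set z | (t < f z)%R])%E.
Proof.
move=> mf f0.
pose A : set (T * measurableTypeR R) := [set zs | 0 < zs.2 < f zs.1].
have mA : measurable A.
  rewrite (_ : A = [set zs | 0 < zs.2] `&` [set zs | zs.2 < f zs.1]); last first.
    by apply/seteqP; split => [x /andP[]//|x [/= h1 h2]]; apply/andP.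
  apply: measurableI; first exact: measurable_set_ltr.
  apply: measurable_set_ltr => //.
  exact: measurableT_comp.
have := @tonelli_section A (cst 1%E) mA (measurable_cst _) (fun _ => lee01).
rewrite (_ : (\int[nu]_z \int[mu]_(s in [set s | A (z, s)]) cst 1%E s =
              \int[nu]_z (f z)%:E)%E); last first.
  apply: eq_integral => z _.
  rewrite (_ : [set s | A (z, s)] = `]0, f z[%classic); last first.
    by apply/seteqP; split => x; rewrite /A /= in_itv.
  rewrite integral_cst//= mul1e lebesgue_measure_itv/= lte_fin sube0.
  by case: ltgtP (f0 z) => // <-.
move=> ->; rewrite [RHS]integral_mkcond; apply: eq_integral => s _.
rewrite mul1e /patch mem_setE in_itv/= andbT; case: ifPn => s0.
  by congr (nu _); apply/seteqP; split => z; rewrite /A /= s0.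
by rewrite (_ : [set _ | _] = set0) ?measure0//; apply/seteqP; split => z //;
  rewrite /A /= (negbTE s0).
Qed.

End layer_cake.

Section positive_half_line.
Context {R : realType}.
Notation mu := (@lebesgue_measure R).

Lemma eq_integral_oo (f g : R -> \bar R) : (forall x, 0 < x -> f x = g x) ->
  (\int[mu]_(x in `]0%R, +oo[) f x = \int[mu]_(x in `]0%R, +oo[) g x)%E.
Proof.
by move=> fg; apply: eq_integral => x; rewrite inE/= in_itv/= andbT => /fg.
Qed.

Lemma ge0_integralZl_oo (k : R) (f : R -> R) : 0 <= k ->
  measurable_fun [set: R] f -> (forall x, 0 < x -> 0 <= f x) ->
  (\int[mu]_(x in `]0%R, +oo[) (k * f x)%:E = k%:E * \int[mu]_(x in `]0%R,
    +oo[) (f x)%:E)%E.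
Proof.
move=> k0 mf f0; under eq_integral do rewrite EFinM.
apply: ge0_integralZl.
- exact: measurable_itv.
- by apply: measurable_funTS; exact/measurable_EFinP.
- by move=> x; rewrite /= in_itv/= andbT => x0; rewrite lee_fin f0.
- by rewrite lee_fin.
Qed.

Lemma fubini_tonelli_oo (f : R * R -> R) :
  measurable_fun [set: measurableTypeR R * measurableTypeR R] f ->
  (forall x y, 0 < x -> 0 < y -> 0 <= f (x, y)) ->
  (\int[mu]_(x in `]0%R, +oo[) \int[mu]_(y in `]0%R, +oo[) (f (x, y))%:E =
   \int[mu]_(y in `]0%R, +oo[) \int[mu]_(x in `]0%R, +oo[) (f (x, y))%:E)%E.
Proof.
move=> mf f0; pose Q : set (measurableTypeR R * measurableTypeR R) :=
  `]0, +oo[%classic `*` `]0, +oo[%classic.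
have mQ : measurable Q by apply: measurableX.
pose g := (EFin \o f) \_ Q.
have mg : measurable_fun setT g.
  apply/(measurable_restrictT _ mQ); apply: measurable_funTS; exact/measurable_EFinP.
have g0 z : (0 <= g z)%E.
  rewrite /g patchE; case: ifPn => // /set_mem; case: z => x y [/=].
  by rewrite !in_itv/= !andbT => x0 y0; rewrite lee_fin f0.
have gE x y : g (x, y) = if 0 < x then if 0 < y then (f (x, y))%:E else 0%E else 0%E.
  rewrite /g patchE; case: ifPn => [/set_mem[/=]|/negP nQ].
    by rewrite !in_itv/= !andbT => -> ->.
  case: ifPn => // x0; case: ifPn => // y0; exfalso; apply: nQ; apply/mem_set.
  by split; rewrite /= in_itv/= andbT.
transitivity (\int[mu]_x \int[mu]_y g (x, y))%E.
  rewrite integral_mkcond; apply: eq_integral => x _.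
  rewrite patchE mem_setE in_itv/= andbT; under [RHS]eq_integral do rewrite gE.
  case: ifPn => x0; last by rewrite integral0.
  rewrite [LHS]integral_mkcond; apply: eq_integral => y _.
  by rewrite patchE mem_setE in_itv/= andbT.
rewrite (@fubini_tonelli _ _ _ _ _ mu mu _ mg)// [RHS]integral_mkcond.
apply: eq_integral => y _.
rewrite patchE mem_setE in_itv/= andbT; under eq_integral do rewrite gE.
case: ifPn => y0; last by rewrite integral0_eq// => x _; case: ifP.
rewrite [RHS]integral_mkcond; apply: eq_integral => x _.
by rewrite patchE mem_setE in_itv/= andbT.
Qed.

End positive_half_line.

(** * The Borell-Brascamp-Lieb inequality *)

Section bbl_line.
Context {R : realType}.
Notation mu := (@lebesgue_measure R).

(** A number strictly between the combination of the infima and that of the suprema lies between two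
    combinations of actual points. Moving in [I] and in [J] with one common parameter [t] reaches
    it, so [C] contains an open interval of the required length. *)
Lemma interval_minkowski (l : R) (I J C : set R) : 0 < l < 1 ->
  I !=set0 -> J !=set0 -> is_interval I -> is_interval J ->
  has_ubound I -> has_lbound I -> has_ubound J -> has_lbound J ->
  measurable C -> (forall x y, I x -> J y -> C ((1 - l) * x + l * y)) ->
  ((1 - l)%:E * mu I + l%:E * mu J <= mu C)%E.
Proof.
move=> /andP[l0 l1] I0 J0 iI iJ uI bI uJ bJ mC IJC.
have l1' : 0 < 1 - l by rewrite subr_gt0.
have len (E : set R) : E !=set0 -> is_interval E -> has_ubound E -> has_lbound E ->
    inf E <= sup E /\ (mu E <= (sup E - inf E)%:E)%E.
  move=> E0 iE uE bE.
  have iu : inf E <= sup E.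
    by case: E0 => x Ex; apply: (@le_trans _ _ x); [exact: ge_inf|exact: ub_le_sup].
  split => //.
  apply: (@le_trans _ _ (mu `[inf E, sup E]%classic)).
    apply: le_measure; rewrite ?inE//; first exact: is_interval_measurable.
    by move=> x Ex; rewrite /= in_itv/=; apply/andP; split;
      [exact: ge_inf|exact: ub_le_sup].
  rewrite /= lebesgue_measure_itv/= lte_fin; case: ifPn => // _.
  by rewrite lee_fin subr_ge0.
have [iuI muI] := len _ I0 iI uI bI.
have [iuJ muJ] := len _ J0 iJ uJ bJ.
pose a := (1 - l) * inf I + l * inf J; pose b := (1 - l) * sup I + l * sup J.
have abC : `]a, b[ `<=` C.
  move=> c; rewrite /= in_itv/= => /andP[ac cb].
  have [x Ix [y Jy xyc]] : exists2 x, I x & exists2 y, J y & (1 - l) * x + l * y < c.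
    pose e := (c - a); have e0 : 0 < e by rewrite subr_gt0.
    have [x Ix xe] := inf_adherent e0 (conj I0 bI).
    have [y Jy ye] := inf_adherent e0 (conj J0 bJ).
    exists x => //; exists y => //.
    apply: (@lt_le_trans _ _ ((1 - l) * (inf I + e) + l * (inf J + e))).
      by rewrite ltrD// ltr_pM2l.
    by rewrite /e /a; lra.
  have [x' Ix' [y' Jy' xyc']] : exists2 x, I x & exists2 y, J y & c < (1 - l) * x + l * y.
    pose e := (b - c); have e0 : 0 < e by rewrite subr_gt0.
    have [x' Ix' xe] := sup_adherent e0 (conj I0 uI).
    have [y' Jy' ye] := sup_adherent e0 (conj J0 uJ).
    exists x' => //; exists y' => //.
    apply: (@le_lt_trans _ _ ((1 - l) * (sup I - e) + l * (sup J - e))).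
      by rewrite /e /b; lra.
    by rewrite ltrD// ltr_pM2l.
  set p := _ + _ in xyc; set q := _ + _ in xyc'.
  have pq : 0 < q - p by rewrite subr_gt0 (lt_trans xyc).
  pose t := (c - p) / (q - p).
  have t01 : 0 <= t <= 1.
    apply/andP; split; first by apply: divr_ge0; [rewrite subr_ge0 ltW|exact: ltW].
    by rewrite ler_pdivrMr// mul1r lerD2r ltW.
  have mid (E : set R) u v : is_interval E -> E u -> E v -> E ((1 - t) * u + t * v).
    move=> iE Eu Ev; case/andP: t01 => t0 t1.
    have [uv|vu] := leP u v.
      by apply: (iE u v) => //; apply/andP; split; nra.
    by apply: (iE v u) => //; apply/andP; split; nra.
  have -> : c = (1 - l) * ((1 - t) * x + t * x') + l * ((1 - t) * y + t * y').
    have : c = p + t * (q - p) by rewrite /t divfK ?gt_eqF// addrC subrK.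
    by move=> ->; rewrite /p /q; ring.
  by apply: IJC; exact: mid.
apply: (@le_trans _ _ (mu `]a, b[%classic)); last by apply: le_measure; rewrite ?inE.
rewrite /= lebesgue_measure_itv/= lte_fin.
have abE : ((1 - l)%:E * mu I + l%:E * mu J <= (b - a)%:E)%E.
  apply: (@le_trans _ _ ((1 - l)%:E * (sup I - inf I)%:E + l%:E * (sup J - inf J)%:E)%E).
    by apply: leeD; apply: lee_wpmul2l => //; rewrite lee_fin ltW.
  by rewrite -!EFinM -EFinD lee_fin /a /b; lra.
(* If [b <= a] the open interval is empty, but then [abE] bounds the left side by a nonpositive
   number. *)
case: ifPn => // ba; apply: (le_trans abE); rewrite lee_fin subr_le0.
by rewrite leNgt.
Qed.

(** The layer cake reduces the claim to [interval_minkowski] at each level. Normalising both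
    functions to supremum 1 is what makes their superlevel sets non-empty at the same levels. *)
Lemma normalized_bbl_line (l B : R) (f g h : R -> R) : 0 < l < 1 ->
  measurable_fun [set: R] f -> measurable_fun [set: R] g -> measurable_fun [set: R] h ->
  (forall x, 0 <= f x <= 1) -> (forall x, 0 <= g x <= 1) -> (forall x, 0 <= h x) ->
  (forall x, 0 < f x -> `|x| <= B) -> (forall x, 0 < g x -> `|x| <= B) ->
  (forall s : R, 0 < s < 1 -> [set x | s < f x] !=set0) ->
  (forall s : R, 0 < s < 1 -> [set x | s < g x] !=set0) ->
  (forall s : R, 0 < s < 1 -> is_interval [set x | s < f x]) ->
  (forall s : R, 0 < s < 1 -> is_interval [set x | s < g x]) ->
  (forall s x y : R, 0 < s < 1 -> s < f x -> s < g y -> s < h ((1 - l) * x + l * y)) ->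
  ((1 - l)%:E * \int[mu]_x (f x)%:E + l%:E * \int[mu]_x (g x)%:E <=
   \int[mu]_x (h x)%:E)%E.
Proof.
move=> l01 mf mg mh f01 g01 h0 fB gB fn gn fi gi fgh.
have f0 x : 0 <= f x by case/andP: (f01 x).
have g0 x : 0 <= g x by case/andP: (g01 x).
rewrite !integral_superlevel//.
have mlev (k : R -> R) : measurable_fun [set: R] k -> (forall x, 0 <= k x) ->
    measurable_fun [set: R] (fun t => mu [set z | t < k z]).
  move=> mk k0.
  pose A : set (measurableTypeR R * measurableTypeR R) := [set zs | zs.2 < k zs.1].
  have mA : measurable A.
    by apply: measurable_set_ltr => //; exact: measurableT_comp.
  have := @measurable_fun_ysection _ _ _ _ _ mu A mA.
  by rewrite /comp; under eq_fun do rewrite ysectionE.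
have lev1 (k : R -> R) : measurable_fun [set: R] k -> (forall x, 0 <= k x <= 1) ->
    (\int[mu]_(t in `]0%R, +oo[) mu [set z | (t < k z)%R] =
     \int[mu]_(t in `]0%R, 1%R[) mu [set z | (t < k z)%R])%E.
  move=> mk k01; rewrite integral_mkcond [RHS]integral_mkcond.
  apply: eq_integral => t _; rewrite /patch !mem_setE !in_itv/= andbT.
  case: ltP => //= t0; case: ltP => // t1.
  rewrite (_ : [set _ | _] = set0) ?measure0//; apply/seteqP; split => z //=.
  by move=> /lt_le_trans /(_ (andP (k01 z)).2); rewrite ltNge t1.
rewrite lev1// lev1//.
case/andP: (l01) => l0 l1; have l1' : 0 <= 1 - l by rewrite subr_ge0 ltW.
rewrite -ge0_integralZl//; last by apply: measurable_funTS; exact: mlev.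
rewrite -ge0_integralZl//; last 2 first.
- by apply: measurable_funTS; exact: mlev.
- by rewrite lee_fin ltW.
rewrite -ge0_integralD//; last 4 first.
- by move=> t _; rewrite mule_ge0// lee_fin.
- by apply: measurable_funTS; apply: measurable_funeM; exact: mlev.
- by move=> t _; rewrite mule_ge0// lee_fin ltW.
- by apply: measurable_funTS; apply: measurable_funeM; exact: mlev.
apply: (@le_trans _ _ (\int[mu]_(t in `]0%R, 1%R[) mu [set z | (t < h z)%R])%E);
  last first.
  apply: ge0_subset_integral => //; first by apply: measurable_funTS; exact: mlev.
  by move=> x; rewrite /= !in_itv/= andbT => /andP[].
apply: ge0_le_integral => //.
- by move=> t _; rewrite adde_ge0// mule_ge0// lee_fin// ltW.
- by apply: measurable_funTS; apply: emeasurable_funD; apply: measurable_funeM;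
  exact: mlev.
- by apply: measurable_funTS; exact: mlev.
move=> t; rewrite /= in_itv/= => t01; case/andP: (t01) => t0 t1.
apply: interval_minkowski => //; [exact: fn|exact: gn|exact: fi|exact: gi|..].
- by exists B => x /= tx; have := fB x (lt_trans t0 tx); rewrite ler_norml => /andP[].
- by exists (- B) => x /= tx; have := fB x (lt_trans t0 tx); rewrite ler_norml => /andP[].
- by exists B => x /= tx; have := gB x (lt_trans t0 tx); rewrite ler_norml => /andP[].
- by exists (- B) => x /= tx; have := gB x (lt_trans t0 tx); rewrite ler_norml => /andP[].
- exact: measurable_set_ltr.
- by move=> x y; exact: fgh.
Qed.

End bbl_line.

Section power_mean.
Context {R : realType}.
Notation mu := (@lebesgue_measure R).

(** The weighted mean of order [1 / m], so that [m] behaves as a dimension: integrating out one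
    variable replaces it by [m + 1]. Contrary to the usual convention it does not vanish when just
    one argument is 0, hence the positivity hypotheses in what follows. *)
Definition power_mean (m l a b : R) : R :=
  ((1 - l) * a `^ m^-1 + l * b `^ m^-1) `^ m.

Lemma powRK (m a : R) : 0 < m -> 0 <= a -> (a `^ m^-1) `^ m = a.
Proof. by move=> m0 a0; rewrite -powRrM mulVf ?gt_eqF// powRr1. Qed.

Lemma power_mean_gt0 (m l a b : R) : 0 < l < 1 -> 0 < a -> 0 < b ->
  0 < power_mean m l a b.
Proof.
move=> /andP[l0 l1] a0 b0; apply: powR_gt0.
by rewrite addr_gt0// mulr_gt0 ?powR_gt0// subr_gt0.
Qed.

Lemma power_mean_id (m l a : R) : 0 < m -> 0 <= a -> power_mean m l a a = a.
Proof. by move=> m0 a0; rewrite /power_mean -mulrDl subrK mul1r powRK. Qed.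

(** Homogeneity absorbs [s], and the mean is strictly increasing in each argument. This transports
    superlevel sets once the functions are divided by [F] and [G]. *)
Lemma power_mean_gt (m l s F G a b : R) : 0 < m -> 0 < l < 1 -> 0 < s ->
  0 < F -> 0 < G -> s * F < a -> s * G < b ->
  s * power_mean m l F G < power_mean m l a b.
Proof.
move=> m0 /andP[l0 l1] s0 F0 G0 Fa Gb; rewrite /power_mean.
have mi0 : 0 < m^-1 by rewrite invr_gt0.
rewrite -{1}[s](@powRK m) ?ltW// -powRM ?powR_ge0//; last first.
  by rewrite addr_ge0// mulr_ge0 ?powR_ge0// ?subr_ge0 ltW.
have l1' : 0 < 1 - l by rewrite subr_gt0.
have sF : (s * F) `^ m^-1 < a `^ m^-1.
  by apply: gt0_ltr_powR => //; rewrite nnegrE ltW// ?(lt_trans _ Fa)// mulr_gt0.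
have sG : (s * G) `^ m^-1 < b `^ m^-1.
  by apply: gt0_ltr_powR => //; rewrite nnegrE ltW// ?(lt_trans _ Gb)// mulr_gt0.
apply: gt0_ltr_powR => //; rewrite ?nnegrE.
- by rewrite mulr_ge0 ?powR_ge0// addr_ge0// mulr_ge0 ?powR_ge0// ltW.
- by rewrite addr_ge0// mulr_ge0 ?powR_ge0// ltW.
rewrite mulrDr mulrCA [s `^ _ * (l * _)]mulrCA -!powRM ?ltW//.
by rewrite ltrD// ltr_pM2l.
Qed.

(* Convexity of [t `^ (m + 1)], with weights proportional to
   [(1 - l) F `^ m^-1] and [l G `^ m^-1]. *)
Lemma power_mean_jensen (m l F G a b : R) : 0 < m -> 0 < l < 1 ->
  0 < F -> 0 < G -> 0 < a -> 0 < b ->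
  power_mean (m + 1) l a b <=
    power_mean m l F G * ((1 - l) * (a / F) + l * (b / G)).
Proof.
move=> m0 /andP[l0 l1] F0 G0 a0 b0; rewrite /power_mean.
have l1' : 0 < 1 - l by rewrite subr_gt0.
have m1 : 0 < m + 1 by rewrite addr_gt0.
set X := F `^ m^-1; set Y := G `^ m^-1.
set x := a `^ (m + 1)^-1; set y := b `^ (m + 1)^-1.
have X0 : 0 < X by exact: powR_gt0.
have Y0 : 0 < Y by exact: powR_gt0.
have x0 : 0 < x by exact: powR_gt0.
have y0 : 0 < y by exact: powR_gt0.
have XF : X `^ m = F by rewrite powRK// ltW.
have YG : Y `^ m = G by rewrite powRK// ltW.
have xa : x `^ (m + 1) = a by rewrite powRK// ltW.
have yb : y `^ (m + 1) = b by rewrite powRK// ltW.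
set P := (1 - l) * X + l * Y.
have P0 : 0 < P by rewrite addr_gt0// mulr_gt0.
pose w := (1 - l) * X / P.
have w01 : 0 <= w <= 1.
  apply/andP; split; first by rewrite ltW// divr_gt0// mulr_gt0.
  by rewrite ler_pdivrMr// mul1r lerDl ltW// mulr_gt0.
have w' : 1 - w = l * Y / P.
  apply: (mulIf (lt0r_neq0 P0)); rewrite mulrBl mul1r !divfK ?gt_eqF//.
  by rewrite /P addrAC subrr add0r.
case/andP: w01 => w0 w1.
have jen : (w * (x / X) + (1 - w) * (y / Y)) `^ (m + 1) <=
    w * (x / X) `^ (m + 1) + (1 - w) * (y / Y) `^ (m + 1).
  have m11 : 1 <= m + 1 by rewrite lerDr ltW.
  have ge0P (z : R) : 0 <= z -> z \in (`[0, +oo[%classic : set R).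
    by move=> z0; rewrite inE/= in_itv/= z0.
  have := convex_powR m11 (Itv01 w0 w1)
    (ge0P _ (divr_ge0 (ltW x0) (ltW X0))) (ge0P _ (divr_ge0 (ltW y0) (ltW Y0))).
  by rewrite !convRE.
have powD (z : R) : 0 < z -> z `^ (m + 1) = z `^ m * z.
  by move=> z0; rewrite powRD ?powRr1 ?ltW// (gt_eqF z0) implybT.
have -> : (1 - l) * x + l * y = P * (w * (x / X) + (1 - w) * (y / Y)).
  by rewrite w' /w; field; rewrite !gt_eqF.
have W0 : 0 <= w * (x / X) + (1 - w) * (y / Y).
  by rewrite addr_ge0// mulr_ge0 ?subr_ge0// divr_ge0// ltW.
rewrite (powRM _ (ltW P0) W0).
rewrite (powD P)// -(mulrA (P `^ m)) ler_pM2l ?powR_gt0//.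
apply: (le_trans (ler_wpM2l (ltW P0) jen)).
have quot (u v c : R) : 0 < u -> 0 < v -> c = u `^ (m + 1) ->
  v * (u / v) `^ (m + 1) = c / v `^ m.
  move=> u0 v0 ->.
  have vi : v^-1 `^ (m + 1) = (v `^ m * v)^-1.
    by rewrite -powD// -[v^-1]powR_inv1 ?ltW// -powRrM mulN1r powRN.
  rewrite powRM ?invr_ge0 ?ltW// vi.
  by field; rewrite !gt_eqF ?powR_gt0.
have e1 := quot _ _ _ x0 X0 (esym xa); have e2 := quot _ _ _ y0 Y0 (esym yb).
rewrite XF in e1; rewrite YG in e2.
rewrite -e1 -e2 w' /w le_eqVlt; apply/orP; left; apply/eqP.
have scale (c u : R) : P * (c / P * u) = c * u.
  by rewrite mulrA [P * _]mulrC divfK// gt_eqF.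
move: (_ `^ (m + 1)) ((y / Y) `^ _) => u v.
by rewrite mulrDr 2!scale -!(mulrA (1 - l)) -(mulrA l).
Qed.

Lemma integrable_bounded_support d (T : measurableType d)
    (nu : {measure set T -> \bar R}) (A : set T) (C : R) (f : T -> R) :
  measurable A -> (nu A < +oo)%E -> measurable_fun setT f ->
  (forall x, 0 <= f x <= C) -> (forall x, 0 < f x -> A x) ->
  nu.-integrable setT (EFin \o f).
Proof.
move=> mA Aoo mf fC fA.
have C0 x : f x <= C -> 0 <= f x -> 0 <= C by move=> h1 h2; exact: le_trans h1.
have [[x0]|/forallNP noT] := pselect (exists x : T, True); last first.
  rewrite (_ : setT = set0); first exact: integrable_set0.
  by apply/seteqP; split => x // _; have := noT x.
move=> _; have {}C0 : 0 <= C by case/andP: (fC x0) => h1 h2; exact: le_trans h1 h2.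
apply/integrableP; split; first exact/measurable_EFinP.
apply: (@le_lt_trans _ _ (\int[nu]_x (C * \1_A x)%:E)%E).
  apply: ge0_le_integral => //.
  - by apply: measurableT_comp => //; exact/measurable_EFinP.
  - by apply/measurable_EFinP; apply: measurable_funM => //; exact: measurable_indic.
  move=> x _; rewrite lee_fin ger0_norm ?(andP (fC x)).1//.
  have [fx|fx] := ltP 0 (f x); last by rewrite (le_trans fx)// mulr_ge0.
  by rewrite indicE mem_set ?mulr1; [case/andP: (fC x)|exact: fA].
under eq_integral do rewrite EFinM.
rewrite ge0_integralZl//; last by apply/measurable_EFinP; exact: measurable_indic.
by rewrite integral_indic// setIT lte_mul_pinfty.
Qed.

(** Divide [f] and [g] by their suprema [F] and [G], and [h] by [power_mean m l F G]. The normalised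
    case gives an arithmetic mean of the integrals, which [power_mean_jensen] converts into a mean
    of order [1 / (m + 1)]. The concavity assumed of [f] and of [g] makes their superlevel sets
    intervals. *)
Lemma bbl_line (m l B C : R) (f g h : R -> R) : 0 < m -> 0 < l < 1 ->
  measurable_fun [set: R] f -> measurable_fun [set: R] g -> measurable_fun [set: R] h ->
  (forall x, 0 <= f x <= C) -> (forall x, 0 <= g x <= C) -> (forall x, 0 <= h x <= C) ->
  (forall x, 0 < f x -> `|x| <= B) -> (forall x, 0 < g x -> `|x| <= B) ->
  (forall x, 0 < h x -> `|x| <= B) ->
  (forall t x y, 0 < t < 1 -> 0 < f x -> 0 < f y ->
    power_mean m t (f x) (f y) <= f ((1 - t) * x + t * y)) ->
  (forall t x y, 0 < t < 1 -> 0 < g x -> 0 < g y ->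
    power_mean m t (g x) (g y) <= g ((1 - t) * x + t * y)) ->
  (forall x y, 0 < f x -> 0 < g y ->
    power_mean m l (f x) (g y) <= h ((1 - l) * x + l * y)) ->
  0 < \int[mu]_x f x -> 0 < \int[mu]_x g x ->
  power_mean (m + 1) l (\int[mu]_x f x) (\int[mu]_x g x) <= \int[mu]_x h x.
Proof.
move=> m0 l01 mf mg mh fC gC hC fB gB hB ff gg fgh If Ig.
have intk (k : R -> R) : measurable_fun [set: R] k -> (forall x, 0 <= k x <= C) ->
    (forall x, 0 < k x -> `|x| <= B) -> mu.-integrable setT (EFin \o k).
  move=> mk kC kB; apply: (@integrable_bounded_support _ _ mu `[- B, B]%classic C) => //.
    by rewrite /= lebesgue_measure_itv/=; case: ifP => // _; rewrite -EFinD ltry.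
  by move=> x /kB; rewrite /= in_itv/= ler_norml.
have supk (k : R -> R) : (forall x, 0 <= k x <= C) -> 0 < \int[mu]_x k x ->
    has_sup (range k) /\ 0 < sup (range k).
  move=> kC Ik; have hs : has_sup (range k).
    split; first by exists (k 0), 0.
    by exists C => _ [x _ <-]; case/andP: (kC x).
  split => //; rewrite ltNge; apply/negP => sk0; move: Ik.
  rewrite (_ : k = cst 0); first by rewrite Rintegral_cst//= mul0r ltxx.
  apply/funext => x /=; apply/eqP; rewrite eq_le (andP (kC x)).1 andbT.
  by apply: le_trans sk0; apply: ub_le_sup; [exact: hs.2|exists x].
have quasi (k : R -> R) : (forall t x y, 0 < t < 1 -> 0 < k x -> 0 < k y ->
    power_mean m t (k x) (k y) <= k ((1 - t) * x + t * y)) ->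
    forall s, 0 < s -> is_interval [set x | s < k x].
  move=> kk s s0 x y /= kx ky z /andP[]; rewrite le_eqVlt => /predU1P[<-//|xz].
  rewrite le_eqVlt => /predU1P[->//|zy].
  have xy : 0 < y - x by rewrite subr_gt0 (lt_trans xz).
  pose t := (z - x) / (y - x).
  have t01 : 0 < t < 1.
    apply/andP; split; rewrite /t; first by rewrite divr_gt0// subr_gt0.
    by rewrite ltr_pdivrMr// mul1r ltrD2r.
  have -> : z = (1 - t) * x + t * y.
    have : z = x + t * (y - x) by rewrite /t divfK ?gt_eqF// addrC subrK.
    by move=> ->; ring.
  apply: lt_le_trans (kk _ _ _ t01 (lt_trans s0 kx) (lt_trans s0 ky)).
  (* With [F = G = 1]: the mean of two values above [s] is above [s]. *)
  have := @power_mean_gt m t s 1 1 (k x) (k y) m0 t01 s0 ltr01 ltr01.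
  by rewrite power_mean_id// !mulr1; apply.
have [hsF F0] := supk _ fC If; have [hsG G0] := supk _ gC Ig.
set F := sup _ in F0; set G := sup _ in G0.
pose M := power_mean m l F G.
have M0 : 0 < M by exact: power_mean_gt0.
have kF (k : R -> R) (S : R) : measurable_fun [set: R] k -> (forall x, 0 <= k x <= C) ->
    (forall x, 0 < k x -> `|x| <= B) -> 0 < S ->
    (\int[mu]_x (k x / S)%:E = (\int[mu]_x k x / S)%:E)%E.
  move=> mk kC kB S0; rewrite -RintegralZr//; last exact: intk.
  rewrite /Rintegral fineK//; apply: integrable_fin_num => //.
  by apply: eq_integrable (integrableZr measurableT S^-1 (intk _ mk kC kB)).
have := @normalized_bbl_line R l B (fun x => f x / F) (fun x => g x / G) (fun x =>
  h x / M) l01.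
rewrite !kF// -!EFinM -EFinD lee_fin => key.
apply: (le_trans (power_mean_jensen m0 l01 F0 G0 If Ig)).
rewrite -/M [M * _]mulrC -ler_pdivlMr//; apply: key => {kF}.
- by apply: measurable_funM.
- by apply: measurable_funM.
- by apply: measurable_funM.
- move=> x; apply/andP; split; first by rewrite divr_ge0 ?(ltW F0) ?(andP (fC x)).1.
  by rewrite ler_pdivrMr// mul1r; apply: ub_le_sup; [exact: hsF.2|exists x].
- move=> x; apply/andP; split; first by rewrite divr_ge0 ?(ltW G0) ?(andP (gC x)).1.
  by rewrite ler_pdivrMr// mul1r; apply: ub_le_sup; [exact: hsG.2|exists x].
- by move=> x; rewrite divr_ge0 ?(ltW M0) ?(andP (hC x)).1.
- by move=> x; rewrite pmulr_lgt0 ?invr_gt0//; exact: fB.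
- by move=> x; rewrite pmulr_lgt0 ?invr_gt0//; exact: gB.
- move=> s /andP[s0 s1]; have : s * F < F by rewrite gtr_pMl.
  by move=> /(sup_gt hsF.1)[_ [x _ <-] sx]; exists x; rewrite /= ltr_pdivlMr.
- move=> s /andP[s0 s1]; have : s * G < G by rewrite gtr_pMl.
  by move=> /(sup_gt hsG.1)[_ [x _ <-] sx]; exists x; rewrite /= ltr_pdivlMr.
- move=> s /andP[s0 _]; rewrite (_ : [set _ | _] = [set x | s * F < f x]).
    by apply: quasi => //; rewrite mulr_gt0.
  by apply/seteqP; split => x /=; rewrite ltr_pdivlMr.
- move=> s /andP[s0 _]; rewrite (_ : [set _ | _] = [set x | s * G < g x]).
    by apply: quasi => //; rewrite mulr_gt0.
  by apply/seteqP; split => x /=; rewrite ltr_pdivlMr.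
move=> s x y /andP[s0 _]; rewrite !ltr_pdivlMr// => sf sg.
apply: lt_le_trans (fgh _ _ (lt_trans (mulr_gt0 s0 F0) sf) (lt_trans (mulr_gt0 s0 G0)
  sg)).
exact: power_mean_gt.
Qed.

End power_mean.

(** * Induction on the dimension *)

Section bbl_rV.
Context {R : realType}.
Notation mu := (@lebesgue_measure R).

Definition bbl n (m l : R) (f g h : 'rV[R]_n -> R) :=
  forall x y, 0 < f x -> 0 < g y ->
    power_mean m l (f x) (g y) <= h ((1 - l) *: x + l *: y).

(** The bounds [C] and [B] keep every integral of the induction finite. They pass unchanged to
    sections; integrating out variables keeps [B] and multiplies [C] by the volume of a box. *)
Record mconcave n (m C B : R) (f : 'rV[R]_n -> R) : Prop := MConcave {
  mconcave_measurable : measurable_fun setT f ;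
  mconcave_bounded : forall x, 0 <= f x <= C ;
  mconcave_support : forall x, 0 < f x -> forall i, `|x ord0 i| <= B ;
  mconcave_bbl : forall t, 0 < t < 1 -> bbl m t f f f }.

Definition box n (B : R) : set 'rV[R]_n := [set x | forall i, x ord0 i \in `[- B, B]].

Lemma measurable_box n (B : R) : measurable (@box n B).
Proof.
rewrite (_ : @box n B = \bigcap_(i in [set: 'I_n])
    (@rV_coord R n i @^-1` `[- B, B]%classic)).
  apply: fin_bigcap_measurable => // i _.
  by rewrite -[X in measurable X]setTI; exact: measurable_rV_coord.
by apply/seteqP; split => [x H i _|x H i] /=; [exact: H|exact: (H i I)].
Qed.

Lemma lebesgue_rV_cube n (B : R) : 0 <= B ->
  lebesgue_rV R n (@box n B) = ((B *+ 2) ^+ n)%:E.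
Proof.
move=> B0; rewrite lebesgue_rV_box; last by move=> i; rewrite ge0_cp.
by rewrite prodr_const card_ord opprK mulr2n.
Qed.

Lemma mconcave_integrable n (m C B : R) (f : 'rV[R]_n -> R) : 0 <= B ->
  mconcave m C B f -> (lebesgue_rV R n).-integrable setT (EFin \o f).
Proof.
move=> B0 [mf fC fB _].
apply: (@integrable_bounded_support _ _ _ (lebesgue_rV R n) (@box n B) C) => //.
- exact: measurable_box.
- by rewrite /= lebesgue_rV_cube// ltry.
- by move=> x fx i; rewrite in_itv/= -ler_norml; exact: fB.
Qed.

Lemma mconcave_integral_le n (m C B : R) (f : 'rV[R]_n -> R) : 0 <= B ->
  mconcave m C B f ->
  0 <= \int[lebesgue_rV R n]_x f x <= C * (B *+ 2) ^+ n.
Proof.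
move=> B0 mcf; have [mf fC fB _] := mcf.
have intf := mconcave_integrable B0 mcf.
apply/andP; split; first by apply: Rintegral_ge0 => x _; case/andP: (fC x).
have C0 : 0 <= C by case/andP: (fC 0) => h1 h2; exact: le_trans h1 h2.
rewrite -lee_fin /Rintegral fineK; last exact: integrable_fin_num.
apply: (@le_trans _ _ (\int[lebesgue_rV R n]_x (C%:E * (\1_(@box n B) x)%:E))%E).
  apply: ge0_le_integral => //.
  - by move=> x _; rewrite lee_fin; case/andP: (fC x).
  - exact/measurable_EFinP.
  - apply: measurable_funeM; apply/measurable_EFinP; apply: measurable_indic.
    exact: measurable_box.
  move=> x _; rewrite -EFinM lee_fin.
  have [fx|fx] := ltP 0 (f x); last by rewrite (le_trans fx)// mulr_ge0.
  rewrite indicE mem_set ?mulr1; first by case/andP: (fC x).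
  by move=> i; rewrite in_itv/= -ler_norml; exact: fB.
rewrite ge0_integralZl//; last first.
  by apply/measurable_EFinP; apply: measurable_indic; exact: measurable_box.
rewrite integral_indic//; last exact: measurable_box.
by rewrite setIT /= lebesgue_rV_cube// -EFinM.
Qed.

Lemma measurable_marginal d (T : measurableType d) n (f : T * 'rV[R]_n -> R) :
  measurable_fun setT f -> (forall z, 0 <= f z) ->
  measurable_fun setT (fun t => \int[lebesgue_rV R n]_y f (t, y)).
Proof.
move=> mf f0; rewrite /Rintegral.
apply: measurableT_comp => //.
have mF := @measurable_fun_fubini_tonelli_F _ _ _ _ _ (lebesgue_rV R n) (EFin \o f).
by apply: mF => //; exact/measurable_EFinP.
Qed.

Lemma rV_cons_head n (t : R) (y : 'rV[R]_n) : rV_cons (t, y) ord0 ord0 = t.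
Proof.
rewrite (_ : ord0 = @lshift 1 n ord0 :> 'I_n.+1); last exact: val_inj.
by rewrite /rV_cons (@row_mxEl _ 1 1 n) mxE.
Qed.

Lemma rV_cons_tail n (t : R) (y : 'rV[R]_n) i : rV_cons (t,
  y) ord0 (lift ord0 i) = y ord0 i.
Proof.
rewrite (_ : lift ord0 i = @rshift 1 n i :> 'I_n.+1); last exact: val_inj.
by rewrite /rV_cons (@row_mxEr _ 1 1 n).
Qed.

Lemma rV_consD n (a b s t : R) (x y : 'rV[R]_n) :
  a *: rV_cons (s, x) + b *: rV_cons (t, y) =
  rV_cons (a * s + b * t, a *: x + b *: y) :> 'rV[R]_n.+1.
Proof.
apply/rowP => i; rewrite mxE [X in X + _]mxE [X in _ + X]mxE.
by case: (unliftP ord0 i) => [j|] ->; rewrite ?rV_cons_tail ?rV_cons_head// !mxE.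
Qed.

Lemma mconcave_section n (m C B : R) (f : 'rV[R]_n.+1 -> R) t :
  mconcave m C B f -> mconcave m C B (fun y => f (rV_cons (t, y))).
Proof.
move=> [mf fC fB ff]; split.
- apply: (measurableT_comp mf).
  by apply: (measurableT_comp (@measurable_rV_cons R n)); exact: measurable_pair1.
- by move=> x; exact: fC.
- by move=> y fy i; have := fB _ fy (lift ord0 i); rewrite rV_cons_tail.
move=> s s01 x y fx fy; apply: le_trans (ff _ s01 _ _ fx fy) _.
by rewrite rV_consD -mulrDl subrK mul1r.
Qed.

(** Fix the first coordinate: the induction hypothesis on the sections says that the three marginals
    satisfy the hypotheses of [bbl_line] with exponent [m + n], and the line adds the last unit.
    Since [bbl_line] also wants each marginal of [f] and [g] to be concave, concavity is carried
    along. *)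
Lemma bbl_rV n (m C B l : R) (f g h : 'rV[R]_n -> R) :
  0 < m -> 0 <= B -> 0 < l < 1 ->
  mconcave m C B f -> mconcave m C B g -> mconcave m C B h -> bbl m l f g h ->
  0 < \int[lebesgue_rV R n]_x f x -> 0 < \int[lebesgue_rV R n]_x g x ->
  power_mean (m + n%:R) l (\int[lebesgue_rV R n]_x f x) (\int[lebesgue_rV R n]_x g x)
    <= \int[lebesgue_rV R n]_x h x.
Proof.
move=> m0 B0; elim: n l f g h => [|n IH] l f g h l01 cf cg ch fgh.
  (* In dimension 0 the measure is a unit mass at the only point. *)
  have int0 (k : 'rV[R]_0 -> R) : mconcave m C B k -> \int[lebesgue_rV R 0]_x k x = k 0.
    move=> [mk _ _ _]; rewrite /Rintegral /= integral_dirac//;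
      last exact/measurable_EFinP.
    by rewrite diracT mul1e.
  rewrite !int0// addr0 => f0 g0; have := fgh _ _ f0 g0.
  by rewrite !scaler0 addr0.
pose marg (k : 'rV[R]_n.+1 -> R) (t : R) := \int[lebesgue_rV R n]_y k (rV_cons (t, y)).
have intE (k : 'rV[R]_n.+1 -> R) : mconcave m C B k ->
    \int[lebesgue_rV R n.+1]_x k x = \int[mu]_t marg k t.
  move=> ck; have [mk kC kB _] := ck; rewrite /Rintegral; congr fine.
  have k0 x : (0 <= (k x)%:E)%E by rewrite lee_fin; case/andP: (kC x).
  rewrite [LHS](@ge0_integral_pushforward _ _ _ _ _ _ (@measurable_rV_cons R n)
    (mu \x lebesgue_rV R n)%E setT (EFin \o k));
    [|exact: measurableT|exact/measurable_EFinP|by move=> y _; exact: k0].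
  rewrite preimage_setT fubini_tonelli1; last 2 first.
  - apply: (measurableT_comp (f := EFin \o k)); last exact: measurable_rV_cons.
    exact/measurable_EFinP.
  - by move=> z; exact: k0.
  apply: eq_integral => t _; rewrite /fubini_F /= /marg /Rintegral fineK//.
  apply: integrable_fin_num => //.
  exact: (mconcave_integrable B0 (mconcave_section t ck)).
have margC (k : 'rV[R]_n.+1 -> R) : mconcave m C B k ->
    [/\ measurable_fun [set: R] (marg k), forall t, 0 <= marg k t <= C * (B *+ 2) ^+ n &
        forall t, 0 < marg k t -> `|t| <= B].
  move=> ck; have [mk kC kB _] := ck; split.
  - apply: (@measurable_marginal _ (measurableTypeR R) n (k \o @rV_cons R n)).
      by apply: (measurableT_comp mk); exact: measurable_rV_cons.
    by move=> z /=; case/andP: (kC (rV_cons z)).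
  - by move=> t; exact: (mconcave_integral_le B0 (mconcave_section t ck)).
  - move=> t; rewrite leNgt => kt; apply/negP => Bt; move: kt.
    rewrite /marg (_ : (fun _ => _) = cst 0) ?Rintegral_cst//= ?mul0r ?ltxx//.
    apply/funext => y; apply/eqP; rewrite eq_le (andP (kC _)).1 andbT leNgt.
    apply/negP => /kB/(_ ord0); rewrite rV_cons_head.
    by rewrite leNgt Bt.
have mn : 0 < m + n%:R by rewrite ltr_wpDr.
have [mF FC FB] := margC _ cf; have [mG GC GB] := margC _ cg;
  have [mH HC HB] := margC _ ch.
rewrite !intE// -addn1 natrD addrA.
apply: (@bbl_line R (m + n%:R) l B (C * (B *+ 2) ^+ n)) => //.
(* Concavity of the marginal of [f]: the induction hypothesis for three sections of the same
   function. *)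
- move=> t x y t01 Fx Fy; apply: (IH t _ _ _ t01) => //; try exact: mconcave_section.
  move=> u v fu fv; rewrite -rV_consD; exact: (mconcave_bbl cf t01).
- move=> t x y t01 Fx Fy; apply: (IH t _ _ _ t01) => //; try exact: mconcave_section.
  move=> u v fu fv; rewrite -rV_consD; exact: (mconcave_bbl cg t01).
- move=> x y Fx Fy; apply: (IH l) => //; try exact: mconcave_section.
  by move=> u v fu fv; rewrite -rV_consD; exact: fgh.
Qed.

End bbl_rV.

(** * Convex bodies and the tails of their difference *)

Section rV_topology.
Context {R : realType} (n : nat).
Implicit Types K U : set 'rV[R]_n.

(** The sigma-algebra is generated by the coordinates, so an open set has to be exhibited as a
    countable union of boxes: those with rational centre and radius [1 / (k + 1)] that it
    contains. *)
Lemma open_rV_measurable U : open U -> measurable U.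
Proof.
move=> oU.
pose D (q : 'rV[rat]_n) (k : nat) : set 'rV[R]_n :=
  [set y | forall i, `|y ord0 i - ratr (q ord0 i)| < k.+1%:R^-1].
have mD q k : measurable (D q k).
  rewrite (_ : D q k = \bigcap_(i in [set: 'I_n])
      [set y | `|@rV_coord R n i y - ratr (q ord0 i)| < k.+1%:R^-1]).
    apply: fin_bigcap_measurable => // i _; apply: measurable_set_ltr => //.
    apply: measurableT_comp => //; apply: measurable_funB => //.
    exact: measurable_rV_coord.
  by apply/seteqP; split => [x H i _|x H i] /=; [exact: H|exact: (H i I)].
pose J : set ('rV[rat]_n * nat) := [set qk | D qk.1 qk.2 `<=` U].
have -> : U = \bigcup_(qk : 'rV[rat]_n * nat) (if qk \in J then D qk.1 qk.2 else set0).
  apply/seteqP; split => [x Ux|x [qk _]]; last first.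
    by case: ifPn => // /set_mem h; exact: h.
  have /nbhs_ballP[e /= e0 xeU] : nbhs x U by exact: open_nbhs_nbhs.
  (* Half of [e], since [x] and the points of the box are each within the radius of the rational
     centre. *)
  have [k ke] := ltr_add_invr (y := 0) (divr_gt0 e0 (ltr0n R 2)).
  rewrite add0r in ke.
  have k0 : 0 < k.+1%:R^-1 :> R by rewrite invr_gt0.
  have /choice[q qx] : forall i : 'I_n, exists q : rat, `|x ord0 i - ratr q| < k.+1%:R^-1.
    move=> i; have [|q] := @rat_in_itvoo R (x ord0 i -
      k.+1%:R^-1) (x ord0 i + k.+1%:R^-1).
      by rewrite ltrD2l (lt_trans _ k0)// oppr_lt0.
    by rewrite in_itv/= => /andP[h1 h2]; exists q; rewrite ltr_distlC h1.
  exists (\row_i q i, k) => //.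
  have DU : D (\row_i q i) k `<=` U.
    move=> y Dy; apply: xeU; split => // i j; rewrite ord1 /ball/=.
    have := Dy j; have := qx j; rewrite mxE => h1 h2.
    rewrite (_ : x 0 j - y 0 j = (x 0 j - ratr (q j)) - (y 0 j - ratr (q j)));
      last by ring.
    apply: (le_lt_trans (ler_normB _ _)); rewrite [e]splitr.
    by rewrite ltrD// (lt_trans _ ke).
  rewrite ifT; last exact/mem_set.
  by move=> i /=; rewrite mxE.
apply: countable_bigcupT_measurable; first exact: countableP.
by move=> qk; case: ifPn.
Qed.

Lemma compact_rV_measurable K : compact K -> measurable K.
Proof.
move=> cK; rewrite -(setCK K); apply: measurableC; apply: open_rV_measurable.
by apply: closed_openC; apply: compact_closed => //; exact: norm_hausdorff.
Qed.

Lemma compact_rV_bounded K : compact K -> exists2 B, 0 <= B & K `<=` box B.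
Proof.
move=> /compact_bounded[M [_ KM]].
pose B := Num.max M 0 + 1.
have MB : M < B by rewrite /B (le_lt_trans (y := Num.max M 0)) ?le_max ?lexx// ltrDl.
have B0 : 0 <= B by rewrite /B addr_ge0// le_max lexx orbT.
exists (B + 1); first by rewrite addr_ge0.
move=> x Kx i; rewrite in_itv/= -ler_norml.
have : ball x (B + 1) 0.
  by rewrite mx_norm_ball /ball_/= subr0 (le_lt_trans (KM _ MB _ Kx))// ltrDl.
by move=> [_ /(_ ord0 i)]; rewrite /ball/= mxE subr0 => /ltW.
Qed.

Definition cbox (c : 'rV[R]_n) (d : R) : set 'rV[R]_n :=
  [set x | forall i, x ord0 i \in `[c ord0 i - d, c ord0 i + d]].

Lemma measurable_cbox c d : measurable (cbox c d).
Proof.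
rewrite (_ : cbox c d = \bigcap_(i in [set: 'I_n])
    (@rV_coord R n i @^-1` `[c ord0 i - d, c ord0 i + d]%classic)).
  apply: fin_bigcap_measurable => // i _.
  by rewrite -[X in measurable X]setTI; exact: measurable_rV_coord.
by apply/seteqP; split => [x H i _|x H i] /=; [exact: H|exact: (H i I)].
Qed.

Lemma lebesgue_rV_cbox_gt0 c d : 0 < d -> (0 < lebesgue_rV R n (cbox c d))%E.
Proof.
move=> d0; rewrite /= lebesgue_rV_box.
  rewrite lte_fin; apply: prodr_gt0 => i _.
  by rewrite opprD opprK addrACA subrr add0r addr_gt0.
by move=> i; rewrite lerD2l ge0_cp// ltW.
Qed.

Lemma interior_rV_box K : interior K !=set0 ->
  exists c, exists2 d : R, 0 < d & cbox c d `<=` K.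
Proof.
move=> [x0 /nbhs_ballP[e /= e0 xeK]]; exists x0, (e / 2); first by rewrite divr_gt0.
move=> x xi; apply: xeK; split => // i j; rewrite ord1 /ball/=.
have := xi j; rewrite in_itv/= -ler_distlC => /le_lt_trans; apply.
by rewrite ltr_pdivrMr// ltr_pMr// ltr1n.
Qed.

Lemma convex_body_combo K x y l : convex_body K -> K x -> K y -> 0 < l < 1 ->
  K ((1 - l) *: x + l *: y).
Proof.
move=> [_ cK _] Kx Ky /andP[/ltW l0 /ltW l1].
have := cK y x (Itv01 l0 l1) (mem_set Ky) (mem_set Kx) => /set_mem.
by rewrite addrC; apply.
Qed.

Lemma convex_body_vol K : convex_body K ->
  [/\ measurable K, (lebesgue_rV R n K < +oo)%E & 0 < vol K].
Proof.
move=> [cK _ iK].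
have mK := compact_rV_measurable cK.
have [B B0 KB] := compact_rV_bounded cK.
have fK : (lebesgue_rV R n K < +oo)%E.
  apply: (@le_lt_trans _ _ (lebesgue_rV R n (box B))).
    by apply: le_measure; rewrite ?inE//; exact: measurable_box.
  by rewrite /= lebesgue_rV_cube// ltry.
split => //; have [x0 [d d0 dK]] := interior_rV_box iK.
apply: fine_gt0; rewrite fK andbT.
apply: (lt_le_trans (lebesgue_rV_cbox_gt0 x0 d0)).
by apply: le_measure; rewrite ?inE//; exact: measurable_cbox.
Qed.

End rV_topology.

(** * Brunn-Minkowski for pairs of points *)

Section directional_tail.
Context {R : realType} (n : nat) (K : set 'rV[R]_n) (theta : 'rV[R]_n).
Hypothesis hK : convex_body K.

Definition gap (z : 'rV[R]_n * 'rV[R]_n) : R := dotp (z.1 - z.2) theta.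

Definition halfspace_pairs (s : R) : set ('rV[R]_n * 'rV[R]_n) :=
  [set z | [/\ K z.1, K z.2 & s <= gap z]].

Notation leb := (lebesgue_rV R n).
Notation H := halfspace_pairs.

Definition tail (s : R) : R := fine ((leb \x leb)%E (H s)).

Lemma measurable_dotp d (T : measurableType d) (f : T -> 'rV[R]_n) (y : 'rV[R]_n) :
  measurable_fun setT f -> measurable_fun setT (fun x => dotp (f x) y).
Proof.
move=> mf; rewrite /dotp; apply: measurable_sum => i.
apply: measurable_funM => //.
exact: (measurableT_comp (@measurable_rV_coord R n i) mf).
Qed.

Lemma dotpDl (x y z : 'rV[R]_n) : dotp (x + y) z = dotp x z + dotp y z.
Proof. by rewrite /dotp -big_split/=; apply: eq_bigr => i _; rewrite mxE mulrDl. Qed.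

Lemma dotpNl (x z : 'rV[R]_n) : dotp (- x) z = - dotp x z.
Proof. by rewrite /dotp -sumrN; apply: eq_bigr => i _; rewrite mxE mulNr. Qed.

Lemma dotpZl (a : R) (x z : 'rV[R]_n) : dotp (a *: x) z = a * dotp x z.
Proof. by rewrite /dotp mulr_sumr; apply: eq_bigr => i _; rewrite mxE mulrA. Qed.

Lemma dotpC (x y : 'rV[R]_n) : dotp x y = dotp y x.
Proof. by rewrite /dotp; apply: eq_bigr => i _; rewrite mulrC. Qed.

Lemma gapE z : gap z = dotp z.1 theta - dotp z.2 theta.
Proof. by rewrite /gap dotpDl dotpNl. Qed.

Lemma measurable_gap : measurable_fun setT gap.
Proof.
rewrite (_ : gap = fun z => dotp z.1 theta - dotp z.2 theta); last exact/funext/gapE.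
by apply: measurable_funB; exact: measurable_dotp.
Qed.

Lemma measurable_body_pairs : measurable (K `*` K).
Proof. by have [mK _ _] := convex_body_vol hK; exact: measurableX. Qed.

Lemma measurable_halfspace_pairs s : measurable (H s).
Proof.
rewrite (_ : H s = (K `*` K) `&` [set z | cst s z <= gap z]).
  by apply: measurableI; [exact: measurable_body_pairs|apply: measurable_set_ler => //;
    exact: measurable_gap].
by apply/seteqP; split => [z [h1 h2 h3]|z [[h1 h2] h3]].
Qed.

Lemma body_pairs_volE : (leb \x leb)%E (K `*` K) = (vol K ^+ 2)%:E.
Proof.
have [mK fK _] := convex_body_vol hK.
have vE : leb K = (vol K)%:E by rewrite /vol fineK// ge0_fin_numE.
rewrite product_measure1E//.
by rewrite [X in (X * _)%E]vE [X in (_ * X)%E]vE -EFinM.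
Qed.

Lemma halfspace_pairs_fin s : (leb \x leb)%E (H s) \is a fin_num.
Proof.
rewrite ge0_fin_numE//; apply: (@le_lt_trans _ _ ((leb \x leb)%E (K `*` K))).
  apply: le_measure; rewrite ?inE.
  - exact: measurable_halfspace_pairs.
  - exact: measurable_body_pairs.
  - by move=> z [h1 h2 _].
by rewrite body_pairs_volE ltry.
Qed.

Lemma tailE s : (leb \x leb)%E (H s) = (tail s)%:E.
Proof. by rewrite /tail fineK// halfspace_pairs_fin. Qed.

Lemma tail_ge0 s : 0 <= tail s.
Proof. by apply: fine_ge0; exact: measure_ge0. Qed.

Let kk (s : R) (z : 'rV[R]_n * 'rV[R]_n) : R := \1_(H s) z.

Let kk_gt0 s z : 0 < kk s z -> H s z.
Proof. by rewrite /kk indicE; case: (boolP (z \in H s)) => [/set_mem//|_];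
  rewrite ltxx. Qed.

Let kk1 s z : H s z -> kk s z = 1.
Proof. by move=> h; rewrite /kk indicE mem_set. Qed.

Let marg (s : R) (x : 'rV[R]_n) : R := \int[leb]_y kk s (x, y).

(** The mean of 1 and 1 is 1 whatever the exponent, so only an inclusion of sets is at stake; it
    follows from the convexity of [K] and the linearity of [gap]. *)
Let kk_bbl (m l s0 s1 : R) x x' : 0 < m -> 0 < l < 1 ->
  bbl m l (fun y => kk s0 (x, y)) (fun y => kk s1 (x', y))
    (fun y => kk ((1 - l) * s0 + l * s1) ((1 - l) *: x + l *: x', y)).
Proof.
move=> m0 l01 y y' /kk_gt0 h /kk_gt0 h'; rewrite !kk1//; last first.
  case: h => /= Kx Ky sxy; case: h' => /= Kx' Ky' sxy'; split => /=.
  - exact: convex_body_combo.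
  - exact: convex_body_combo.
  rewrite !gapE /= in sxy sxy' *; rewrite !dotpDl !dotpZl.
  case/andP: l01 => l0 l1.
  have l1' : 0 <= 1 - l by rewrite subr_ge0 ltW.
  have := lerD (ler_wpM2l l1' sxy) (ler_wpM2l (ltW l0) sxy').
  by move=> /le_trans; apply; lra.
by rewrite power_mean_id.
Qed.

Let convc (V : lmodType R) (t : R) (x : V) : (1 - t) *: x + t *: x = x.
Proof. by rewrite -scalerDl subrK scale1r. Qed.

(** [bbl_rV] is applied twice to indicators, in [y] for fixed [x] and then in [x], each time adding
    [n] to the exponent. It requires a positive exponent to start with, and this is [e]. *)
Lemma tail_brunn_minkowski_gt (e l s0 s1 : R) : 0 < e -> 0 < l < 1 ->
  0 < tail s0 -> 0 < tail s1 ->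
  power_mean (e + n%:R + n%:R) l (tail s0) (tail s1) <= tail ((1 - l) * s0 + l * s1).
Proof.
move=> e0 l01; have [cK _ _] := hK; have [B B0 KB] := compact_rV_bounded cK.
have mkk s : measurable_fun setT (kk s).
  by apply: measurable_indic; exact: measurable_halfspace_pairs.
have ck s x : mconcave e 1 B (fun y => kk s (x, y)).
  split.
  - by apply: (measurableT_comp (mkk s)); exact: measurable_pair1.
  - by move=> y; rewrite /kk indicE; case: (_ \in _); rewrite /= ?ler01 ?lexx.
  - by move=> y /kk_gt0[_ /= Ky _] i; have := KB _ Ky i; rewrite in_itv/= -ler_norml.
  - move=> t t01 y y' ky ky'; have := @kk_bbl e t s s x x e0 t01 y y' ky ky'.
    rewrite (_ : (1 - t) * s + t * s = s); last by ring.
    by rewrite convc.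
have ne : 0 < e + n%:R by rewrite ltr_wpDr.
(* The outer application needs concave marginals; these come from the inner one taken at two equal
   levels. *)
have cm s : mconcave (e + n%:R) (1 * (B *+ 2) ^+ n) B (marg s).
  split.
  - by apply: measurable_marginal => // z; rewrite /kk indicE.
  - by move=> x; exact: mconcave_integral_le (ck s x).
  - move=> x; have [Kx|nKx] := pselect (K x).
      by move=> _ i; have := KB _ Kx i; rewrite in_itv/= -ler_norml.
    rewrite /marg (_ : (fun _ => _) = cst 0) ?Rintegral_cst//= ?mul0r ?ltxx//.
    by apply/funext => y; rewrite /kk indicE memNset// => -[].
  - move=> t t01 x x' mx mx'.
    apply: (bbl_rV e0 B0 t01 (ck s x) (ck s x') (ck s _)) => //.
    have := @kk_bbl e t s s x x' e0 t01.
    by rewrite (_ : (1 - t) * s + t * s = s)//; ring.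
have tailI s : tail s = \int[leb]_x marg s x.
  rewrite /tail /Rintegral; congr fine.
  transitivity (\int[(leb \x leb)%E]_z (kk s z)%:E)%E.
    by rewrite integral_indic ?setIT//; exact: measurable_halfspace_pairs.
  rewrite fubini_tonelli1; last 2 first.
  - apply/measurable_EFinP; exact: mkk.
  - by move=> z; rewrite lee_fin /kk indicE.
  apply: eq_integral => x _; rewrite /fubini_F /= /marg /Rintegral fineK//.
  by apply: integrable_fin_num => //; exact: mconcave_integrable (ck s x).
rewrite !tailI => t0 t1; apply: (bbl_rV ne B0 l01 (cm s0) (cm s1) (cm _)) => //.
move=> x x' mx mx'.
apply: (bbl_rV e0 B0 l01 (ck s0 x) (ck s1 x') (ck _ _)) => //.
exact: kk_bbl.
Qed.

End directional_tail.

(** Continuity in the exponent, which lets [e] tend to 0 in [tail_brunn_minkowski_gt]. All bases are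
    positive, so the powers are exponentials of logarithms. *)
Lemma cvg_power_mean (R : realType) (m l a b : R) (e : nat -> R) : 0 < m -> 0 < l < 1 ->
  0 < a -> 0 < b -> e k @[k --> \oo] --> m ->
  power_mean (e k) l a b @[k --> \oo] --> power_mean m l a b.
Proof.
move=> m0 l01 a0 b0 em.
have ei : (e k)^-1 @[k --> \oo] --> m^-1 by apply: cvgV => //; rewrite gt_eqF.
have pw (c : R) : 0 < c -> c `^ (e k)^-1 @[k --> \oo] --> c `^ m^-1.
  move=> c0; have pE x : c `^ x = expR (x * ln c) by rewrite /powR gt_eqF.
  under eq_fun do rewrite pE.
  rewrite pE; apply: continuous_cvg; first exact: continuous_expR.
  exact: cvgMl.
pose S (x : R) := (1 - l) * a `^ x^-1 + l * b `^ x^-1.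
have S0 x : 0 < S x.
  by case/andP: l01 => l0 l1; rewrite addr_gt0// mulr_gt0 ?powR_gt0// subr_gt0.
have SS : S (e k) @[k --> \oo] --> S m.
  by apply: cvgD; apply: cvgMr; exact: pw.
have pE x : power_mean x l a b = expR (x * ln (S x)).
  by rewrite /power_mean /powR -/(S x) gt_eqF.
under eq_fun do rewrite pE.
rewrite pE; apply: continuous_cvg; first exact: continuous_expR.
apply: cvgM => //; apply: continuous_cvg => //.
exact: continuous_ln.
Qed.

Section tail_properties.
Context {R : realType} (n : nat) (K : set 'rV[R]_n) (theta : 'rV[R]_n).
Hypotheses (n_gt0 : (0 < n)%N) (hK : convex_body K) (htheta : unit_sphere theta).
Notation leb := (lebesgue_rV R n).
Notation H := (halfspace_pairs K theta).
Notation tail := (tail K theta).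
Notation gap := (gap theta).

(** The right side of [tail_brunn_minkowski_gt] does not involve [e]; take [e = 1 / (k + 1)] and
    pass to the limit. *)
Lemma tail_brunn_minkowski l s0 s1 : 0 < l < 1 ->
  0 < tail s0 -> 0 < tail s1 ->
  power_mean (2 * n)%:R l (tail s0) (tail s1) <= tail ((1 - l) * s0 + l * s1).
Proof.
move=> l01 t0 t1; pose e (k : nat) : R := k.+1%:R^-1 + n%:R + n%:R.
have em : e k @[k --> \oo] --> ((2 * n)%:R : R).
  rewrite mul2n -addnn natrD -[X in _ --> (X + _)]add0r.
  by do 2 (apply: cvgD; last exact: cvg_cst); exact: cvg_harmonic.
have m0 : 0 < (2 * n)%:R :> R by rewrite ltr0n muln_gt0.
apply: (cvgr_to_le (cvg_power_mean m0 l01 t0 t1 em)).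
apply: nearW => k; exact: (tail_brunn_minkowski_gt hK).
Qed.

Lemma tail_nonincreasing s t : s <= t -> tail t <= tail s.
Proof.
move=> st; rewrite -lee_fin -!(tailE theta hK).
apply: le_measure; rewrite ?inE; [exact: measurable_halfspace_pairs..|].
by move=> z [h1 h2 h3]; split => //; exact: le_trans h3.
Qed.

Lemma tail_bounded_support : exists2 b, 0 < b & forall s, b <= s -> tail s = 0.
Proof.
have [cK _ _] := hK; have [B B0 KB] := compact_rV_bounded cK.
(* The sum bounds [gap] over the box containing [K]; adding 1 makes the bound strict and [b]
   positive. *)
pose b := \sum_(i < n) (B *+ 2) * `|theta ord0 i| + 1.
have b0 : 0 < b by rewrite ltr_wpDl// sumr_ge0// => i _; rewrite mulr_ge0// mulrn_wge0.
exists b => // s bs; rewrite /tail (_ : H s = set0) ?measure0//.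
apply/seteqP; split => // z [Kx Ky sz].
have : gap z < s.
  apply: lt_le_trans bs; rewrite /b; apply: (@le_lt_trans _ _ (\sum_(i < n) (B *+ 2) *
    `|theta ord0 i|)).
    rewrite /gap /dotp; apply: ler_sum => i _; apply: (le_trans (ler_norm _)).
    rewrite normrM ler_wpM2r// !mxE mulr2n (le_trans (ler_normB _ _))// lerD//.
      by have := KB _ Kx i; rewrite in_itv/= -ler_norml.
    by have := KB _ Ky i; rewrite in_itv/= -ler_norml.
  by rewrite ltrDl.
by rewrite ltNge sz.
Qed.

Lemma dotp_unit : dotp theta theta = 1.
Proof.
have : enorm theta = 1 := htheta.
rewrite /enorm => /(congr1 (fun x => x ^+ 2)).
by rewrite sqr_sqrtr ?expr1n// /dotp sumr_ge0// => i _; rewrite -expr2 sqr_ge0.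
Qed.

(** Two small cubes inside [K], centred at [c] plus and minus [d / 2] times [theta], have centres
    with gap [d]; all their pairs have gap at least [d / 2]. *)
Lemma tail_gt0 : exists2 b, 0 < b & 0 < tail b.
Proof.
have [_ _ iK] := hK; have [c [d d0 dK]] := interior_rV_box iK.
(* Each coordinate loses at most [2 * r], in total [2 * n * r = d / 2]; moreover [r <= d / 4] keeps
   the two cubes inside [cbox c d]. *)
pose r : R := d / (4 * n%:R).
have n0 : 0 < n%:R :> R by rewrite ltr0n.
have r0 : 0 < r by rewrite divr_gt0// mulr_gt0.
have rd : r <= d / 4.
  have d4 : 0 <= d / 4 by rewrite divr_ge0// ltW.
  by rewrite /r invfM mulrA ler_pdivrMr// ler_peMr// ler1n.
have th1 i : `|theta ord0 i| <= 1.
  rewrite -[leRHS](@sqrtr1 R) -sqrtr_sqr ler_sqrt// -dotp_unit /dotp (bigD1 i)//= -expr2.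
  by rewrite lerDl sumr_ge0// => j _; rewrite -expr2 sqr_ge0.
pose A (e : R) := cbox (c + (e * (d / 2)) *: theta) r.
have AK e : `|e| <= 1 -> A e `<=` K.
  move=> e1 x Ax; apply: dK => i; have := Ax i; rewrite !in_itv/= !mxE -!ler_distlC => h.
  have h2 : `|e * (d / 2) * theta ord0 i| <= d / 2.
    have d2 : 0 <= d / 2 by rewrite divr_ge0// ltW.
    rewrite normrM (normrM e) (ger0_norm d2) -[leRHS]mulr1; apply: ler_pM => //.
      by rewrite mulr_ge0.
    by rewrite -[leRHS]mul1r; apply: ler_wpM2r.
  rewrite (_ : c ord0 i - x ord0 i = (c ord0 i + e * (d / 2) * theta ord0 i - x ord0 i)
     - e * (d / 2) * theta ord0 i); last by ring.
  apply: (le_trans (ler_normB _ _)); apply: (le_trans (lerD h h2)).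
  by move: rd d0; lra.
exists (d / 2); first by rewrite divr_gt0.
rewrite -lte_fin -(tailE theta hK).
apply: (@lt_le_trans _ _ ((leb \x leb)%E (A 1 `*` A (-1)))).
  rewrite product_measure1E; [|exact: measurable_cbox..].
  by apply: mule_gt0; exact: lebesgue_rV_cbox_gt0.
apply: le_measure; rewrite ?inE.
- by apply: measurableX; exact: measurable_cbox.
- exact: measurable_halfspace_pairs.
move=> [x y] [/= Ax Ay]; split => /=.
- by apply: AK Ax; rewrite normr1.
- by apply: AK Ay; rewrite normrN normr1.
(* The gap of the centres minus the deviations of [x] and [y] from them. *)
have -> : gap (x, y) = \sum_(i < n) (d * theta ord0 i * theta ord0 i -
    ((c ord0 i + 1 * (d / 2) * theta ord0 i - x ord0 i) -
     (c ord0 i + - 1 * (d / 2) * theta ord0 i - y ord0 i)) * theta ord0 i).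
  by rewrite /gap /dotp; apply: eq_bigr => i _; rewrite !mxE/=; field.
rewrite sumrB; under eq_bigr do rewrite -mulrA.
rewrite -mulr_sumr -[X in _ * X - _]/(dotp theta theta) dotp_unit mulr1.
rewrite lerBrDr -lerBrDl.
apply: (@le_trans _ _ (\sum_(i < n) (r + r))); last first.
  rewrite sumr_const card_ord -mulr_natl /r le_eqVlt; apply/orP; left; apply/eqP.
  by field; rewrite gt_eqF.
apply: ler_sum => i _; apply: (le_trans (ler_norm _)); rewrite normrM.
rewrite -[leRHS]mulr1; apply: ler_pM => //.
apply: (le_trans (ler_normB _ _)); apply: lerD.
  by have := Ax i; rewrite in_itv/= !mxE -ler_distlC.
by have := Ay i; rewrite in_itv/= !mxE -ler_distlC.
Qed.

(** Tonelli for the indicator in the two orders of integration. *)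
Lemma product_swap (A : set ('rV[R]_n * 'rV[R]_n)) : measurable A ->
  (leb \x leb)%E [set z | A (z.2, z.1)] = (leb \x leb)%E A.
Proof.
move=> mA; pose sw (z : 'rV[R]_n * 'rV[R]_n) := (z.2, z.1).
have msw : measurable_fun setT sw by exact: measurable_swap.
have mS : measurable [set z | A (z.2, z.1)].
  by rewrite -[X in measurable X]setTI; exact: msw.
have I (S : set ('rV[R]_n * 'rV[R]_n)) : measurable S ->
    (leb \x leb)%E S = (\int[(leb \x leb)%E]_z (\1_S z)%:E)%E.
  by move=> ?; rewrite integral_indic ?setIT.
have mI (S : set ('rV[R]_n * 'rV[R]_n)) : measurable S ->
    measurable_fun setT (fun z => (\1_S z)%:E : \bar R).
  by move=> ?; apply/measurable_EFinP; exact: measurable_indic.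
have p0 (S : set ('rV[R]_n * 'rV[R]_n)) z : (0 <= (\1_S z)%:E :> \bar R)%E.
  by rewrite lee_fin indicE.
rewrite !I// fubini_tonelli1//; last exact: mI.
rewrite [RHS]fubini_tonelli2//; last exact: mI.
Qed.

(** K x K is the disjoint union of the slab, of [H s] and of the mirror image of [H s] under
    exchange of the two points, which has the same measure. *)
Lemma tail_slab s : 0 < s ->
  (leb \x leb)%E ((K `*` K) `&` [set z | `|gap z| < s]) = (vol K ^+ 2 - tail s *+ 2)%:E.
Proof.
move=> s0; set S := _ `&` _.
have mS : measurable S.
  apply: measurableI; first exact: measurable_body_pairs.
  by apply: measurable_set_ltr => //; apply: measurableT_comp => //;
    exact: measurable_gap.
pose H' := [set z | H s (z.2, z.1)].
have mH := measurable_halfspace_pairs theta hK s.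
have mH' : measurable H'.
  rewrite -[X in measurable X]setTI.
  exact: measurable_swap.
have gapN x y : gap (x, y) = - gap (y, x) by rewrite !gapE /= opprB.
have KKE : K `*` K = (S `|` H s) `|` H'.
  apply/seteqP; split => [[x y] [/= Kx Ky]|[x y] [[[]|[]]|[]]//].
  have [xs|sx] := ltP `|gap (x, y)| s; first by left; left.
  have := sx; rewrite ler_normr => /orP[h|h]; first by left; right.
  by right; split => //; rewrite gapN.
have : ((leb \x leb) S + (leb \x leb) (H s) + (leb \x leb) H' = (vol K ^+ 2)%:E)%E.
  rewrite -(body_pairs_volE hK) [in RHS]KKE measureU//; last 2 first.
  - exact: measurableU.
  - apply/seteqP; split => // -[x y] [[[_ /= h]|[/= _ _ h]] [/= _ _]]; rewrite gapN => h'.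
      by move: h; rewrite ltr_norml => /andP[+ _]; rewrite ltNge lerNr h'.
    by move: h' h; rewrite lerNr => h' h; have := le_trans h h'; rewrite leNgt gtrN.
  rewrite measureU//.
  apply/seteqP; split => // -[x y] [[_ /= h] [/= _ _ h']].
  by move: h; rewrite ltr_norml => /andP[_]; rewrite ltNge h'.
rewrite (product_swap mH) (tailE theta hK).
have fS : (leb \x leb)%E S \is a fin_num.
  rewrite ge0_fin_numE//; apply: (@le_lt_trans _ _ ((leb \x leb)%E (K `*` K))).
    by apply: le_measure; rewrite ?inE//; [exact: measurable_body_pairs|exact: subIsetl].
  by rewrite (body_pairs_volE hK) ltry.
rewrite -(fineK fS) -!EFinD => -[<-]; congr EFin.
by rewrite mulr2n opprD addrA addrK addrK.
Qed.

(** K x K splits into [H 0] and the mirror image of the open half [P], so it must be shown that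
    removing the pairs of gap 0 loses no measure. Brunn-Minkowski between 0 and some [b] with
    positive tail gives it: [P] contains [H (e * b)], of measure at least (1 - e)^(2n) times
    [tail 0], and [e] tends to 0. *)
Lemma tail0 : vol K ^+ 2 = tail 0 *+ 2.
Proof.
have [b b0 tb] := tail_gt0.
have t0 : 0 < tail 0 by apply: lt_le_trans tb _; apply: tail_nonincreasing; exact: ltW.
have m0 : 0 < (2 * n)%:R :> R by rewrite ltr0n muln_gt0.
pose P : set ('rV[R]_n * 'rV[R]_n) := (K `*` K) `&` [set z | 0 < gap z].
pose P' : set ('rV[R]_n * 'rV[R]_n) := [set z | P (z.2, z.1)].
have mP : measurable P.
  apply: measurableI; first exact: measurable_body_pairs.
  by apply: measurable_set_ltr => //; exact: measurable_gap.
have mP' : measurable P'.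
  rewrite -[X in measurable X]setTI.
  exact: measurable_swap.
have mH := measurable_halfspace_pairs theta hK 0.
have gapN x y : gap (x, y) = - gap (y, x) by rewrite !gapE /= opprB.
have PH : P `<=` H 0 by move=> z [[h1 h2] /ltW h3].
have PE : (leb \x leb)%E P = (tail 0)%:E.
  apply/eqP; rewrite eq_le; apply/andP; split.
    by rewrite -(tailE theta hK); apply: le_measure; rewrite ?inE.
  (* [k.+2] rather than [k.+1], so that [e k] is less than 1 from the start. *)
  pose e (k : nat) : R := k.+2%:R^-1.
  have e0 : e k @[k --> \oo] --> 0.
    by have := @cvg_harmonic R; rewrite -(cvg_shiftS (V := R^o)); apply.
  have step k : (((1 - e k) `^ (2 * n)%:R * tail 0)%:E <= (leb \x leb) P)%E.
    have e01 : 0 < e k < 1 by rewrite invr_gt0 ltr0n /= invf_lt1 ?ltr0n// ltr1n.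
    apply: (@le_trans _ _ (tail (e k * b))%:E).
      rewrite lee_fin; have := tail_brunn_minkowski e01 t0 tb; rewrite mulr0 add0r;
        apply: le_trans.
      rewrite -{1}(powRK m0 (ltW t0)) -powRM ?powR_ge0//; last by rewrite subr_ge0;
        case/andP: e01 => _ /ltW.
      apply: ge0_ler_powR; rewrite ?nnegrE ?(ltW m0)//.
      - by rewrite mulr_ge0 ?powR_ge0// subr_ge0; case/andP: e01 => _ /ltW.
      - by case/andP: e01 => /ltW h1 /ltW h2;
        rewrite addr_ge0// mulr_ge0 ?powR_ge0// subr_ge0.
      by rewrite lerDl mulr_ge0 ?powR_ge0//; case/andP: e01 => /ltW.
    rewrite -(tailE theta hK); apply: le_measure; rewrite ?inE//;
      first exact: measurable_halfspace_pairs.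
    move=> z [h1 h2 h3]; split => //; apply: lt_le_trans h3.
    by rewrite mulr_gt0//; case/andP: e01.
  have fP : (leb \x leb)%E P \is a fin_num.
    rewrite ge0_fin_numE//; apply: (@le_lt_trans _ _ ((leb \x leb)%E (H 0))).
      by apply: le_measure; rewrite ?inE.
    by rewrite (tailE theta hK) ltry.
  rewrite -(fineK fP) lee_fin.
  have lim : (1 - e k) `^ (2 * n)%:R * tail 0 @[k --> \oo] --> tail 0.
    have v1 : expR ((2 * n)%:R * ln (1 - 0)) = 1 :> R by rewrite subr0 ln1 mulr0 expR0.
    have ne k : 1 - e k != 0.
      by rewrite subr_eq0 eq_sym lt_eqF// invf_lt1 ?ltr0n// ltr1n.
    have pE k : (1 - e k) `^ (2 * n)%:R = expR ((2 * n)%:R * ln (1 - e k)).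
      by rewrite /powR (negbTE (ne k)).
    have h : (1 - e k) `^ (2 * n)%:R @[k --> \oo] --> expR ((2 * n)%:R * ln (1 - 0)).
      under eq_fun do rewrite pE.
      apply: continuous_cvg; first exact: continuous_expR.
      apply: cvgMr; apply: continuous_cvg; first by apply: continuous_ln; rewrite subr0.
      by apply: cvgB => //; exact: cvg_cst.
    by rewrite v1 in h; rewrite -[X in _ --> X]mul1r; exact: cvgMl.
  apply: (cvgr_to_le lim); apply: nearW => k.
  by rewrite -lee_fin fineK.
have KKE : K `*` K = H 0 `|` P'.
  apply/seteqP; split => [[x y] [/= Kx Ky]|[x y] [[]|[[]]]//].
  have [h|h] := ltP (gap (x, y)) 0; last by left.
  by right; split => //=; rewrite gapN oppr_gt0.
have : ((leb \x leb) (H 0) + (leb \x leb) P' = (vol K ^+ 2)%:E)%E.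
  rewrite -(body_pairs_volE hK) [in RHS]KKE measureU//.
  apply/seteqP; split => // -[x y] [[/= _ _ h] [_ /=]].
  by rewrite gapN oppr_gt0 ltNge h.
by rewrite (product_swap mP) PE (tailE theta hK) -EFinD mulr2n => -[].
Qed.

End tail_properties.

(** * The Gamma function and beta integrals *)

Section ftc_positive_reals.
Context {R : realType}.
Notation mu := (@lebesgue_measure R).

Lemma is_derive_continuous (f : R -> R) (x d : R) :
  is_derive x 1 f d -> {for x, continuous f}.
Proof. by move=> [df _]; apply: differentiable_continuous; exact/derivable1_diffP. Qed.

Lemma is_derive_powR (p x : R) : 0 < x ->
  is_derive x 1 (fun y => y `^ p) (p * x `^ (p - 1)).
Proof.
move=> x0; have xi : x \in `]0, +oo[ by rewrite in_itv/= andbT.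
apply: DeriveDef; first exact: derivable_powR.
by rewrite -derive1E; exact: (powR_derive1 p xi).
Qed.

Lemma continuous_powR (p x : R) : 0 < x -> {for x, continuous (fun y : R => y `^ p)}.
Proof. by move=> x0; exact: is_derive_continuous (is_derive_powR p x0). Qed.

Variables (f F : R -> R) (A B : R).
Hypothesis F'f : forall x : R, 0 < x -> is_derive x 1 F (f x).
Hypothesis cf : forall x : R, 0 < x -> {for x, continuous f}.
Hypothesis F0 : F x @[x --> 0^'+] --> A.
Hypothesis Fy : F x @[x --> +oo] --> B.

(** An exhaustion of the half-line by compact intervals; starting at 2 makes even the first one
    nondegenerate. *)
Let E (k : nat) : set R := `[k.+2%:R^-1, k.+2%:R]%classic.

Let E_gt0 k x : E k x -> 0 < x.
Proof. by rewrite /E/= in_itv/= => /andP[+ _]; apply: lt_le_trans. Qed.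

Let E_nd : {homo E : n m / (n <= m)%N >-> (n <= m)%O}.
Proof.
move=> i j ij; apply/subsetPset => x; rewrite /E /= !in_itv/= => /andP[h1 h2].
apply/andP; split; last by rewrite (le_trans h2)// ler_nat ltnS.
by rewrite (le_trans _ h1)// lef_pV2 ?posrE// ler_nat ltnS.
Qed.

Let E_union : \bigcup_k E k = `]0, +oo[%classic.
Proof.
apply/seteqP; split => [x [k _ /E_gt0]|x]; first by rewrite /= in_itv/= andbT.
rewrite /= in_itv/= andbT => x0.
have [k xk] : exists k : nat, x < k.+2%:R /\ k.+2%:R^-1 < x.
  have [i xi] := ltr_add_invr x0; rewrite add0r in xi.
  exists (maxn (Num.truncn x) i); split.
    apply: (lt_le_trans (truncnS_gt x)); rewrite ler_nat ltnS.
    by rewrite (leq_trans (leq_maxl _ i)).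
  rewrite (le_lt_trans _ xi)// lef_pV2 ?posrE// ler_nat ltnS.
  by rewrite (leq_trans (leq_maxr (Num.truncn x) _)).
by exists k => //; rewrite /E/= in_itv/=; case: xk => /ltW -> /ltW ->.
Qed.

Let mf_oo : measurable_fun (`]0, +oo[%classic : set R) f.
Proof.
apply: open_continuous_measurable_fun => // x; rewrite inE /= in_itv/= andbT.
exact: cf.
Qed.

Let mfE k : measurable_fun (E k) f.
Proof.
apply: measurable_funS mf_oo => // x /E_gt0 x0.
by rewrite /= in_itv/= x0.
Qed.

Let intE k : (\int[mu]_(x in E k) (f x)%:E = (F k.+2%:R - F k.+2%:R^-1)%:E)%E.
Proof.
have k1 : k.+2%:R^-1 < k.+2%:R :> R.
  by rewrite (@lt_trans _ _ 1)// ?invf_lt1// ltr1n.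
rewrite (@continuous_FTC2 _ f F) ?EFinB//.
- apply: continuous_in_subspaceT => x /set_mem/= h; apply: cf.
  exact: (@E_gt0 k).
- have cF (x : R) : 0 < x -> {for x, continuous F} by move=> x0;
  exact: is_derive_continuous (F'f x0).
  split.
  + move=> x xk; have x0 : 0 < x by apply: (@E_gt0 k); exact: subset_itv_oo_cc xk.
    by have [] := F'f x0.
  + by apply: cvg_at_right_filter; apply: cF; rewrite invr_gt0.
  + by apply: cvg_at_left_filter; exact: cF.
- move=> x xk; have x0 : 0 < x by apply: (@E_gt0 k); exact: subset_itv_oo_cc xk.
  by rewrite derive1E; have [_ ->] := F'f x0.
Qed.

Let cvgE : (F k.+2%:R - F k.+2%:R^-1) @[k --> \oo] --> B - A.
Proof.
have k2 : (k.+2%:R : R) @[k --> \oo] --> +oo.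
  apply/cvgryPge => M; near=> k.
  apply: (@le_trans _ _ k%:R); last by rewrite ler_nat !leqW.
  by near: k; exact: nbhs_infty_ger.
apply: cvgB.
  exact: (cvg_comp _ _ k2 Fy).
move/cvg_at_rightP : F0; apply; split => [k|]; first by rewrite invr_gt0.
have := @cvg_harmonic R; rewrite -(cvg_shiftS (V := R^o)); apply.
Unshelve. all: end_near. Qed.

Lemma ge0_FTC_oo : (forall x : R, 0 < x -> 0 <= f x) ->
  (\int[mu]_(x in `]0%R, +oo[) (f x)%:E = (B - A)%:E)%E.
Proof.
move=> f0; rewrite -E_union.
have h : (\int[mu]_(x in E k) (f x)%:E)%E @[k --> \oo] -->
    (\int[mu]_(x in \bigcup_k E k) (f x)%:E)%E.
  apply: ge0_nondecreasing_set_cvg_integral => //.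
  - by move=> k; exact: measurable_itv.
  - by move=> k; apply/measurable_EFinP; exact: mfE.
  - by move=> k x /E_gt0 x0; rewrite lee_fin f0.
apply: (cvg_unique _ h) => //.
rewrite (_ : (fun k => _) = (fun k => (F k.+2%:R - F k.+2%:R^-1)%:E));
  last exact/funext/intE.
by apply: cvg_EFin; [exact: nearW|exact: cvgE].
Qed.

(** For integrands of varying sign, dominated convergence replaces the monotone convergence of
    [ge0_FTC_oo]. *)
Lemma FTC_oo : mu.-integrable (`]0, +oo[%classic : set R) (EFin \o f) ->
  \int[mu]_(x in `]0, +oo[) f x = B - A.
Proof.
move=> intf; have mE k : measurable (E k) by exact: measurable_itv.
have h : (\int[mu]_(x in `]0%R, +oo[) (((EFin \o f) \_ (E k)) x))%E @[k --> \oo] -->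
    (\int[mu]_(x in `]0%R, +oo[) (f x)%:E)%E.
  apply: (@dominated_cvg _ _ R mu `]0, +oo[%classic _ (fun k =>
    (EFin \o f) \_ (E k)) (EFin \o f) (fun x => `|(f x)%:E|%E)) => //.
  - move=> k; apply: measurable_funTS; apply/(measurable_restrictT _ (mE k)).
    by apply/measurable_EFinP; exact: mfE.
  - move=> x; rewrite -E_union => -[N _ ENx].
    apply: cvg_near_cst; exists N => // k /= Nk.
    rewrite patchE mem_set//.
    by have /subsetPset := E_nd Nk; apply.
  - exact: (integrable_abse intf).
  - by move=> k x _; rewrite patchE; case: ifP => //; rewrite abse0.
rewrite /Rintegral.
suff -> : (\int[mu]_(x in `]0%R, +oo[) (f x)%:E = (B - A)%:E)%E by [].
apply: (cvg_unique _ h) => //.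
rewrite (_ : (fun k => _) = (fun k => (F k.+2%:R - F k.+2%:R^-1)%:E)); last first.
    apply/funext => k; rewrite -integral_mkcondr setIidr ?intE//.
    by move=> x /E_gt0 x0; rewrite /= in_itv/= x0.
by apply: cvg_EFin; [exact: nearW|exact: cvgE].
Qed.

End ftc_positive_reals.

Section gamma.
Context {R : realType}.
Notation mu := (@lebesgue_measure R).

(** Raise 1 + r <= M (1 + r/M) <= M exp(r/M) to the power [M]. *)
Lemma powR_1D_le_expR (M r : R) : 1 <= M -> 0 <= r -> (1 + r) `^ M <= M `^ M * expR r.
Proof.
move=> M1 r0; have M0 : 0 < M by exact: lt_le_trans M1.
have r1 : 0 <= 1 + r by rewrite addr_ge0.
have : 1 + r <= M * expR (r / M).
  apply: (@le_trans _ _ (M * (1 + r / M))); last by rewrite ler_pM2l// expR_ge1Dx.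
  by rewrite mulrDr mulr1 mulrC divfK ?gt_eqF// lerD2r.
move=> /(ge0_ler_powR (ltW M0)); rewrite !nnegrE => /(_ r1) h.
apply: (le_trans (h _)); first by rewrite mulr_ge0 ?expR_ge0// ltW.
by rewrite (powRM _ (ltW M0) (expR_ge0 _)) -expRM divfK// gt_eqF.
Qed.

Lemma is_derive_1D (x : R) : is_derive x 1 (fun r : R => 1 + r) 1.
Proof.
have h := @is_deriveD R R R (cst 1) id x 1 0 1 (is_derive_cst _ _ _) (is_derive_id _ _).
by apply: is_derive_eq h _; rewrite add0r.
Qed.

Lemma is_derive_ratio (x : R) : 0 <= x ->
  is_derive x 1 (fun r : R => r / (1 + r)) ((1 + x) ^- 2).
Proof.
move=> x0; have x10 : 1 + x != 0 by rewrite gt_eqF// ltr_pwDl.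
have dv := is_deriveV x10 (is_derive_1D x).
by apply: is_derive_eq (is_deriveM (is_derive_id x 1) dv) _; rewrite /GRing.scale/=;
  field.
Qed.

(** A majorant of the exponential whose product with r^(p-1) has an explicit antiderivative. It
    yields both the integrability of the Gamma integrand and its decay at infinity. *)
Lemma expRN_le_powR (p r : R) : 0 < p -> 0 <= r ->
  expR (- r) <= (p + 1) `^ (p + 1) * (1 + r) `^ (- (p + 1)).
Proof.
move=> p0 r0; have r1 : 0 < 1 + r by rewrite ltr_pwDl.
rewrite powRN expRN ler_pdivlMr ?powR_gt0// mulrC ler_pdivrMr ?expR_gt0//.
by apply: powR_1D_le_expR => //; rewrite lerDr ltW.
Qed.

Lemma cvg_ratioy : (r / (1 + r)) @[r --> +oo] --> (1 : R).
Proof.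
apply/cvgrPdist_lt => e e0; near=> r.
have r0 : 0 < r by near: r; exact: nbhs_pinfty_gt.
have r1 : 0 < 1 + r by rewrite addr_gt0.
rewrite (_ : 1 - r / (1 + r) = (1 + r)^-1); last by field; rewrite gt_eqF.
rewrite gtr0_norm ?invr_gt0// -[e]invrK ltf_pV2 ?posrE ?invr_gt0//.
rewrite (@lt_trans _ _ r)// ?ltrDr//.
by near: r; apply: nbhs_pinfty_gt; exact: num_real.
Unshelve. all: end_near. Qed.

(** The antiderivative is (r / (1 + r))^p / p, which goes from 0 to 1/p. *)
Lemma integral_beta_prime (p : R) : 0 < p ->
  (\int[mu]_(r in `]0%R, +oo[) (r `^ (p - 1) * (1 + r) `^ (- (p + 1)))%:E = (p^-1)%:E)%E.
Proof.
move=> p0; pose F (r : R) := (r / (1 + r)) `^ p * p^-1.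
rewrite -[X in X%:E](subr0 p^-1); apply: (@ge0_FTC_oo R _ F 0 p^-1).
- move=> x x0; have x1 : 0 < 1 + x by rewrite addr_gt0.
  have xx : 0 < x / (1 + x) by rewrite divr_gt0.
  have h := @is_derive1_comp R (fun y => y `^ p) (fun r => r / (1 + r)) x _ _
    (is_derive_powR p xx) (is_derive_ratio (ltW x0)).
  have : is_derive x 1 F (p^-1 *: (p * (x / (1 + x)) `^ (p - 1) * (1 + x) ^- 2)).
    rewrite (_ : F = p^-1 \*: (fun r : R => (r / (1 + r)) `^ p)); first exact: is_deriveZ.
    by apply/funext => r; rewrite /F mulrC.
  move=> h2; apply: is_derive_eq h2 _; rewrite /GRing.scale/=.
  rewrite powRM ?invr_ge0 ?ltW// -[(1 + x)^-1]powR_inv1 ?ltW// -powRrM mulN1r.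
  rewrite -(powR_invn 2 (ltW x1)) !mulrA mulVf ?gt_eqF// mul1r -mulrA -powRD.
    by congr (_ * _ `^ _); ring.
  by rewrite (gt_eqF x1) implybT.
- move=> x x0; have x1 : 0 < 1 + x by rewrite addr_gt0.
  apply: continuousM; first exact: continuous_powR.
  apply: is_derive_continuous.
  exact: (@is_derive1_comp R (fun y => y `^ (- (p + 1))) (fun r => 1 + r) x _ _
    (is_derive_powR _ x1) (is_derive_1D x)).
- rewrite -[X in _ --> X](mul0r p^-1); apply: cvgMl.
  apply: (@squeeze_cvgr _ _ _ _ (cst 0) (fun r : R => r `^ p)).
  + near=> r; have r0 : 0 < r by near: r; exact: nbhs_right_gt.
    have r1 : 0 < 1 + r by rewrite addr_gt0.
    rewrite powR_ge0/=; apply: (ge0_ler_powR (ltW p0)); rewrite ?nnegrE.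
    * by apply: divr_ge0; exact: ltW.
    * exact: ltW.
    by rewrite ler_pdivrMr// mulrDr mulr1 lerDl mulr_ge0 ?(ltW r0).
  + exact: cvg_cst.
  + exact: powR_cvg0.
- rewrite -[X in _ --> X](mul1r p^-1); apply: cvgMl.
  rewrite -[X in _ --> X](congr1 (fun f => f p) (powR1 R)).
  apply: (continuous_cvg _ (h := fun r : R => r `^ p)); last exact: cvg_ratioy.
  exact: continuous_powR.
- by move=> x x0; rewrite mulr_ge0 ?powR_ge0.
Unshelve. all: end_near. Qed.

Definition gamma_density (p r : R) : R := r `^ (p - 1) * expR (- r).

Lemma measurable_gamma_density (p : R) : measurable_fun [set: R] (gamma_density p).
Proof.
apply: measurable_funM; first exact: measurable_powR.
by apply: measurableT_comp => //; exact: measurable_funT_comp.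
Qed.

Lemma gamma_density_ge0 (p r : R) : 0 <= gamma_density p r.
Proof. by rewrite mulr_ge0 ?powR_ge0 ?expR_ge0. Qed.

Lemma integrable_gamma_density (p : R) : 0 < p ->
  mu.-integrable (`]0, +oo[%classic : set R) (EFin \o gamma_density p).
Proof.
move=> p0; apply/integrableP; split.
  by apply: measurable_funTS; apply/measurable_EFinP; exact: measurable_gamma_density.
pose M := p + 1; pose C := M `^ M.
have C0 : 0 <= C by exact: powR_ge0.
have mg : measurable_fun [set: R] (fun r : R => r `^ (p - 1) * (1 + r) `^ (- (p + 1))).
  apply: measurable_funM; first exact: measurable_powR.
  apply: (@measurableT_comp _ _ _ _ _ _ (fun r : R => r `^ (- (p + 1))) _ (fun r : R =>
    1 + r)).
    exact: measurable_powR.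
  exact: measurable_funD.
apply: (@le_lt_trans _ _ (\int[mu]_(r in `]0%R, +oo[)
    (C%:E * (r `^ (p - 1) * (1 + r) `^ (- (p + 1)))%:E))%E).
  apply: ge0_le_integral => //.
  - apply: measurable_funTS; apply: measurableT_comp => //; apply/measurable_EFinP.
    exact: measurable_gamma_density.
  - by apply: measurable_funTS; apply: measurable_funeM; exact/measurable_EFinP.
  move=> r; rewrite /= in_itv/= andbT => r0; have r1 : 0 < 1 + r by rewrite addr_gt0.
  rewrite -EFinM lee_fin ger0_norm ?gamma_density_ge0// /gamma_density mulrCA.
  apply: ler_wpM2l; first exact: powR_ge0.
  exact: (expRN_le_powR p0 (ltW r0)).
rewrite ge0_integralZl//.
- by rewrite integral_beta_prime// -EFinM ltry.
- by apply: measurable_funTS; apply/measurable_EFinP.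
- by move=> r _; rewrite lee_fin mulr_ge0 ?powR_ge0.
Qed.

Lemma GammaE (p : R) : 0 < p ->
  (\int[mu]_(r in `]0%R, +oo[) (gamma_density p r)%:E = (Gamma p)%:E)%E.
Proof.
by move=> p0; rewrite /Gamma /Rintegral fineK//; apply: integrable_fin_num => //;
  exact: integrable_gamma_density.
Qed.

(** Were the integral zero, the integrand would vanish almost everywhere, although it is positive on
    all of []0, 1[]. *)
Lemma Gamma_gt0 (p : R) : 0 < p -> 0 < Gamma p.
Proof.
move=> p0; rewrite lt_neqAle; apply/andP; split; last first.
  by apply: Rintegral_ge0 => r _; exact: gamma_density_ge0.
apply/negP => /eqP G0.
have := GammaE p0; rewrite -G0 => h.
have : (\int[mu]_(r in `]0%R, +oo[) `|(gamma_density p r)%:E| = 0)%E.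
  by rewrite -[RHS]h; apply: eq_integral => r _;
    rewrite gee0_abs// lee_fin gamma_density_ge0.
move/ae_eq_integral_abs => ae0.
have {ae0} /ae0 : measurable_fun (`]0, +oo[%classic : set R) (EFin \o gamma_density p).
  by apply: measurable_funTS; apply/measurable_EFinP; exact: measurable_gamma_density.
move=> /(_ (measurable_itv _)) [N [mN N0 sub]].
have : (mu `]0%R, 1%R[%classic <= mu N)%E.
  apply: le_measure; rewrite ?inE//.
  move=> r /=; rewrite in_itv/= => /andP[r0 r1]; apply: sub => /= h2.
  have := h2 _; rewrite /= in_itv/= r0 => /(_ isT)[] /eqP.
  by rewrite gt_eqF// mulr_gt0 ?powR_gt0 ?expR_gt0.
by rewrite N0 /= lebesgue_measure_itv/= lte_fin ltr01 oppr0 adde0 lee_fin leNgt ltr01.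
Qed.

Lemma integral_gamma_scale (p a : R) : 0 < p -> 0 < a ->
  (\int[mu]_(r in `]0%R, +oo[) (r `^ (p - 1) * expR (- (a * r)))%:E =
   (a `^ (- p) * Gamma p)%:E)%E.
Proof.
move=> p0 a0.
have mg : measurable_fun [set: R] (EFin \o gamma_density p).
  by apply/measurable_EFinP; exact: measurable_gamma_density.
have g0 x : (0 <= (EFin \o gamma_density p) x)%E by rewrite lee_fin gamma_density_ge0.
have := ge0_integral_scale a0 mg g0; rewrite GammaE// => h.
have -> : (a `^ (- p) * Gamma p)%:E = ((a `^ (1 - p))%:E * (a^-1%:E * (Gamma p)%:E))%E.
  rewrite -!EFinM mulrA -(powR_inv1 (ltW a0)) -powRD ?(gt_eqF a0) ?implybT//.
  by congr (_ `^ _ * _)%:E; ring.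
rewrite -h -ge0_integralZl//; last 2 first.
- apply: measurable_funTS; apply: (measurableT_comp mg).
  exact: measurable_funM.
- by rewrite lee_fin powR_ge0.
apply: eq_integral => r; rewrite inE/= in_itv/= andbT => r0.
rewrite -EFinM /gamma_density powRM ?ltW// !mulrA -powRD ?(gt_eqF a0) ?implybT//.
by rewrite addrA subrK subrr powRr0 mul1r.
Qed.

Lemma is_derive_expRN (x : R) : is_derive x 1 (fun r : R => expR (- r)) (- expR (- x)).
Proof.
have h := @is_derive1_comp R expR (fun r => - r) x (expR (- x)) (- 1) _ _.
by apply: is_derive_eq (h _ _) _; rewrite mulrN1.
Qed.

Lemma continuous_gamma_density (p x : R) : 0 < x -> {for x, continuous (gamma_density p)}.
Proof.
move=> x0; apply: continuousM; first exact: continuous_powR.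
exact: is_derive_continuous (is_derive_expRN x).
Qed.

Lemma cvg_powR_expRN_0 (p : R) : 0 < p ->
  (r `^ p * expR (- r)) @[r --> (0:R)^'+] --> (0 : R).
Proof.
move=> p0; apply: (@squeeze_cvgr _ _ _ _ (cst 0) (fun r : R => r `^ p)).
- near=> r; have r0 : 0 < r by near: r; exact: nbhs_right_gt.
  rewrite mulr_ge0 ?powR_ge0 ?expR_ge0//= ler_piMr ?powR_ge0//.
  by rewrite -expR0 ler_expR oppr_le0 ltW.
- exact: cvg_cst.
- exact: powR_cvg0.
Unshelve. all: end_near. Qed.

Lemma cvg_powR_expRN_y (p : R) : 0 < p -> (r `^ p * expR (- r)) @[r --> +oo] --> (0 : R).
Proof.
move=> p0; pose C := (p + 1) `^ (p + 1).
apply: (@squeeze_cvgr _ _ _ _ (cst 0) (fun r : R => C * (1 - r / (1 + r)))).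
- near=> r; have r0 : 0 < r by near: r; exact: nbhs_pinfty_gt.
  have r1 : 0 < 1 + r by rewrite addr_gt0.
  rewrite mulr_ge0 ?powR_ge0 ?expR_ge0//=.
  rewrite (_ : 1 - r / (1 + r) = (1 + r)^-1); last by field; rewrite gt_eqF.
  apply: (@le_trans _ _ ((1 + r) `^ p * (C * (1 + r) `^ (- (p + 1))))).
    apply: ler_pM; rewrite ?powR_ge0 ?expR_ge0//; last exact: (expRN_le_powR p0 (ltW r0)).
    by apply: (ge0_ler_powR (ltW p0)); rewrite ?nnegrE ?(ltW r0) ?(ltW r1)// lerDr.
  rewrite mulrCA -powRD; last by rewrite (gt_eqF r1) implybT.
  by rewrite opprD addrA subrr add0r powR_inv1// ltW.
- exact: cvg_cst.
- rewrite -[X in _ --> X](mulr0 C) -(subrr 1); apply: cvgMr; apply: cvgB;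
  first exact: cvg_cst.
  exact: cvg_ratioy.
Unshelve. all: end_near. Qed.

(** The derivative of r^p exp(-r), which vanishes at both ends, has integral 0. *)
Lemma Gamma_recr (p : R) : 0 < p -> Gamma (p + 1) = p * Gamma p.
Proof.
move=> p0; have p1 : 0 < p + 1 by rewrite addr_gt0.
have int0 := integrable_gamma_density p0; have int1 := integrable_gamma_density p1.
have int0' : mu.-integrable (`]0, +oo[%classic : set R) (EFin \o (fun r =>
  p * gamma_density p r)).
  by apply: eq_integrable (integrableZl _ p int0).
have := @FTC_oo R (fun r => p * gamma_density p r - gamma_density (p + 1) r)
  (fun r => r `^ p * expR (- r)) 0 0.
rewrite RintegralB// RintegralZl// -[X in _ - X]/(Gamma (p + 1)) -[X in _ * X -
  _]/(Gamma p).
move=> h; apply/esym/eqP; rewrite -subr_eq0; apply/eqP; rewrite -[RHS](subrr 0); apply: h.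
- move=> x x0.
  have h := @is_deriveM R R (fun r => r `^ p) (fun r : R =>
    expR (- r)) x 1 _ _ (is_derive_powR p x0) (is_derive_expRN x).
  apply: is_derive_eq h _; rewrite /GRing.scale/= /gamma_density addrK.
  ring.
- move=> x x0; apply: continuousB; last exact: continuous_gamma_density.
  by apply: continuousM; [exact: cst_continuous|exact: continuous_gamma_density].
- exact: cvg_powR_expRN_0.
- exact: cvg_powR_expRN_y.
- by apply: eq_integrable (integrableB _ int0' int1).
Qed.

End gamma.

Section beta.
Context {R : realType}.
Notation mu := (@lebesgue_measure R).

Lemma cvg_powRN_y (p : R) : 0 < p -> (s `^ (- p)) @[s --> +oo] --> (0 : R).
Proof.
move=> p0; apply/cvgrPdist_lt => e e0; near=> s.
have s0 : 0 < s by near: s; exact: nbhs_pinfty_gt.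
have es : e `^ (- p^-1) < s by near: s; apply: nbhs_pinfty_gt; exact: num_real.
rewrite sub0r normrN ger0_norm ?powR_ge0// powRN.
rewrite -[e]invrK ltf_pV2 ?posrE ?invr_gt0 ?powR_gt0//.
have -> : e^-1 = (e `^ (- p^-1)) `^ p.
  by rewrite -powRrM mulNr mulVf ?gt_eqF// powR_inv1// ltW.
by apply: gt0_ltr_powR => //; rewrite nnegrE ?powR_ge0// ltW.
Unshelve. all: end_near. Qed.

Lemma integral_powR_tail (p x : R) : 0 < p -> 0 < x ->
  (\int[mu]_(s in `]x, +oo[) (s `^ (- p - 1))%:E = (x `^ (- p) / p)%:E)%E.
Proof.
move=> p0 x0; pose F (s : R) := - p^-1 * s `^ (- p).
have pos (y : R) : x <= y -> 0 < y by exact: lt_le_trans.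
have F' (y : R) : 0 < y -> is_derive y 1 F (y `^ (- p - 1)).
  move=> y0; have h := @is_deriveZ R R R (fun s =>
    s `^ (- p)) (- p^-1) y 1 _ (is_derive_powR (- p) y0).
  by apply: is_derive_eq h _; rewrite /GRing.scale/= mulrA mulrNN mulVf ?gt_eqF// mul1r.
have mf : measurable_fun [set: R] (fun s : R => s `^ (- p - 1)) by exact: measurable_powR.
rewrite integral_itv_obnd_cbnd; last first.
  by apply: measurable_funTS; apply/measurable_EFinP.
rewrite (@ge0_continuous_FTC2y R (fun s => s `^ (- p - 1)) F x 0).
- by rewrite -EFinB sub0r /F mulNr opprK mulrC.
- by move=> s _; exact: powR_ge0.
- apply: continuous_in_subspaceT => y; rewrite inE/= in_itv/= andbT => xy.
  exact/continuous_powR/pos.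
- rewrite -[X in _ --> X](mulr0 (- p^-1)); apply: cvgMr; exact: cvg_powRN_y.
- by move=> y xy; have [] := F' _ (pos _ (ltW xy)).
- by apply: cvg_at_right_filter; exact: is_derive_continuous (F' _ x0).
- move=> y; rewrite in_itv/= andbT => xy; rewrite derive1E.
  by have [_ ->] := F' _ (pos _ (ltW xy)).
Qed.

Lemma integral_expRN (s : R) : 0 < s ->
  (\int[mu]_(x in `]0%R, s[) (expR (- x))%:E = (1 - expR (- s))%:E)%E.
Proof.
move=> s0.
have mf : measurable_fun [set: R] (fun s : R => expR (- s)) by exact: measurableT_comp.
rewrite -(@integral_itv_bndoo _ 0 s _ true false); last first.
  by apply: measurable_funTS; apply/measurable_EFinP.
have F' (y : R) : is_derive y 1 (fun x : R => - expR (- x)) (expR (- y)).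
  by apply: is_derive_eq (is_deriveN (is_derive_expRN y)) _; rewrite opprK.
rewrite (@continuous_FTC2 _ _ (fun x => - expR (- x))) ?oppr0 ?expR0//.
- by rewrite -EFinB; congr EFin; ring.
- apply: continuous_subspaceT => x; exact: is_derive_continuous (is_derive_expRN x).
- split.
  + by move=> x _; have [] := F' x.
  + by apply: cvg_at_right_filter; exact: is_derive_continuous (F' 0).
  + by apply: cvg_at_left_filter; exact: is_derive_continuous (F' s).
- by move=> y _; rewrite derive1E; have [_ ->] := F' y.
Qed.

(** Tonelli on the region 0 < x < s with weights exp(-x) and s^(-p-1): integrating in x first gives
    1 - exp(-s), integrating in s first gives x^(-p) / p, hence a Gamma integral. *)
Lemma integral_powR_1BexpRN (p : R) : 0 < p < 1 ->
  (\int[mu]_(s in `]0%R, +oo[) (s `^ (- p - 1) * (1 - expR (- s)))%:E =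
   (Gamma (1 - p) / p)%:E)%E.
Proof.
move=> /andP[p0 p1].
pose A : set (measurableTypeR R * measurableTypeR R) := [set xs | 0 < xs.1 < xs.2].
have mA : measurable A.
  rewrite (_ : A = [set xs | 0 < xs.1] `&` [set xs | xs.1 < xs.2]); last first.
    by apply/seteqP; split => [x /andP[]//|x [/= h1 h2]]; apply/andP.
  by apply: measurableI; exact: measurable_set_ltr.
have mv : measurable_fun [set: R] (fun s : R => (expR (- s))%:E : \bar R).
  by apply/measurable_EFinP; exact: measurableT_comp.
have mw : measurable_fun [set: R] (fun s : R => (s `^ (- p - 1))%:E : \bar R).
  by apply/measurable_EFinP; exact: measurable_powR.
have v0 (s : R) : (0 <= (expR (- s))%:E)%E by rewrite lee_fin expR_ge0.
have w0 (s : R) : (0 <= (s `^ (- p - 1))%:E)%E by rewrite lee_fin powR_ge0.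
have := @tonelli_weight _ _ R mu A _ _ mA mv mw v0 w0.
have -> : (\int[mu]_x ((expR (- x))%:E * \int[mu]_(s in [set s | A (x,
  s)]) (s `^ (- p - 1))%:E) =
    \int[mu]_(x in `]0%R, +oo[) (p^-1%:E * (gamma_density (1 - p) x)%:E))%E.
  rewrite [RHS]integral_mkcond; apply: eq_integral => x _.
  rewrite /patch mem_setE in_itv/= andbT; case: ifPn => x0.
    rewrite (_ : [set s | A (x, s)] = `]x, +oo[%classic); last first.
      by apply/seteqP; split => s; rewrite /A /= in_itv/= andbT x0.
    rewrite integral_powR_tail// -!EFinM /gamma_density addrAC subrr add0r.
    by congr EFin; ring.
  rewrite (_ : [set s | A (x, s)] = set0) ?integral_set0 ?mule0//.
  by apply/seteqP; split => s //; rewrite /A /= (negbTE x0).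
rewrite ge0_integralZl//; last 3 first.
- by apply: measurable_funTS; apply/measurable_EFinP; exact: measurable_gamma_density.
- by move=> x _; rewrite lee_fin gamma_density_ge0.
- by rewrite lee_fin invr_ge0 ltW.
rewrite GammaE ?subr_gt0// -EFinM mulrC => ->.
rewrite integral_mkcond; apply: eq_integral => s _.
rewrite /patch mem_setE in_itv/= andbT; case: ifPn => s0.
  rewrite (_ : [set x | A (x, s)] = `]0, s[%classic); last first.
    by apply/seteqP; split => x; rewrite /A /= in_itv.
  by rewrite integral_expRN// -EFinM.
rewrite (_ : [set x | A (x, s)] = set0) ?integral_set0 ?mule0//.
apply/seteqP; split => x //; rewrite /A /= => /andP[h1 h2].
by rewrite (lt_trans h1 h2) in s0.
Qed.

(** What 1 - T s / T 0 becomes when the profile is the cone of width 1; [N] stands for 2n. *)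
Definition simplex_gap (N : nat) (s : R) : R := 1 - Num.max (1 - s) 0 ^+ N.

Lemma simplex_gap_ge0 N s : 0 <= s -> 0 <= simplex_gap N s.
Proof.
move=> s0; rewrite subr_ge0 exprn_ile1//; first by rewrite le_max lexx orbT.
by rewrite ge_max ler01 gerBl s0.
Qed.

Lemma measurable_simplex_gap N : measurable_fun [set: R] (simplex_gap N).
Proof.
apply: measurable_funB => //; apply: measurable_funX; apply: measurable_maxr => //.
exact: measurable_funB.
Qed.

Notation wgap p w N s := (s `^ (- p - 1) * simplex_gap N (s / w)) (only parsing).

Lemma integral_simplex_gap_scale (N : nat) (p w : R) : 0 < w ->
  (\int[mu]_(s in `]0%R, +oo[) (wgap p w N s)%:E =
   (w `^ (- p))%:E * \int[mu]_(s in `]0%R, +oo[) (wgap p 1 N s)%:E)%E.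
Proof.
move=> w0; have wi0 : 0 < w^-1 by rewrite invr_gt0.
(* Truncating at 0 makes the integrand nonnegative on the whole line, as [ge0_integral_scale]
   demands, without changing it on the half-line. *)
pose f (s : R) := (s `^ (- p - 1) * simplex_gap N (Num.max s 0))%:E : \bar R.
have mf : measurable_fun [set: R] f.
  apply/measurable_EFinP; apply: measurable_funM; first exact: measurable_powR.
  apply: (measurableT_comp (measurable_simplex_gap N)); exact: measurable_maxr.
have f0 s : (0 <= f s)%E.
  by rewrite lee_fin mulr_ge0 ?powR_ge0// simplex_gap_ge0// le_max lexx orbT.
have -> : (\int[mu]_(s in `]0%R, +oo[) (wgap p 1 N s)%:E = \int[mu]_(s in `]0%R,
  +oo[) f s)%E.
  apply: eq_integral => s; rewrite inE/= in_itv/= andbT => s0.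
  by rewrite /f divr1 max_l// ltW.
have -> : (w `^ (- p))%:E = ((w `^ (- p - 1))%:E * (w^-1)^-1%:E)%E :> \bar R.
  rewrite -EFinM invrK -{3}(powRr1 (ltW w0)) -powRD ?subrK//.
  by rewrite (gt_eqF w0) implybT.
rewrite -muleA -(ge0_integral_scale wi0 mf f0) -ge0_integralZl//; last 2 first.
- by apply: measurable_funTS; apply: (measurableT_comp mf); exact: measurable_funM.
- by rewrite lee_fin powR_ge0.
apply: eq_integral => s; rewrite inE/= in_itv/= andbT => s0.
rewrite /f -EFinM max_l; last by rewrite mulr_ge0 ?ltW.
rewrite mulrA -(powRM _ (ltW w0) (mulr_ge0 (ltW wi0) (ltW s0))).
by rewrite mulVKf ?gt_eqF// [_ * s]mulrC.
Qed.

(** Multiplying by the power of [w] turns the scaled gap into a difference of a function of [w] and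
    its translate by [s]. *)
Lemma simplex_gap_pM (N : nat) (w s : R) : 0 < w ->
  w ^+ N * simplex_gap N (s / w) = w ^+ N - Num.max (w - s) 0 ^+ N.
Proof.
move=> w0; rewrite /simplex_gap mulrBr mulr1 -exprMn maxr_pMr ?(ltW w0)// mulr0.
by rewrite mulrBr mulr1 [w * (s / w)]mulrC divfK ?gt_eqF.
Qed.

(** The subtracted term is exp(-s) times the translate by [s] of the Gamma integrand, so its
    integral is exp(-s) times that of the first term. *)
Lemma integral_simplex_gap_expRN (N : nat) (s : R) : (0 < N)%N -> 0 < s ->
  (\int[mu]_(w in `]0%R, +oo[) ((w ^+ N - Num.max (w - s) 0 ^+ N) * expR (- w))%:E =
   (Gamma N.+1%:R * (1 - expR (- s)))%:E)%E.
Proof.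
move=> N0 s0; have [G GN] : exists G : R, G = Gamma N.+1%:R by eexists.
pose g (w : R) : R := Num.max w 0 ^+ N * expR (- w).
have mg : measurable_fun [set: R] g.
  apply: measurable_funM; first by apply: measurable_funX; exact: measurable_maxr.
  exact: measurableT_comp.
have mg' : measurable_fun [set: R] (fun w => (g w)%:E : \bar R) by exact/measurable_EFinP.
have g0 w : 0 <= g w by rewrite mulr_ge0 ?expR_ge0// exprn_ge0// le_max lexx orbT.
(* Positivity of [N] matters: [0 ^+ 0] is 1. *)
have gN0 w : w <= 0 -> g w = 0 by move=> w0; rewrite /g max_r// expr0n gtn_eqF ?mul0r.
have gp : (\int[mu]_(w in `]0%R, +oo[) (g w)%:E = G%:E)%E.
  rewrite GN -GammaE ?ltr0n//; apply: eq_integral_oo => w w0.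
  by rewrite /g (max_l (ltW w0)) /gamma_density -natr1 addrK powR_mulrn// ltW.
have gE : (\int[mu]_w (g w)%:E = G%:E)%E.
  rewrite -gp [RHS]integral_mkcond; apply: eq_integral => w _.
  by rewrite patchE mem_setE in_itv/= andbT; case: ltP => // /gN0->.
have gs : (\int[mu]_w (g (w - s))%:E = G%:E)%E.
  have h := ge0_integral_affine (- s) ltr01 mg' (fun w => g0 w).
  rewrite invr1 mul1e gE in h.
  by rewrite -h; apply: eq_integral => w _; rewrite mul1r.
have mgs : measurable_fun [set: R] (fun w => g (w - s)).
  by apply: (measurableT_comp mg); exact: measurable_funB.
have gsp : (\int[mu]_(w in `]0%R, +oo[) (expR (- s) * g (w - s))%:E =
  (expR (- s) * G)%:E)%E.
  rewrite ge0_integralZl_oo ?expR_ge0// EFinM; congr (_ * _)%E.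
  rewrite -gs integral_mkcond; apply: eq_integral => w _.
  rewrite patchE mem_setE in_itv/= andbT; case: ltP => // w0.
  by rewrite gN0// subr_le0 (le_trans w0)// ltW.
pose k (w : R) : R := g w - expR (- s) * g (w - s).
have kE (w : R) : 0 < w -> (w ^+ N - Num.max (w - s) 0 ^+ N) * expR (- w) = k w.
  move=> w0; rewrite /k /g (max_l (ltW w0)) mulrBl; congr (_ - _).
  have -> : expR (- w) = expR (- s) * expR (- (w - s)).
    by rewrite -expRD; congr expR; ring.
  by rewrite mulrCA.
transitivity (\int[mu]_(w in `]0%R, +oo[) (k w)%:E)%E.
  by apply: eq_integral_oo => w w0; rewrite kE.
have mk : measurable_fun [set: R] k by apply: measurable_funB => //;
  exact: measurable_funM.
(* Adding the translated part back avoids a subtraction of extended reals; the finite total then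
   forces the integral of [k] to be finite. *)
have sumE : (\int[mu]_(w in `]0%R, +oo[) (k w)%:E + (expR (- s) * G)%:E = G%:E)%E.
  rewrite -gsp -[in RHS]gp -ge0_integralD//; last 4 first.
  - move=> w; rewrite /= in_itv/= andbT => w0; rewrite lee_fin -kE//.
    rewrite mulr_ge0 ?expR_ge0// subr_ge0; apply: lerXn2r.
    - by rewrite nnegrE le_max lexx orbT.
    - by rewrite nnegrE ltW.
    - by rewrite ge_max (ltW w0) andbT gerBl ltW.
  - by apply: measurable_funTS; exact/measurable_EFinP.
  - by move=> w _; rewrite lee_fin mulr_ge0 ?expR_ge0.
  - by apply: measurable_funTS; apply/measurable_EFinP; exact: measurable_funM.
  by apply: eq_integral => w _; rewrite -EFinD /k subrK.
move: sumE; case: (\int[mu]_(w in _) _)%E => [r| |] //.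
rewrite -EFinD => -[h]; congr EFin; apply: (addIr (expR (- s) * G)).
by rewrite h -GN; ring.
Qed.

(** For fixed [w], rescaling [s] by [w] extracts a factor w^(-p), which joins w^N exp(-w) to form
    the Gamma density of order N + 1 - p. *)
Lemma integral_simplex_gap_row (N : nat) (p w : R) : 0 < w ->
  (\int[mu]_(s in `]0%R, +oo[)
      (s `^ (- p - 1) * ((w ^+ N - Num.max (w - s) 0 ^+ N) * expR (- w)))%:E =
   (gamma_density (N.+1%:R - p) w)%:E *
   \int[mu]_(s in `]0%R, +oo[) (s `^ (- p - 1) * simplex_gap N s)%:E)%E.
Proof.
move=> w0.
transitivity (\int[mu]_(s in `]0%R, +oo[)
    ((w ^+ N * expR (- w)) * (s `^ (- p - 1) * simplex_gap N (s / w)))%:E)%E.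
  apply: eq_integral_oo => s s0; congr EFin; rewrite -(simplex_gap_pM N s w0).
  have alg (a b c d : R) : a * (b * c * d) = b * d * (a * c) by ring.
  exact: alg.
rewrite ge0_integralZl_oo; last 3 first.
- by apply: mulr_ge0; [apply: exprn_ge0; exact: ltW|exact: expR_ge0].
- apply: measurable_funM; first exact: measurable_powR.
  by apply: (measurableT_comp (measurable_simplex_gap N)); exact: measurable_funM.
- move=> s s0; apply: mulr_ge0; first exact: powR_ge0.
  by apply: simplex_gap_ge0; apply: divr_ge0; exact: ltW.
rewrite integral_simplex_gap_scale//.
transitivity ((w ^+ N * expR (- w) * w `^ (- p))%:E *
  \int[mu]_(s in `]0%R, +oo[) (s `^ (- p - 1) * simplex_gap N s)%:E)%E.
  rewrite [in RHS]EFinM -[in RHS]muleA; congr (_ * (_ * _))%E.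
  by apply: eq_integral_oo => s s0; rewrite divr1.
congr (_ * _)%E; congr EFin; rewrite /gamma_density mulrAC -natr1; congr (_ * _).
rewrite -powR_mulrn; last exact: ltW.
rewrite -powRD; last by rewrite (gt_eqF w0) implybT.
by congr (_ `^ _); ring.
Qed.

Lemma integral_simplex_gap_col (N : nat) (p s : R) : (0 < N)%N -> 0 < s ->
  (\int[mu]_(w in `]0%R, +oo[)
      (s `^ (- p - 1) * ((w ^+ N - Num.max (w - s) 0 ^+ N) * expR (- w)))%:E =
   (Gamma N.+1%:R * (s `^ (- p - 1) * (1 - expR (- s))))%:E)%E.
Proof.
move=> N0 s0; rewrite ge0_integralZl_oo; last 3 first.
- exact: powR_ge0.
- apply: measurable_funM; last exact: measurableT_comp.
  apply: measurable_funB; first exact: measurable_funX.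
  by apply: measurable_funX; apply: measurable_maxr => //; exact: measurable_funB.
- move=> w w0; apply: mulr_ge0; last exact: expR_ge0.
  rewrite -simplex_gap_pM//; apply: mulr_ge0; first by apply: exprn_ge0; exact: ltW.
  by apply: simplex_gap_ge0; apply: divr_ge0; exact: ltW.
by rewrite integral_simplex_gap_expRN// -EFinM mulrCA.
Qed.

(* Integrating the scaled identity against [w ^+ N * expR (- w)] turns
   [simplex_gap N] into [1 - expR (- s)], whose integral is a value of [Gamma]. *)
Lemma integral_simplex_gap (N : nat) (p : R) : (0 < N)%N -> 0 < p < 1 ->
  (\int[mu]_(s in `]0%R, +oo[) (s `^ (- p - 1) * simplex_gap N s)%:E =
   (Gamma N.+1%:R * Gamma (1 - p) / (p * Gamma (N.+1%:R - p)))%:E)%E.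
Proof.
move=> N0 p01; case/andP: (p01) => p0 p1.
have NP : 0 < N.+1%:R - p by rewrite subr_gt0 (lt_le_trans p1)// ler1n.
pose F (ws : R * R) : R := ws.2 `^ (- p - 1) *
  ((ws.1 ^+ N - Num.max (ws.1 - ws.2) 0 ^+ N) * expR (- ws.1)).
have mF : measurable_fun [set: measurableTypeR R * measurableTypeR R] F.
  have mE : measurable_fun [set: R] (fun w : R => expR (- w)) by exact: measurableT_comp.
  have mp : measurable_fun [set: R] (fun s : R =>
    s `^ (- p - 1)) by exact: measurable_powR.
  apply: measurable_funM; first exact: (measurableT_comp mp measurable_snd).
  apply: measurable_funM; last exact: (measurableT_comp mE measurable_fst).
  apply: measurable_funB; first by apply: measurable_funX; exact: measurable_fst.
  apply: measurable_funX; apply: measurable_maxr => //.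
  by apply: measurable_funB; [exact: measurable_fst|exact: measurable_snd].
have F0 x y : 0 < x -> 0 < y -> 0 <= F (x, y).
  move=> x0 y0; apply: mulr_ge0; first exact: powR_ge0.
  apply: mulr_ge0; last exact: expR_ge0.
  rewrite -simplex_gap_pM//; apply: mulr_ge0; first by apply: exprn_ge0; exact: ltW.
  by apply: simplex_gap_ge0; apply: divr_ge0; exact: ltW.
have := fubini_tonelli_oo mF F0.
under eq_integral_oo => w w0 do rewrite (integral_simplex_gap_row N p w0).
under [X in _ = X -> _]eq_integral_oo =>
  s s0 do rewrite (integral_simplex_gap_col p N0 s0).
have J0 : (0 <= \int[mu]_(s in `]0%R, +oo[) (s `^ (- p - 1) * simplex_gap N s)%:E)%E.
  apply: integral_ge0 => s; rewrite /= in_itv/= andbT => s0.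
  by rewrite lee_fin; apply: mulr_ge0; [exact: powR_ge0|apply: simplex_gap_ge0;
    exact: ltW].
rewrite ge0_integralZr; [|exact: measurable_itv| |by move=> w _;
  rewrite lee_fin gamma_density_ge0|exact: J0]; last first.
  by apply: measurable_funTS; apply/measurable_EFinP; exact: measurable_gamma_density.
have GN0 : 0 < Gamma N.+1%:R :> R by apply: Gamma_gt0; rewrite ltr0n.
rewrite ge0_integralZl_oo; last 3 first.
- exact: ltW.
- apply: measurable_funM; first exact: measurable_powR.
  by apply: measurable_funB => //; exact: measurableT_comp.
- move=> s s0; apply: mulr_ge0; first exact: powR_ge0.
  by rewrite subr_ge0 -expR0 ler_expR oppr_le0 ltW.
rewrite (GammaE NP) integral_powR_1BexpRN// -EFinM.
have G0 := Gamma_gt0 NP; move: (Gamma (N.+1%:R - p)) G0 J0 => G G0.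
case: (\int[mu]_(s in _) _)%E => [j| |] // _.
- rewrite -EFinM => -[h]; congr EFin.
  by apply: (mulfI (lt0r_neq0 G0)); rewrite h; field; rewrite !gt_eqF.
- by rewrite gt0_muley ?lte_fin.
Qed.
End beta.

(** * Rotation of the Gamma integral *)

Section oscillating_gamma.
Context {R : realType}.
Notation mu := (@lebesgue_measure R).
Variables (p a : R).
Hypotheses (p_gt0 : 0 < p) (a_gt0 : 0 < a).

(** The Gamma density with rate [a]; letting [a] tend to 0 removes the damping. *)
Definition exp_density (q r : R) : R := r `^ (q - 1) * expR (- (a * r)).

Lemma measurable_exp_density q : measurable_fun [set: R] (exp_density q).
Proof.
apply: measurable_funM; first exact: measurable_powR.
by apply: measurableT_comp => //; apply: measurableT_comp => //; exact: measurable_funM.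
Qed.

Lemma exp_density_ge0 q r : 0 <= exp_density q r.
Proof. by apply: mulr_ge0; [exact: powR_ge0|exact: expR_ge0]. Qed.

Lemma integrable_exp_density q : 0 < q ->
  mu.-integrable (`]0, +oo[%classic : set R) (EFin \o exp_density q).
Proof.
move=> q0; apply/integrableP; split.
  by apply: measurable_funTS; apply/measurable_EFinP; exact: measurable_exp_density.
under eq_integral => r _ do rewrite /= ger0_norm ?exp_density_ge0//.
by rewrite integral_gamma_scale// ltry.
Qed.

Variables (g g' : R -> R).
Hypothesis dg : forall x : R, is_derive x 1 g (g' x).
Hypothesis cg' : continuous g'.
Hypothesis g1 : forall x, `|g x| <= 1.
Hypothesis g'1 : forall x, `|g' x| <= 1.

Let cg : continuous g. Proof. by move=> x; exact: is_derive_continuous (dg x). Qed.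

Lemma integrable_exp_density_osc (h : R -> R) q b : 0 < q -> continuous h ->
  (forall x, `|h x| <= 1) ->
  mu.-integrable (`]0, +oo[%classic : set R) (EFin \o (fun r =>
    exp_density q r * h (b * r))).
Proof.
move=> q0 ch h1; apply: (le_integrable _ _ _ (integrable_exp_density q0)) => //.
- apply: measurable_funTS; apply/measurable_EFinP; apply: measurable_funM.
    exact: measurable_exp_density.
  apply: (measurableT_comp (continuous_measurable_fun ch)); exact: measurable_funM.
- move=> r _; rewrite lee_fin normrM ler_piMr//.
Qed.

(** Differentiation under the integral sign, where [exp_density (p + 1)] dominates the derivative
    whatever [b]. The function [g] stands for [cos] and for [sin]. *)
Lemma is_derive_exp_osc (b : R) :
  is_derive b 1 (fun b => \int[mu]_(r in `]0, +oo[) (exp_density p r * g (b * r)))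
    (\int[mu]_(r in `]0, +oo[) (exp_density (p + 1) r * g' (b * r))).
Proof.
pose f (b r : R) := exp_density p r * g (b * r).
have df (x r : R) : 0 < r -> is_derive x 1 (f ^~ r) (exp_density (p + 1) r * g' (x * r)).
  move=> r0; rewrite /f.
  have h1 : is_derive x 1 (fun x : R => x * r) r.
    have h := @is_deriveM R R id (cst r) x 1 1 0 (is_derive_id _ _) (is_derive_cst _ _ _).
    by apply: is_derive_eq h _; rewrite scaler0 add0r /GRing.scale/= mulr1.
  have h2 := @is_derive1_comp R g (fun x : R => x * r) x _ _ (dg (x * r)) h1.
  have h3 := @is_deriveZ R R R _ (exp_density p r) x 1 _ h2.
  apply: is_derive_eq h3 _; rewrite /GRing.scale/= /exp_density addrK.
  rewrite -(mulr_powRB1 (ltW r0) p_gt0); ring.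
have p1 : 0 < p + 1 by rewrite addr_gt0.
have Ib : (`]b - 1, b + 1[%classic : set R) b.
  by rewrite /= in_itv/= ltrBlDr ltrDl ltr01.
have intf (x : R) : (`]b - 1, b + 1[%classic : set R) x ->
    mu.-integrable (`]0, +oo[%classic : set R) (EFin \o f x).
  by move=> _; exact: integrable_exp_density_osc.
have derf (x r : R) : (`]b - 1, b + 1[%classic : set R) x ->
  (`]0, +oo[%classic : set R) r ->
    derivable (f ^~ r) x 1.
  by move=> _; rewrite /= in_itv/= andbT => r0; have [] := df x r r0.
have bnd (x r : R) : (`]b - 1, b + 1[%classic : set R) x ->
  (`]0, +oo[%classic : set R) r ->
    `|partial1of2 f x r| <= exp_density (p + 1) r.
  move=> _; rewrite /= in_itv/= andbT => r0; rewrite partial1of2E;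
    have [_ ->] := df x r r0.
  by rewrite normrM (ger0_norm (exp_density_ge0 _ _)) ler_piMr// exp_density_ge0.
apply: DeriveDef.
  exact: (@derivable_under_integral _ _ _ mu f _ (measurable_itv _) b (b -
    1) (b + 1) Ib intf derf
    _ (exp_density_ge0 _) (integrable_exp_density p1) bnd).
rewrite -derive1E.
rewrite (@differentiation_under_integral _ _ _ mu f _ (measurable_itv _) b (b -
  1) (b + 1) Ib intf derf
    _ (exp_density_ge0 _) (integrable_exp_density p1) bnd).
apply: eq_Rintegral => r; rewrite inE/= in_itv/= andbT => r0.
by rewrite partial1of2E; have [_ ->] := df b r r0.
Qed.

Lemma is_derive_exp_density (r : R) : 0 < r ->
  is_derive r 1 (exp_density (p + 1)) (p * exp_density p r - a * exp_density (p + 1) r).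
Proof.
move=> r0.
have h1 : is_derive r 1 (fun r : R => - (a * r)) (- a).
  have h := @is_deriveN R R R _ r 1 _ (@is_deriveZ R R R id a r 1 1 (is_derive_id _ _)).
  by apply: is_derive_eq h _; rewrite /GRing.scale/= mulr1.
have h2 := @is_derive1_comp R expR (fun r : R => - (a * r)) r _ _ (is_derive_expR _) h1.
have h3 := @is_deriveM R R (fun r => r `^ p) _ r 1 _ _ (is_derive_powR p r0) h2.
have e : exp_density (p + 1) = (fun r : R => r `^ p) * (expR \o (fun r : R => - (a * r))).
  by apply/funext => x; rewrite /exp_density addrK.
rewrite [X in is_derive _ _ X _]e.
by apply: is_derive_eq h3 _; rewrite /GRing.scale/= /exp_density addrK; ring.
Qed.

(** The function r^p exp(-a r) g(b r) vanishes at both ends, so the integral of its derivative is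
    0. *)
Lemma exp_osc_by_parts (b : R) :
  p * \int[mu]_(r in `]0, +oo[) (exp_density p r * g (b * r)) =
  a * \int[mu]_(r in `]0, +oo[) (exp_density (p + 1) r * g (b * r)) -
  b * \int[mu]_(r in `]0, +oo[) (exp_density (p + 1) r * g' (b * r)).
Proof.
have p1 : 0 < p + 1 by rewrite addr_gt0.
pose f0 r := exp_density p r * g (b * r).
pose f1 r := exp_density (p + 1) r * g (b * r).
pose f2 r := exp_density (p + 1) r * g' (b * r).
have i0 : mu.-integrable (`]0, +oo[%classic : set R) (EFin \o f0) by exact:
  integrable_exp_density_osc.
have i1 : mu.-integrable (`]0, +oo[%classic : set R) (EFin \o f1) by exact:
  integrable_exp_density_osc.
have i2 : mu.-integrable (`]0, +oo[%classic : set R) (EFin \o f2) by exact: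
  integrable_exp_density_osc.
have mI : measurable (`]0, +oo[%classic : set (measurableTypeR R)) by exact:
  measurable_itv.
have iZ (c : R) (f : R -> R) : mu.-integrable (`]0, +oo[%classic : set R) (EFin \o f) ->
    mu.-integrable (`]0, +oo[%classic : set R) (EFin \o (fun r => c * f r)).
  by move=> h; apply: eq_integrable (integrableZl _ c h).
pose f r := p * f0 r - (a * f1 r - b * f2 r).
have i12 : mu.-integrable (`]0, +oo[%classic : set R) (EFin \o (fun r =>
  a * f1 r - b * f2 r)).
  by apply: eq_integrable (integrableB _ (iZ a _ i1) (iZ b _ i2)).
have intf : mu.-integrable (`]0, +oo[%classic : set R) (EFin \o f).
  by apply: eq_integrable (integrableB _ (iZ p _ i0) i12).
have cmul (x c : R) : {for x, continuous (fun r : R => c * r)} by exact: mulrl_continuous.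
have cosc (x : R) (q : R) (h : R -> R) : 0 < x -> continuous h ->
    {for x, continuous (fun r => exp_density q r * h (b * r))}.
  move=> x0 ch; apply: continuousM; last first.
    by apply: (@continuous_comp _ _ _ (fun r : R => b * r) h x); [exact: cmul|exact: ch].
  apply: continuousM; first exact: continuous_powR.
  apply: (@continuous_comp _ _ _ (fun r : R => - (a * r)) expR x);
    last exact: continuous_expR.
  by apply: continuousN; exact: cmul.
have cst_mul (x c : R) (h : R -> R) : {for x, continuous h} ->
  {for x, continuous (fun r => c * h r)}.
  by move=> ch; apply: continuousM => //; exact: cst_continuous.
have cf (x : R) : 0 < x -> {for x, continuous f}.
  move=> x0; apply: continuousB; first by apply: cst_mul; exact: cosc.
  by apply: continuousB; apply: cst_mul; exact: cosc.
have F'f (x : R) : 0 < x -> is_derive x 1 f1 (f x).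
  move=> x0.
  have h1 : is_derive x 1 (fun r : R => b * r) b.
    have h := @is_deriveZ R R R id b x 1 1 (is_derive_id _ _).
    by apply: is_derive_eq h _; rewrite /GRing.scale/= mulr1.
  have h2 := @is_derive1_comp R g (fun r : R => b * r) x _ _ (dg (b * x)) h1.
  have h3 := @is_deriveM R R _ _ x 1 _ _ (is_derive_exp_density x0) h2.
  by apply: is_derive_eq h3 _; rewrite /GRing.scale/= /f /f0 /f1 /f2; ring.
have bnd r : - exp_density (p + 1) r <= f1 r <= exp_density (p + 1) r.
  rewrite -ler_norml /f1 normrM (ger0_norm (exp_density_ge0 _ _)) ler_piMr//.
  exact: exp_density_ge0.
have F0 : f1 x @[x --> 0^'+] --> (0 : R).
  have h : exp_density (p + 1) x @[x --> 0^'+] --> (0 : R).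
    apply: (@squeeze_cvgr _ _ _ _ (cst 0) (fun r : R => r `^ p)).
    - near=> r; have r0 : 0 < r by near: r; exact: nbhs_right_gt.
      rewrite exp_density_ge0/= /exp_density addrK ler_piMr ?powR_ge0//.
      by rewrite -expR0 ler_expR oppr_le0 mulr_ge0// ltW.
    - exact: cvg_cst.
    - exact: powR_cvg0.
  apply: (@squeeze_cvgr _ _ _ _ (fun r =>
    - exp_density (p + 1) r) (exp_density (p + 1))) => //.
  - by near=> r.
  - by rewrite -[X in _ --> X]oppr0; exact: cvgN.
have Fy : f1 x @[x --> +oo] --> (0 : R).
  have h : exp_density (p + 1) x @[x --> +oo] --> (0 : R).
    have ay : (a * x) @[x --> +oo] --> +oo.
      apply/cvgryPge => M; near=> x.
      have Mx : a^-1 * M <= x by near: x; apply: nbhs_pinfty_ge; exact: num_real.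
      by move: Mx; rewrite ler_pdivrMl.
    have h1 := cvg_comp _ _ ay (cvg_powR_expRN_y p_gt0).
    have h2 : a `^ (- p) * ((a * x) `^ p * expR (- (a * x))) @[x --> +oo] --> (0 : R).
      by rewrite -[X in _ --> X](mulr0 (a `^ (- p))); apply: cvgMr.
    apply: cvg_trans h2; apply: near_eq_cvg; near=> x.
    have x0 : 0 < x by near: x; exact: nbhs_pinfty_gt.
    rewrite /exp_density addrK (powRM _ (ltW a_gt0) (ltW x0)) !mulrA -powRD ?addNr
      ?powRr0 ?mul1r//.
    by rewrite (gt_eqF a_gt0) implybT.
  apply: (@squeeze_cvgr _ _ _ _ (fun r =>
    - exp_density (p + 1) r) (exp_density (p + 1))) => //.
  - by near=> r.
  - by rewrite -[X in _ --> X]oppr0; exact: cvgN.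
have := FTC_oo F'f cf F0 Fy intf; rewrite subrr /f.
rewrite (RintegralB mI (iZ p _ i0) i12) (RintegralB mI (iZ a _ i1) (iZ b _ i2)).
rewrite (RintegralZl _ mI i0) (RintegralZl _ mI i1) (RintegralZl _ mI i2).
by move/eqP; rewrite subr_eq0 => /eqP.
Unshelve. all: end_near. Qed.

End oscillating_gamma.

Section rotation.
Context {R : realType}.
Notation mu := (@lebesgue_measure R).

(** The real part of Gamma(p) (a - ib)^(-p). As functions of [b], the cosine integral [C] and the
    sine integral [S] have derivatives [- S1] and [C1]; integration by parts expresses [C1] and [S1]
    through [C] and [S], whence a linear differential system. *)
Lemma gamma_rotation (p a b : R) : 0 < p -> 0 < a ->
  \int[mu]_(r in `]0, +oo[) (exp_density a p r * cos (b * r)) =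
  Gamma p * (a ^+ 2 + b ^+ 2) `^ (- (p / 2)) * cos (p * atan (b / a)).
Proof.
move=> p0 a0.
pose C (x : R) := \int[mu]_(r in `]0, +oo[) (exp_density a p r * cos (x * r)).
pose S (x : R) := \int[mu]_(r in `]0, +oo[) (exp_density a p r * sin (x * r)).
pose C1 (x : R) := \int[mu]_(r in `]0, +oo[) (exp_density a (p + 1) r * cos (x * r)).
pose S1 (x : R) := \int[mu]_(r in `]0, +oo[) (exp_density a (p + 1) r * sin (x * r)).
have sin1 (x : R) : `|sin x| <= 1 by rewrite ler_norml sin_geN1 sin_le1.
have cos1 (x : R) : `|cos x| <= 1 by rewrite ler_norml cos_geN1 cos_le1.
have nsin1 (x : R) : `|- sin x| <= 1 by rewrite normrN.
have cnsin : continuous (fun x : R => - sin x) by move=> x; apply: continuousN;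
  exact: continuous_sin.
have int1 (x : R) : mu.-integrable (`]0, +oo[%classic : set R)
    (EFin \o (fun r => exp_density a (p + 1) r * sin (x * r))).
  by apply: integrable_exp_density_osc => //; [rewrite addr_gt0|exact: continuous_sin].
have NS1 (x : R) : \int[mu]_(r in `]0,
  +oo[) (exp_density a (p + 1) r * - sin (x * r)) = - S1 x.
  rewrite -mulN1r /S1 -RintegralZl//.
  by apply: eq_Rintegral => r _; rewrite mulrN mulN1r.
have dC (x : R) : is_derive x 1 C (- S1 x).
  rewrite -NS1; exact: (is_derive_exp_osc p0 a0 (@is_derive_cos R) cos1 nsin1).
have dS (x : R) : is_derive x 1 S (C1 x).
  exact: (is_derive_exp_osc p0 a0 (@is_derive_sin R) sin1 cos1).
have E1 (x : R) : p * C x = a * C1 x + x * S1 x.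
  have := exp_osc_by_parts p0 a0 (@is_derive_cos R) cnsin cos1 nsin1 x.
  by rewrite NS1 mulrN opprK.
have E2 (x : R) : p * S x = a * S1 x - x * C1 x.
  exact: (exp_osc_by_parts p0 a0 (@is_derive_sin R) (@continuous_cos R) sin1 cos1 x).
pose Q (x : R) := a ^+ 2 + x ^+ 2.
have Q0 (x : R) : 0 < Q x by rewrite ltr_pwDl// ?exprn_gt0// sqr_ge0.
pose rho (x : R) := Q x `^ (p / 2).
pose psi (x : R) := p * atan (x / a).
have drho (x : R) : is_derive x 1 rho (p * x * rho x / Q x).
  have dQ : is_derive x 1 Q (2 * x).
    have h := @is_deriveD R R R (cst (a ^+ 2)) _ x 1 _ _ (is_derive_cst _ _ _)
      (@is_deriveM R R id id x 1 1 1 (is_derive_id _ _) (is_derive_id _ _)).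
    have e : Q = cst (a ^+ 2) + id * id by apply/funext => y; rewrite /Q expr2.
    rewrite [X in is_derive _ _ X _]e.
    by apply: is_derive_eq h _; rewrite /GRing.scale/= mulr1 add0r; ring.
  have h := @is_derive1_comp R (fun y =>
    y `^ (p / 2)) Q x _ _ (is_derive_powR (p / 2) (Q0 x)) dQ.
  apply: is_derive_eq h _.
  have -> : Q x `^ (p / 2 - 1) = rho x / Q x.
    by rewrite powRB ?powRr1 ?(ltW (Q0 x))// (gt_eqF (Q0 x)) implybT.
  by field; rewrite gt_eqF.
have dpsi (x : R) : is_derive x 1 psi (p * a / Q x).
  have dl : is_derive x 1 (fun x : R => x / a) a^-1.
    have h := @is_deriveZ R R R id a^-1 x 1 1 (is_derive_id _ _).
    rewrite (_ : (fun x : R => x / a) = a^-1 \*: id); last by apply/funext => y;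
      rewrite mulrC.
    by apply: is_derive_eq h _; rewrite /GRing.scale/= mulr1.
  have h1 := @is_derive1_comp R atan (fun x : R => x / a) x _ _ (is_derive1_atan _) dl.
  have h2 := @is_deriveZ R R R _ p x 1 _ h1.
  apply: is_derive_eq h2 _; rewrite /GRing.scale/= /Q.
  by field; rewrite (gt_eqF a0) andbT; exact: lt0r_neq0 (Q0 x).
have C1E (x : R) : C1 x = (a * (p * C x) - x * (p * S x)) / Q x.
  rewrite E1 E2; apply: (mulIf (lt0r_neq0 (Q0 x)));
    rewrite divfK ?(lt0r_neq0 (Q0 x))// /Q; ring.
have S1E (x : R) : S1 x = (x * (p * C x) + a * (p * S x)) / Q x.
  rewrite E1 E2; apply: (mulIf (lt0r_neq0 (Q0 x)));
    rewrite divfK ?(lt0r_neq0 (Q0 x))// /Q; ring.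
have dcos (x : R) := @is_derive1_comp R cos psi x _ _ (is_derive_cos _) (dpsi x).
have dsin (x : R) := @is_derive1_comp R sin psi x _ _ (is_derive_sin _) (dpsi x).
(* [X] and [Y] are the real and imaginary parts of C + iS multiplied by (a - ib)^p; both are
   constant, hence equal to their values at 0. *)
pose X : R -> R := rho * (C * (cos \o psi) + S * (sin \o psi)).
pose Y : R -> R := rho * (S * (cos \o psi) - C * (sin \o psi)).
have dX (x : R) : is_derive x 1 X 0.
  have h := @is_deriveM R R _ _ x 1 _ _ (drho x) (@is_deriveD R R R _ _ x 1 _ _
    (@is_deriveM R R _ _ x 1 _ _ (dC x) (dcos x)) (@is_deriveM R R _ _ x 1 _ _ (dS x)
      (dsin x))).
  apply: is_derive_eq h _; rewrite /GRing.scale/= !fctE /= C1E S1E.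
  by field; exact: lt0r_neq0 (Q0 x).
have dY (x : R) : is_derive x 1 Y 0.
  have h := @is_deriveM R R _ _ x 1 _ _ (drho x) (@is_deriveB R R R _ _ x 1 _ _
    (@is_deriveM R R _ _ x 1 _ _ (dS x) (dcos x)) (@is_deriveM R R _ _ x 1 _ _ (dC x)
      (dsin x))).
  apply: is_derive_eq h _; rewrite /GRing.scale/= !fctE /= C1E S1E.
  by field; exact: lt0r_neq0 (Q0 x).
have psi0 : psi 0 = 0 by rewrite /psi mul0r atan0 mulr0.
have C0 : C 0 = a `^ (- p) * Gamma p.
  rewrite /C /Rintegral -[RHS]/(fine (a `^ (- p) * Gamma p)%:E) -(integral_gamma_scale p0
    a0).
  by congr fine; apply: eq_integral => r _; rewrite mul0r cos0 mulr1.
have S0 : S 0 = 0.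
  rewrite /S (_ : (fun r => _) = cst 0) ?Rintegral_cst ?mul0r//.
  by apply/funext => r; rewrite mul0r sin0 mulr0.
have rho0 : rho 0 = a `^ p.
  rewrite /rho /Q expr0n addr0 -powR_mulrn ?(ltW a0)// -powRrM mulrC divfK// pnatr_eq0.
have XE : X b = Gamma p.
  rewrite (is_derive_0_is_cst b 0 dX) /X !fctE /= psi0 C0 S0 rho0 cos0 sin0 mulr1 mulr0
    addr0.
  by rewrite mulrA -powRD ?subrr ?powRr0 ?mul1r// (gt_eqF a0) implybT.
have YE : Y b = 0.
  by rewrite (is_derive_0_is_cst b 0 dY) /Y !fctE /= psi0 S0 sin0 !mulr0 mul0r subrr
    mulr0.
have rinv : (a ^+ 2 + b ^+ 2) `^ (- (p / 2)) = (rho b)^-1 by rewrite powRN.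
have r0 : rho b != 0 by rewrite gt_eqF// powR_gt0.
rewrite rinv -[LHS]/(C b) -XE -[p * _]/(psi b) /X !fctE /=.
move: YE; rewrite /Y !fctE /= => /eqP;
  rewrite mulf_eq0 (negbTE r0) /= subr_eq0 => /eqP YE.
have cs : cos (psi b) ^+ 2 + sin (psi b) ^+ 2 = 1 by rewrite cos2Dsin2.
(* Undo the rotation: [Y b = 0] replaces [C b * sin (psi b)] by [S b * cos (psi b)], and [X b]
   appears. *)
transitivity (C b * (cos (psi b) ^+ 2 + sin (psi b) ^+ 2)); first by rewrite cs mulr1.
transitivity (C b * cos (psi b) ^+ 2 + (C b * sin (psi b)) * sin (psi b)); first by ring.
rewrite -YE; field; exact: r0.
Qed.

End rotation.

(** * Moments of cosine transforms *)

Section cosine_transform.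
Context d (T : measurableType d) (R : realType).
Variables (nu : {sigma_finite_measure set T -> \bar R}) (D : set T) (u : T -> R).
Hypotheses (mD : measurable D) (fD : (nu D < +oo)%E) (mu_ : measurable_fun setT u).
Notation mu := (@lebesgue_measure R).

Definition cosine_transform (r : R) : R := \int[nu]_(z in D) cos (r * u z).
Notation G := cosine_transform.

Let ioo : set (measurableTypeR R) := `]0%R, +oo[%classic.
Let mioo : measurable ioo. Proof. exact: measurable_itv. Qed.

Let cos1 (x : R) : `|cos x| <= 1. Proof. by rewrite ler_norml cos_geN1 cos_le1. Qed.

Let mcosR : measurable_fun setT (@cos R).
Proof. exact: continuous_measurable_fun (@continuous_cos R). Qed.

Let mcos (r : R) : measurable_fun setT (fun z => cos (r * u z)).
Proof.
apply: (measurableT_comp mcosR); apply: measurable_funM => //.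
Qed.

Let intcos (r : R) : nu.-integrable D (EFin \o (fun z => cos (r * u z))).
Proof.
apply: measurable_bounded_integrable => //; first exact: measurable_funTS (mcos r).
exists 1; split; first exact: num_real.
by move=> M M1 z _; exact: le_trans (cos1 _) (ltW M1).
Qed.

Let cosK (a p r : R) (z : T) : R := exp_density a p r * cos (r * u z).

Let mcosK a p : measurable_fun setT (fun rz : measurableTypeR R * T =>
  cosK a p rz.1 rz.2).
Proof.
apply: measurable_funM.
  exact: (measurableT_comp (measurable_exp_density a p) measurable_fst).
apply: (measurableT_comp mcosR); apply: measurable_funM; first exact: measurable_fst.
exact: (measurableT_comp mu_ measurable_snd).
Qed.

(** Fubini, legitimate thanks to the damping: the integrand is dominated by [exp_density a p] on a
    set of finite measure in the other variable. The inner integral is [gamma_rotation]. *)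
Lemma integral_cosine_transform_reg (a p : R) : 0 < a -> 0 < p ->
  (\int[mu]_(r in `]0%R, +oo[) (G r * exp_density a p r)%:E =
   \int[nu]_(z in D) (Gamma p * (a ^+ 2 +
     u z ^+ 2) `^ (- (p / 2)) * cos (p * atan (u z / a)))%:E)%E.
Proof.
move=> a0 p0.
pose B : set (measurableTypeR R * T) := ioo `*` D.
have mB : measurable B by exact: measurableX.
pose F := (EFin \o (fun rz : measurableTypeR R * T => cosK a p rz.1 rz.2)) \_ B.
have mF : measurable_fun setT F.
  apply/(measurable_restrictT _ mB); apply: measurable_funTS; apply/measurable_EFinP.
  exact: mcosK.
have FE r z : F (r, z) = if (r \in ioo) && (z \in D) then (cosK a p r z)%:E else 0%E.
  rewrite /F patchE; congr (if _ then _ else _).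
  by apply/idP/andP => [/set_mem[/= h1 h2]|[/set_mem h1 /set_mem h2]]; [split;
    exact/mem_set|exact/mem_set].
have intF : (mu \x nu)%E.-integrable setT F.
  apply/integrable12ltyP => //.
  apply: (@le_lt_trans _ _ (\int[mu]_(r in `]0%R,
    +oo[) (fine (nu D) * exp_density a p r)%:E)%E).
    rewrite [leRHS]integral_mkcond; apply: ge0_le_integral => //.
    - by move=> r _; apply: integral_ge0.
    - apply: (@measurable_fun_fubini_tonelli_F _ _ _ _ _ nu (fun x => `|F x|%E)) => //.
      by apply: measurableT_comp.
    - apply/(measurable_restrictT _ mioo); apply: measurable_funTS;
      apply/measurable_EFinP.
      by apply: measurable_funM => //; exact: measurable_exp_density.
    move=> r _; rewrite patchE; case: ifPn => r0; last first.
      by rewrite integral0_eq// => z _; rewrite FE (negbTE r0) abse0.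
    apply: (@le_trans _ _ (\int[nu]_(z in D) (exp_density a p r)%:E)%E).
      rewrite [leRHS]integral_mkcond; apply: ge0_le_integral => //.
      - by apply: measurableT_comp => //;
        exact: (measurableT_comp mF (measurable_pair1 r)).
      - by apply/(measurable_restrictT _ mD); exact: measurable_cst.
      move=> z _; rewrite FE patchE r0 /=; case: ifPn => zD; last by rewrite abse0.
      rewrite abse_EFin lee_fin /cosK normrM (ger0_norm (exp_density_ge0 _ _ _)).
      by rewrite ler_piMr// exp_density_ge0.
    by rewrite integral_cst// -[X in (_ * X)%E]fineK ?ge0_fin_numE// -EFinM mulrC.
  rewrite ge0_integralZl_oo.
  - by rewrite integral_gamma_scale// -EFinM ltry.
  - exact: fine_ge0.
  - exact: measurable_exp_density.
  - by move=> r _; exact: exp_density_ge0.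
have := Fubini intF.
have -> : (\int[mu]_r \int[nu]_z F (r, z) = \int[mu]_(r in `]0%R,
  +oo[) (G r * exp_density a p r)%:E)%E.
  rewrite [RHS]integral_mkcond; apply: eq_integral => r _; rewrite patchE.
  rewrite -/ioo; case: ifPn => r0; last by rewrite integral0_eq// => z _;
    rewrite FE (negbTE r0).
  transitivity (\int[nu]_(z in D) ((exp_density a p r)%:E * (cos (r * u z))%:E))%E.
    by rewrite [RHS]integral_mkcond; apply: eq_integral => z _; rewrite FE r0 patchE.
  rewrite integralZl//; last exact: intcos.
  have -> : (G r * exp_density a p r)%:E =
    ((exp_density a p r)%:E * (G r)%:E)%E by rewrite -EFinM mulrC.
  congr (_ * _)%E; apply/esym/fineK.
  by apply: integrable_fin_num => //; exact: intcos.
move=> ->; rewrite [RHS]integral_mkcond; apply: eq_integral => z _; rewrite patchE.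
case: ifPn => zD; last by rewrite integral0_eq// => r _; rewrite FE (negbTE zD) andbF.
rewrite -(gamma_rotation (u z) p0 a0).
transitivity (\int[mu]_(r in `]0%R, +oo[) (exp_density a p r * cos (u z * r))%:E)%E.
  rewrite [RHS]integral_mkcond; apply: eq_integral => r _; rewrite FE zD andbT patchE.
  by rewrite /cosK mulrC [_ * u z]mulrC mulrC.
rewrite /Rintegral fineK//; apply: integrable_fin_num => //.
apply: integrable_exp_density_osc => //; exact: continuous_cos.
Qed.

End cosine_transform.

Section slab_layer_cake.
Context d (T : measurableType d) (R : realType).
Variables (nu : {sigma_finite_measure set T -> \bar R}) (D : set T) (u : T -> R).
Hypotheses (mD : measurable D) (fD : (nu D < +oo)%E) (mu_ : measurable_fun setT u).
Notation mu := (@lebesgue_measure R).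

Definition slab (s : R) : set T := D `&` [set z | `|u z| < s].

Lemma measurable_slab s : measurable (slab s).
Proof.
apply: measurableI => //; apply: measurable_set_ltr; last exact: measurable_cst.
by apply: measurableT_comp.
Qed.

Lemma slab_fin_num s : nu (slab s) \is a fin_num.
Proof.
rewrite ge0_fin_numE//; apply: le_lt_trans fD.
by apply: le_measure; rewrite ?inE//; [exact: measurable_slab|move=> z []].
Qed.

(** Write [phi] as the integral of [w] beyond its argument and exchange the integrals. It is applied
    to powers for p < 1 and to the Poisson kernel for p = 1. *)
Lemma integral_slab (w phi : R -> R) :
  measurable_fun [set: R] w -> measurable_fun [set: R] phi ->
  (forall s, 0 < s -> 0 <= w s) -> (forall s, 0 <= phi s) ->
  (forall x : R, (0 < x)%R -> \int[mu]_(s in `]x, +oo[) (w s)%:E = (phi x)%:E)%E ->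
  nu (D `&` [set z | u z = 0]) = 0%E ->
  (\int[nu]_(z in D) (phi `|u z|)%:E =
   \int[mu]_(s in `]0%R, +oo[) (w s * fine (nu (slab s)))%:E)%E.
Proof.
move=> mw mphi w0 phi0 wphi null.
pose w' := (EFin \o w) \_ (`]0, +oo[%classic : set R).
have mI x : measurable (`]x, +oo[%classic : set (measurableTypeR R)) by exact:
  measurable_itv.
have mw' : measurable_fun setT w'.
  by apply/(measurable_restrictT _ (mI 0)); apply: measurable_funTS;
    apply/measurable_EFinP.
have w'0 s : (0 <= w' s)%E.
  rewrite /w' patchE; case: ifPn => // /set_mem/=; rewrite in_itv/= andbT => s0.
  by rewrite lee_fin w0.
pose A : set (T * measurableTypeR R) := [set zs | D zs.1 /\ `|u zs.1| < zs.2].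
have mA : measurable A.
  rewrite (_ : A = fst @^-1` D `&` [set zs | `|u zs.1| < zs.2]) //.
  apply: measurableI.
    by rewrite -[X in measurable X]setTI; exact: measurable_fst.
  apply: (@measurable_set_ltr _ _ _ (fun zs : T * measurableTypeR R => `|u zs.1|) snd);
    last exact: measurable_snd.
  by apply: measurableT_comp => //; exact: (measurableT_comp mu_ measurable_fst).
have := tonelli_section nu mA mw' w'0.
have -> : (\int[mu]_s (w' s * nu [set z | A (z, s)]) = \int[mu]_(s in `]0%R,
  +oo[) (w s * fine (nu (slab s)))%:E)%E.
  rewrite [RHS]integral_mkcond; apply: eq_integral => s _; rewrite patchE /w' patchE.
  case: ifPn => s0; last by rewrite mul0e.
  by rewrite EFinM fineK ?slab_fin_num.
(* Only almost everywhere: [phi] is tied to [w] at positive arguments, so points with [u z = 0]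
   escape. *)
move=> <-; rewrite integral_mkcond; apply: ae_eq_integral => //.
- by apply/(measurable_restrictT _ mD); apply: measurable_funTS; apply/measurable_EFinP;
    apply: measurableT_comp => //; exact: measurableT_comp.
- pose F := fun zs : T * measurableTypeR R => (w' zs.2 * (\1_A zs)%:E)%E.
  have -> : (fun z => \int[mu]_(s in [set s | A (z, s)]) w' s)%E = fubini_F mu F.
    apply/funext => z; rewrite /fubini_F /F [LHS]integral_mkcond;
      apply: eq_integral => s _.
    rewrite patchE indicE; case: ifPn => /=.
      by move=> /set_mem/= h; rewrite mem_set// mule1.
    by move=> h; rewrite memNset ?mule0//; move=> h2; move: h; rewrite notin_setE.
  apply: measurable_fun_fubini_tonelli_F.
    apply: emeasurable_funM; first exact: (measurableT_comp mw' measurable_snd).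
    by apply/measurable_EFinP; exact: measurable_indic.
  by move=> zs; rewrite mule_ge0// lee_fin.
exists (D `&` [set z | u z = 0]); split => //.
  apply: measurableI => //.
  by have := mu_ measurableT (measurable_set1 (0 : R)); rewrite setTI.
move=> z /= hz; split.
  apply: contrapT => Dz; apply: hz => _.
  rewrite patchE memNset//.
  rewrite (_ : [set s | A (z, s)] = set0) ?integral_set0//.
  by apply/seteqP; split => // s [].
apply: contrapT => uz; apply: hz => _; rewrite patchE; case: ifPn => zD; last first.
  rewrite (_ : [set s | A (z, s)] = set0) ?integral_set0//.
  by apply/seteqP; split => // s [/mem_set]; rewrite (negbTE zD).
have up : 0 < `|u z| by rewrite normr_gt0; exact/eqP.
rewrite /= -(wphi _ up).
rewrite (_ : [set s | A (z, s)] = `]`|u z|, +oo[%classic); last first.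
  apply/seteqP; split => s /=; rewrite in_itv/= andbT; first by case.
  by move=> h; split => //; exact: set_mem.
apply: eq_integral => s /set_mem/=; rewrite in_itv/= andbT => h.
by rewrite /w' patchE mem_set//= in_itv/= andbT (lt_trans up).
Qed.

End slab_layer_cake.

Section regularized_kernel.
Context {R : realType}.
Variables (p x : R).
Hypotheses (p_gt0 : 0 < p) (x_neq0 : x != 0).
Notation kernel k := (Gamma p * (k.+1%:R^-1 ^+ 2 +
  x ^+ 2) `^ (- (p / 2)) * cos (p * atan (x / k.+1%:R^-1))).

Let x2_gt0 : 0 < x ^+ 2. Proof. by rewrite exprn_even_gt0. Qed.

Let powR_x2 : (x ^+ 2) `^ (- (p / 2)) = `|x| `^ (- p).
Proof.
rewrite -real_normK ?num_real// -powR_mulrn// -powRrM; congr (_ `^ _); by field.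
Qed.

(** The quotient [x / a] tends to infinity with the sign of [x], so its arctangent tends to plus or
    minus pi/2, and [cos] is even. *)
Lemma regularized_kernel_cvg :
  kernel k @[k --> \oo] --> Gamma p * cos (p * (pi / 2)) * `|x| `^ (- p).
Proof.
have ck : (k.+1%:R^-1 : R) @[k --> \oo] --> (0 : R) by exact: cvg_harmonic.
rewrite mulrAC; apply: cvgM.
  apply: cvgMr; rewrite -powR_x2.
  apply: (@continuous_cvg _ _ _ _ _ (fun k : nat =>
    k.+1%:R^-1 ^+ 2 + x ^+ 2) (fun y : R => y `^ (- (p / 2))) (x ^+ 2)).
    exact: continuous_powR.
  rewrite -[X in _ --> X]add0r; apply: cvgD; last exact: cvg_cst.
  by rewrite -(mul0r (0 : R)); exact: cvgM.
have ckE (k : nat) : cos (p * atan (x / k.+1%:R^-1)) = cos (p * atan (`|x| * k.+1%:R)).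
  rewrite invrK; case: (ger0P x) => _ //.
  by rewrite mulNr atanN mulrN cosN.
under eq_fun do rewrite ckE.
apply: continuous_cvg; first exact: continuous_cos.
apply: cvgMr.
have hy : `|x| * k.+1%:R @[k --> \oo] --> +oo.
  apply/cvgryPge => A; near=> k.
  rewrite mulrC -ler_pdivrMr ?normr_gt0// (@le_trans _ _ k%:R) ?ler_nat//.
  by near: k; exact: nbhs_infty_ger.
exact: (cvg_comp _ _ hy (@cvgy_atan R)).
Unshelve. all: by end_near. Qed.

(** The negative power is largest without the damping term, and the cosine is at most 1 in absolute
    value. *)
Lemma regularized_kernel_le (k : nat) : `|kernel k| <= Gamma p * `|x| `^ (- p).
Proof.
have G0 : 0 < Gamma p by exact: Gamma_gt0.
rewrite normrM (ger0_norm (mulr_ge0 (ltW G0) (powR_ge0 _ _))).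
apply: (@le_trans _ _ (Gamma p * (k.+1%:R^-1 ^+ 2 + x ^+ 2) `^ (- (p / 2)))).
  by rewrite ler_piMr ?mulr_ge0 ?powR_ge0 ?(ltW G0)// ler_norml cos_geN1 cos_le1.
rewrite ler_pM2l// -powR_x2 !powRN lef_pV2 ?posrE ?powR_gt0//.
  by apply: ge0_ler_powR; rewrite ?nnegrE ?lerDr ?sqr_ge0 ?addr_ge0 ?sqr_ge0// divr_ge0
    ?(ltW p_gt0).
by rewrite ltr_wpDl// sqr_ge0.
Qed.

End regularized_kernel.

Section cosine_transform_moments.
Context d (T : measurableType d) (R : realType).
Variables (nu : {sigma_finite_measure set T -> \bar R}) (D : set T) (u : T -> R).
Hypotheses (mD : measurable D) (fD : (nu D < +oo)%E) (mu_ : measurable_fun setT u).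
Notation mu := (@lebesgue_measure R).
Notation G := (cosine_transform nu D u).
Hypothesis G_ge0 : forall r, 0 <= G r.

(** Measurability of partial integrals is available for nonnegative integrands: apply it to 1 + cos
    and subtract the measure of [D]. *)
Lemma measurable_cosine_transform : measurable_fun setT G.
Proof.
have mcosR : measurable_fun setT (@cos R) by exact: continuous_measurable_fun
  (@continuous_cos R).
pose h := fun rz : measurableTypeR R * T => 1 + cos (rz.1 * u rz.2).
have mh : measurable_fun setT h.
  apply: measurable_funD; first exact: measurable_cst.
  apply: (measurableT_comp mcosR); apply: measurable_funM; first exact: measurable_fst.
  exact: (measurableT_comp mu_ measurable_snd).
have h0 rz : 0 <= h rz by rewrite /h addrC -lerBlDr sub0r cos_geN1.
pose F := fun rz => ((h rz)%:E * (\1_D rz.2)%:E)%E.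
have F0 rz : (0 <= F rz)%E by rewrite mule_ge0// lee_fin.
have mF : measurable_fun setT F.
  apply: emeasurable_funM; first exact/measurable_EFinP.
  by apply/measurable_EFinP; apply: (measurableT_comp (measurable_indic mD));
    exact: measurable_snd.
have mFF := measurable_fun_fubini_tonelli_F (m2 := nu) F mF F0.
rewrite (_ : G = fun r => fine (fubini_F nu F r) - fine (nu D)).
  apply: measurable_funB; last exact: measurable_cst.
  exact: measurableT_comp.
apply/funext => r.
have icos : nu.-integrable D (EFin \o (fun z => cos (r * u z))).
  apply: measurable_bounded_integrable => //.
    by apply: measurable_funTS; apply: (measurableT_comp mcosR); exact: measurable_funM.
  exists 1; split; first exact: num_real.
  by move=> M M1 z _; apply: le_trans (ltW M1); rewrite ler_norml cos_geN1 cos_le1.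
have i1 : nu.-integrable D (EFin \o (cst (1 : R))) by apply/integrableP; split;
  [exact/measurable_EFinP/measurable_cst|under eq_integral do rewrite /= normr1;
    rewrite integral_cst// mul1e].
have -> : (fubini_F nu F r = \int[nu]_(z in D) (1 + cos (r * u z))%:E)%E.
  rewrite /fubini_F [RHS]integral_mkcond; apply: eq_integral => z _;
    rewrite patchE /F indicE /=.
  by case: ifPn => _; rewrite ?mule1 ?mule0.
rewrite -[LHS](addKr (fine (nu D))) addrC; congr (_ - _).
by rewrite -/(Rintegral nu D _) RintegralD// Rintegral_cst// mul1r.
Qed.

(** Monotone convergence: [G] is nonnegative and the damping factor increases as its rate decreases.
    The limit may be infinite. *)
Lemma cvg_cosine_transform_reg (p : R) :
  (\int[mu]_(r in `]0%R, +oo[) (G r * exp_density k.+1%:R^-1 p r)%:E @[k --> \oo] -->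
   \int[mu]_(r in `]0%R, +oo[) (G r * r `^ (p - 1))%:E)%E.
Proof.
have mI : measurable (`]0, +oo[%classic : set (measurableTypeR R)) by exact:
  measurable_itv.
have lim (r : R) : (G r * exp_density k.+1%:R^-1 p r) @[k --> \oo] --> G r * r `^ (p - 1).
  have -> : G r * r `^ (p - 1) = G r * (r `^ (p - 1) * expR 0) by rewrite expR0 mulr1.
  have h : - (k.+1%:R^-1 * r) @[k --> \oo] --> (0 : R).
    by rewrite -oppr0 -(mul0r r); apply: cvgN; apply: cvgMl; exact: cvg_harmonic.
  by apply: cvgMr; rewrite /exp_density; apply: cvgMr;
    exact: (continuous_cvg _ (@continuous_expR R 0) h).
rewrite (_ : (\int[mu]_(r in `]0%R, +oo[) (G r * r `^ (p - 1))%:E =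
  \int[mu]_(r in `]0%R, +oo[) (limn (fun k =>
    (G r * exp_density k.+1%:R^-1 p r)%:E)))%E); last first.
  by apply: eq_integral => r _; apply/esym/cvg_lim => //; apply/cvg_EFin;
    [near=> k|exact: lim].
apply: (@cvg_monotone_convergence _ _ _ mu _ mI).
- move=> k; apply: measurable_funTS; apply/measurable_EFinP; apply: measurable_funM.
    exact: measurable_cosine_transform.
  exact: measurable_exp_density.
- by move=> k r _; rewrite lee_fin mulr_ge0// exp_density_ge0.
- move=> r /=; rewrite in_itv/= andbT => r0 k l kl; rewrite lee_fin.
  apply: ler_wpM2l => //; apply: ler_wpM2l; first exact: powR_ge0.
  by rewrite ler_expR lerN2 ler_pM2r// lef_pV2 ?posrE// ler_nat.
Unshelve. all: by end_near. Qed.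

(** Both sides are limits of the same damped integrals, by monotone convergence in [r] on the left
    and by dominated convergence in [z] on the right. *)
Lemma integral_cosine_transform (p : R) : 0 < p < 1 ->
  nu (D `&` [set z | u z = 0]) = 0%E ->
  nu.-integrable D (EFin \o (fun z => `|u z| `^ (- p))) ->
  (\int[mu]_(r in `]0%R, +oo[) (G r * r `^ (p - 1))%:E =
   (Gamma p * cos (p * (pi / 2)))%:E * \int[nu]_(z in D) (`|u z| `^ (- p))%:E)%E.
Proof.
move=> /andP[p0 p1] null iu.
have h1 := @cvg_cosine_transform_reg p.
apply: (cvg_unique _ h1) => //; clear h1.
have G0 : 0 < Gamma p by exact: Gamma_gt0.
rewrite (_ : (fun k => _)%E = (fun k =>
  \int[nu]_(z in D) (Gamma p * (k.+1%:R^-1 ^+ 2 +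
    u z ^+ 2) `^ (- (p / 2)) * cos (p * atan (u z / k.+1%:R^-1)))%:E)%E); last first.
  by apply/funext => k; rewrite integral_cosine_transform_reg// invr_gt0 ltr0n.
rewrite -integralZl//.
have iC (c : R) : nu.-integrable D (EFin \o (fun z => c * `|u z| `^ (- p))).
  by apply: eq_integrable (integrableZl _ c iu).
have mF (k : nat) : measurable_fun D (fun z =>
  (Gamma p * (k.+1%:R^-1 ^+ 2 + u z ^+ 2) `^ (- (p / 2)) * cos (p * atan (u z /
    k.+1%:R^-1)))%:E).
  apply: measurable_funTS; apply/measurable_EFinP.
  apply: measurable_funM.
    apply: measurable_funM; first exact: measurable_cst.
    apply: (measurableT_comp (measurable_powR _)).
    by apply: measurable_funD; [exact: measurable_cst|exact: measurable_funX].
  apply: (measurableT_comp (continuous_measurable_fun (@continuous_cos R))).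
  apply: measurable_funM; first exact: measurable_cst.
  apply: (measurableT_comp (continuous_measurable_fun (@continuous_atan R))).
  by apply: measurable_funM.
have nullD : {ae nu, forall z, D z -> u z != 0}.
  exists (D `&` [set z | u z = 0]); split => //.
    apply: measurableI => //.
    by have := mu_ measurableT (measurable_set1 (0 : R)); rewrite setTI.
  by move=> z /= /not_implyP[Dz /negP/negPn/eqP].
have := @dominated_convergence _ _ _ nu D mD _
  (EFin \o (fun z => Gamma p * cos (p * (pi / 2)) * `|u z| `^ (- p)))
  (EFin \o (fun z => Gamma p * `|u z| `^ (- p))) mF (measurable_int _ (iC _)) _ (iC _) _.
case.
- apply: filterS nullD => z uz Dz; apply/cvg_EFin; first by near=> k.
  exact/regularized_kernel_cvg/uz.
- apply: filterS nullD => z uz k Dz; rewrite lee_fin.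
  by apply: regularized_kernel_le => //; exact: uz.
- by [].
Unshelve. all: by end_near. Qed.

End cosine_transform_moments.

(** * The damped kernel for p = 1 *)

Section poisson_kernel.
Context {R : realType}.
Notation mu := (@lebesgue_measure R).
Variable a : R.
Hypothesis a_gt0 : 0 < a.

(** The value of [gamma_rotation] at p = 1, with [b = x]; [poisson_slope] is minus its
    derivative. *)
Definition poisson_kernel (x : R) : R := a / (a ^+ 2 + x ^+ 2).
Definition poisson_slope (s : R) : R := 2 * a * s / (a ^+ 2 + s ^+ 2) ^+ 2.

Let den_gt0 (x : R) : 0 < a ^+ 2 + x ^+ 2.
Proof. by rewrite ltr_pwDl ?sqr_ge0// exprn_gt0. Qed.

Let dden (x : R) : is_derive x 1 (fun x =>
  (a ^+ 2 + x ^+ 2)^-1) (- (2 * x) / (a ^+ 2 + x ^+ 2) ^+ 2).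
Proof.
have h := @is_deriveD R R R (cst (a ^+ 2)) _ x 1 _ _ (is_derive_cst _ _ _)
      (@is_deriveM R R id id x 1 1 1 (is_derive_id _ _) (is_derive_id _ _)).
have h2 := @is_deriveV R (fun x => a ^+ 2 + x * x) x _ 1 (lt0r_neq0 (den_gt0 x)) h.
apply: is_derive_eq h2 _; rewrite /GRing.scale/= mulr1 add0r; field.
by rewrite lt0r_neq0.
Qed.

Let dker (x : R) : is_derive x 1 poisson_kernel (- poisson_slope x).
Proof.
have h := @is_deriveZ R R R _ a x 1 _ (dden x).
by apply: is_derive_eq h _; rewrite /GRing.scale/= /poisson_slope; field;
  rewrite lt0r_neq0.
Qed.

(** An antiderivative of [s * poisson_slope s], by parts: [atan (s / a)] is one of the kernel. *)
Let F (s : R) := atan (s / a) - s * poisson_kernel s.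

Let dF (x : R) : is_derive x 1 F (x * poisson_slope x).
Proof.
have dl : is_derive x 1 (fun x : R => x / a) a^-1.
  have h := @is_deriveZ R R R id a^-1 x 1 1 (is_derive_id _ _).
  rewrite (_ : (fun x : R => x / a) = a^-1 \*: id); last by apply/funext => y;
    rewrite /= mulrC.
  by apply: is_derive_eq h _; rewrite /GRing.scale/= mulr1.
have h1 := @is_derive1_comp R atan (fun x : R => x / a) x _ _ (is_derive1_atan _) dl.
have h2 := @is_deriveM R R id _ x 1 _ _ (is_derive_id _ _) (dker x).
have h3 := @is_deriveB R R R _ _ x 1 _ _ h1 h2.
apply: is_derive_eq h3 _; rewrite /GRing.scale/= /poisson_slope /poisson_kernel; field.
by rewrite !lt0r_neq0//=.
Qed.

Lemma measurable_poisson_kernel : measurable_fun [set: R] poisson_kernel.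
Proof. by apply: continuous_measurable_fun => x;
  exact: is_derive_continuous (dker x). Qed.

Let cslope : continuous poisson_slope.
Proof.
move=> x; apply: cvgM; first by apply: cvgMr; exact: cvg_id.
apply: cvgV; first by rewrite expf_neq0// lt0r_neq0.
by apply: cvgM; apply: cvgD; [exact: cvg_cst|exact: exprn_continuous|exact:
  cvg_cst|exact: exprn_continuous].
Qed.

Lemma measurable_poisson_slope : measurable_fun [set: R] poisson_slope.
Proof. exact: continuous_measurable_fun. Qed.

Lemma poisson_kernel_ge0 x : 0 <= poisson_kernel x.
Proof. by rewrite divr_ge0 ?ltW. Qed.

Lemma poisson_slope_ge0 s : 0 <= s -> 0 <= poisson_slope s.
Proof. by move=> s0; rewrite /poisson_slope divr_ge0 ?sqr_ge0// !mulr_ge0// ltW. Qed.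

Let inv_y : (y `^ (- 1)) @[y --> +oo] --> (0 : R).
Proof. exact: cvg_powRN_y. Qed.

Let mul_kernel_y : (y * poisson_kernel y) @[y --> +oo] --> (0 : R).
Proof.
apply: (@squeeze_cvgr _ _ _ _ (cst 0) (fun y => a * y `^ (- 1))); last 2 first.
- exact: cvg_cst.
- by rewrite -(mulr0 a); exact: cvgMr.
near=> y; have y0 : 0 < y by near: y; apply: nbhs_pinfty_gt; exact: num_real.
rewrite mulr_ge0 ?poisson_kernel_ge0 ?(ltW y0)//= powR_inv1 ?(ltW y0)//.
rewrite /poisson_kernel mulrCA ler_pM2l// ler_pdivrMr//.
have -> : y^-1 * (a ^+ 2 + y ^+ 2) = y + y^-1 * a ^+ 2 by field; rewrite gt_eqF.
by rewrite lerDl mulr_ge0 ?sqr_ge0// invr_ge0 ltW.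
Unshelve. all: by end_near. Qed.

Let kernel_y : poisson_kernel y @[y --> +oo] --> (0 : R).
Proof.
apply: (@squeeze_cvgr _ _ _ _ (cst 0) (fun y => y * poisson_kernel y)); last 2 first.
- exact: cvg_cst.
- exact: mul_kernel_y.
near=> y; have y0 : 1 < y by near: y; apply: nbhs_pinfty_gt; exact: num_real.
by rewrite poisson_kernel_ge0 ler_peMl ?poisson_kernel_ge0 ?(ltW y0).
Unshelve. all: by end_near. Qed.

Lemma integral_poisson_slope_tail (x : R) : 0 < x ->
  (\int[mu]_(s in `]x, +oo[) (poisson_slope s)%:E = (poisson_kernel x)%:E)%E.
Proof.
move=> x0; pose H (s : R) := - poisson_kernel s.
have dH (y : R) : is_derive y 1 H (poisson_slope y).
  by have h := @is_deriveN R R R _ y 1 _ (dker y); apply: is_derive_eq h _; rewrite opprK.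
rewrite integral_itv_obnd_cbnd; last first.
  by apply: measurable_funTS; apply/measurable_EFinP; exact: measurable_poisson_slope.
rewrite (@ge0_continuous_FTC2y R poisson_slope H x 0).
- by rewrite -EFinB sub0r /H opprK.
- by move=> s xs; apply: poisson_slope_ge0; exact: le_trans (ltW x0) xs.
- by apply: continuous_in_subspaceT => y _; exact: cslope.
- by rewrite -oppr0; apply: cvgN.
- by move=> y xy; have [] := dH y.
- by apply: cvg_at_right_filter; exact: is_derive_continuous (dH x).
- by move=> y _; rewrite derive1E; have [_ ->] := dH y.
Qed.

(** The value is independent of [a], so it survives the limit; this is where the pi of
    [lambda_const] at 1 comes from. *)
Lemma integral_mul_poisson_slope :
  (\int[mu]_(s in `]0%R, +oo[) (s * poisson_slope s)%:E = (pi / 2)%:E)%E.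
Proof.
rewrite (@ge0_FTC_oo R (fun s => s * poisson_slope s) F 0 (pi / 2) (fun x _ => dF x)).
- by rewrite subr0.
- by move=> x _; apply: cvgM; [exact: cvg_id|exact: cslope].
- rewrite (_ : F x @[x --> 0^'+] --> 0 = (F x @[x --> 0^'+] --> F 0)); last first.
    by rewrite [in RHS]/F mul0r atan0 mul0r subr0.
  by apply: cvg_at_right_filter; exact: is_derive_continuous (dF 0).
- rewrite -[pi / 2]subr0; apply: cvgB; last exact: mul_kernel_y.
  have hy : a^-1 * s @[s --> +oo] --> +oo.
    by apply: gt0_cvgMry; [rewrite invr_gt0|exact: cvg_id].
  rewrite (_ : (fun s => atan (s / a)) = atan \o (fun s => a^-1 * s)); last first.
    by apply/funext => s /=; rewrite mulrC.
  exact: (cvg_comp _ _ hy (@cvgy_atan R)).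
- by move=> x x0; rewrite mulr_ge0 ?poisson_slope_ge0 ?(ltW x0).
Qed.

End poisson_kernel.

Lemma Gamma1 (R : realType) : Gamma (1 : R) = 1.
Proof.
apply: EFin_inj; rewrite -GammaE//.
rewrite (@eq_integral_oo R _ (fun r => (expR (- r))%:E)); last first.
  by move=> r r0; rewrite /gamma_density subrr powRr0 mul1r.
have d (r : R) : 0 < r -> is_derive r 1 (fun r : R => - expR (- r)) (expR (- r)).
  move=> _; have h := @is_deriveN R R R _ r 1 _ (is_derive_expRN r).
  by apply: is_derive_eq h _; rewrite opprK.
rewrite (@ge0_FTC_oo R _ (fun r => - expR (- r)) (-1) 0 d).
- by rewrite opprK add0r.
- by move=> r r0; exact: is_derive_continuous (is_derive_expRN r).
- rewrite -[X in _ --> - X]expR0 -[X in expR X]oppr0; apply: cvg_at_right_filter.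
  by apply: cvgN; exact: is_derive_continuous (is_derive_expRN 0).
- by rewrite -oppr0; apply: cvgN; exact: cvgr_expR.
- by move=> r _; exact: expR_ge0.
Qed.

Section cosine_transform_slab.
Context d (T : measurableType d) (R : realType).
Variables (nu : {sigma_finite_measure set T -> \bar R}) (D : set T) (u : T -> R).
Hypotheses (mD : measurable D) (fD : (nu D < +oo)%E) (mu_ : measurable_fun setT u).
Notation mu := (@lebesgue_measure R).
Notation G := (cosine_transform nu D u).
Notation Q s := (fine (nu (slab D u s))).
Hypothesis G_ge0 : forall r, 0 <= G r.
Hypothesis null : nu (D `&` [set z | u z = 0]) = 0%E.

(** The negative power of [u] is spread over slabs by [integral_slab]; the resulting factor [p]
    turns [Gamma p] into [Gamma (p + 1)]. *)
Lemma integral_cosine_transform_slab (p : R) : 0 < p < 1 ->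
  (\int[mu]_(s in `]0%R, +oo[) (s `^ (- p - 1) * Q s)%:E < +oo)%E ->
  (\int[mu]_(r in `]0%R, +oo[) (G r * r `^ (p - 1))%:E =
   (Gamma (p + 1) * cos (pi * p / 2))%:E *
   \int[mu]_(s in `]0%R, +oo[) (s `^ (- p - 1) * Q s)%:E)%E.
Proof.
move=> p01; have /andP[p0 p1] := p01.
have mphi : measurable_fun [set: R] (fun x : R => x `^ (- p) / p).
  by apply: measurable_funM => //; exact: measurable_powR.
rewrite -(@integral_slab _ _ _ nu D u mD fD mu_ (fun s => s `^ (- p - 1)) (fun x =>
  x `^ (- p) / p)) //; first last.
- by move=> x x0; exact: integral_powR_tail.
- by move=> s; rewrite divr_ge0 ?powR_ge0 ?(ltW p0).
- by move=> s _; exact: powR_ge0.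
have mup : measurable_fun D (fun z => `|u z| `^ (- p)).
  apply: measurable_funTS; apply: (measurableT_comp (measurable_powR _)).
  exact: measurableT_comp.
have -> : (\int[nu]_(z in D) (`|u z| `^ (- p) / p)%:E =
  (p^-1)%:E * \int[nu]_(z in D) (`|u z| `^ (- p))%:E)%E.
  rewrite -ge0_integralZl//.
  - by apply: eq_integral => z _; rewrite mulrC.
  - exact/measurable_EFinP.
  - by rewrite lee_fin invr_ge0 ltW.
move=> fin.
have iu : nu.-integrable D (EFin \o (fun z => `|u z| `^ (- p))).
  apply/integrableP; split; first exact/measurable_EFinP.
  under eq_integral do rewrite /= (ger0_norm (powR_ge0 _ _)).
  move: fin; case: (\int[nu]_(z in D) _)%E => [r _|h|h].
  - exact: ltry.
  - by move: h; rewrite gt0_muley ?ltxx// lte_fin invr_gt0.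
  - by [].
rewrite (integral_cosine_transform mD fD mu_ G_ge0 p01 null iu) muleA -EFinM;
  congr (_%:E * _)%E.
have -> : pi * p / 2 = p * (pi / 2) by ring.
by rewrite Gamma_recr//; field; rewrite gt_eqF.
Qed.

(** After damping, the integral becomes one of [poisson_slope] against the measures of slabs. Below
    [eta] the linear bound contributes at most c pi/2; beyond [eta] the total measure times the
    kernel at [eta] remains, and this vanishes as the rate tends to 0. *)
Lemma integral_cosine_transform1_le (c eta : R) : 0 <= c -> 0 < eta ->
  (forall s, 0 < s -> s <= eta -> Q s <= c * s) ->
  (\int[mu]_(r in `]0%R, +oo[) (G r * r `^ (1 - 1))%:E <= (c * (pi / 2))%:E)%E.
Proof.
move=> c0 eta0 Qc; pose M := fine (nu D).
have M0 : 0 <= M by exact: fine_ge0.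
have QM s : Q s <= M.
  rewrite fine_le ?slab_fin_num//; first by rewrite ge0_fin_numE.
  by apply: le_measure; rewrite ?inE//; [exact: measurable_slab|move=> z []].
have Q0 s : 0 <= Q s by exact: fine_ge0.
pose a (k : nat) : R := k.+1%:R^-1.
have a0 k : 0 < a k by rewrite invr_gt0 ltr0n.
have bound k : (\int[mu]_(r in `]0%R, +oo[) (G r * exp_density (a k) 1 r)%:E <=
    (c * (pi / 2) + M * poisson_kernel (a k) eta)%:E)%E.
  rewrite integral_cosine_transform_reg//.
  have -> : (\int[nu]_(z in D) (Gamma 1 * (a k ^+ 2 +
    u z ^+ 2) `^ (- (1 / 2)) * cos (1 * atan (u z / a k)))%:E =
      \int[nu]_(z in D) (poisson_kernel (a k) `|u z|)%:E)%E.
    apply: eq_integral => z _; congr EFin.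
    rewrite Gamma1 !mul1r cos_atan powRN powR12_sqrt ?addr_ge0 ?sqr_ge0//.
    have e : a k ^+ 2 + u z ^+ 2 = a k ^+ 2 * (1 + (u z / a k) ^+ 2).
      by field; rewrite gt_eqF.
    rewrite e sqrtrM ?sqr_ge0// sqrtr_sqr gtr0_norm// invfM -mulrA -expr2 exprVn.
    rewrite sqr_sqrtr ?addr_ge0 ?sqr_ge0// /poisson_kernel real_normK ?num_real// e.
    by field; rewrite gt_eqF//= lt0r_neq0// ltr_pwDl ?sqr_ge0// exprn_gt0.
  rewrite (@integral_slab _ _ _ nu D u mD fD mu_ (poisson_slope (a k)) (poisson_kernel (a
    k)))//; first last.
  - by move=> x x0; exact: integral_poisson_slope_tail.
  - by move=> s; exact: poisson_kernel_ge0.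
  - by move=> s s0; apply: poisson_slope_ge0 => //; exact: ltW.
  - exact: measurable_poisson_kernel.
  - exact: measurable_poisson_slope.
  have mI x : measurable (`]x, +oo[%classic : set (measurableTypeR R)) by exact:
    measurable_itv.
  have ms := @measurable_poisson_slope R (a k) (a0 k).
  have mQ : measurable_fun [set: R] (fun s : R => Q s).
    apply: nondecreasing_measurable => // s t st; rewrite fine_le ?slab_fin_num//.
    apply: le_measure; rewrite ?inE; [exact: measurable_slab|exact: measurable_slab|].
    by move=> z [Dz /= us]; split => //=; exact: lt_le_trans st.
  have slope0 s : 0 < s -> 0 <= poisson_slope (a k) s.
    by move=> s0; apply: poisson_slope_ge0 => //; exact: ltW.
  have msi (x : R) : measurable_fun [set: R] (fun s =>
    poisson_slope (a k) s * (s \in (`]x, +oo[%classic : set R))%:R).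
    apply: measurable_funM => //.
    rewrite (_ : (fun s => _) = \1_(`]x, +oo[%classic : set R));
      first exact: measurable_indic.
    by apply/funext => s; rewrite indicE.
  have mc : measurable_fun [set: R] (fun s =>
    s * poisson_slope (a k) s) by exact: measurable_funM.
  have m1 : measurable_fun [set: R] (fun s => c * (s * poisson_slope (a k) s)).
    by apply: measurable_funM => //; exact: mc.
  have m2 : measurable_fun [set: R] (fun s =>
    M * (poisson_slope (a k) s * (s \in (`]eta, +oo[%classic : set R))%:R)).
    by apply: measurable_funM => //; exact: msi.
  (* A sum majorant instead of a split domain: the linear bound everywhere plus the crude bound [M]
     on []eta, +oo[]. *)
  apply: (@le_trans _ _ (\int[mu]_(s in `]0%R,
    +oo[) ((c * (s * poisson_slope (a k) s))%:E +
      (M * (poisson_slope (a k) s * (s \in (`]eta, +oo[%classic : set R))%:R))%:E))%E).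
    apply: ge0_le_integral => //.
    - by move=> s /=; rewrite in_itv/= andbT => s0; rewrite lee_fin mulr_ge0 ?slope0.
    - by apply: measurable_funTS; apply/measurable_EFinP; exact: measurable_funM ms mQ.
    - by apply: emeasurable_funD; apply: measurable_funTS; apply/measurable_EFinP;
      [exact: m1|exact: m2].
    move=> s /=; rewrite in_itv/= andbT => s0; rewrite -EFinD lee_fin.
    have [se|es] := leP s eta.
      apply: (@le_trans _ _ (c * (s * poisson_slope (a k) s))).
        by rewrite mulrA mulrC ler_wpM2r ?slope0 ?Qc.
      by rewrite lerDl mulr_ge0// mulr_ge0 ?slope0.
    apply: (@le_trans _ _ (M * poisson_slope (a k) s)).
      by rewrite mulrC ler_wpM2r ?slope0.
    by rewrite mem_set/= ?in_itv/= ?andbT// mulr1 lerDr mulr_ge0// mulr_ge0 ?slope0// ltW.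
  rewrite ge0_integralD//; first last.
  - by apply: measurable_funTS; apply/measurable_EFinP; exact: m2.
  - by move=> s /=; rewrite in_itv/= andbT => s0;
    rewrite lee_fin mulr_ge0// mulr_ge0 ?slope0.
  - by apply: measurable_funTS; apply/measurable_EFinP; exact: m1.
  - by move=> s /=; rewrite in_itv/= andbT => s0;
    rewrite lee_fin mulr_ge0// mulr_ge0 ?slope0 ?(ltW s0).
  rewrite EFinD; apply: leeD.
    rewrite le_eqVlt; apply/orP; left; apply/eqP.
    rewrite EFinM -(integral_mul_poisson_slope (a0 k)).
    apply: (@ge0_integralZl_oo R c (fun s => s * poisson_slope (a k) s)) => //.
    by move=> s s0; rewrite mulr_ge0 ?slope0// ltW.
  apply: (@le_trans _ _ (M%:E * \int[mu]_(s in `]0%R,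
    +oo[) (poisson_slope (a k) s * (s \in (`]eta, +oo[%classic : set R))%:R)%:E)%E).
    rewrite le_eqVlt; apply/orP; left; apply/eqP.
    apply: (@ge0_integralZl_oo R M (fun s =>
      poisson_slope (a k) s * (s \in (`]eta, +oo[%classic : set R))%:R)) => //.
    by move=> s s0; rewrite mulr_ge0 ?slope0.
  rewrite EFinM -(integral_poisson_slope_tail (a0 k) eta0).
  apply: lee_wpmul2l; first by rewrite lee_fin.
  rewrite integral_mkcond [leRHS]integral_mkcond; rewrite le_eqVlt; apply/orP; left;
    apply/eqP.
  apply: eq_integral => s _; rewrite !patchE.
  case: ifPn => [_|s0].
    by case: ifPn => _; rewrite ?mulr1 ?mulr0.
  rewrite memNset//= in_itv/= andbT => es; move: s0.
  by rewrite notin_setE/= in_itv/= andbT; apply; exact: lt_trans es.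
apply: (lee_cvg_to (cvg_cosine_transform_reg (p := 1) mD fD mu_ G_ge0) (g := fun k =>
  (c * (pi / 2) + M * poisson_kernel (a k) eta)%:E)); last first.
  by near=> k; exact: bound.
apply/cvg_EFin; first by near=> k.
rewrite -[X in _ --> X]addr0; apply: cvgD; first exact: cvg_cst.
rewrite -(mulr0 M); apply: cvgMr.
have a_cvg : a k @[k --> \oo] --> (0 : R) by exact: cvg_harmonic.
rewrite (_ : 0 = 0 * (0 * 0 + eta ^+ 2)^-1); last by rewrite !mul0r.
apply: cvgM; first exact: a_cvg.
apply: cvgV; first by rewrite mul0r add0r expf_neq0// gt_eqF.
by apply: cvgD; [exact: cvgM|exact: cvg_cst].
Unshelve. all: by end_near. Qed.

End cosine_transform_slab.

(** * Comparison with cones *)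

Section star_concave_profile.
Context {R : realType}.
Notation mu := (@lebesgue_measure R).
Variables (N : nat) (tau : R -> R).
Hypotheses (N_gt0 : (0 < N)%N) (tau0 : tau 0 = 1)
  (tau_ge0 : forall s, 0 <= tau s)
  (tau_ni : forall s t, s <= t -> tau t <= tau s)
  (tau_supp : exists2 b, 0 < b & forall s, b <= s -> tau s = 0)
  (tau_pos : exists2 b, 0 < b & 0 < tau b)
  (tau_star : forall l s, 0 < l < 1 -> 0 < s -> 0 < tau s ->
     (1 - l) + l * tau s <= tau (l * s)).

Definition profile_gap (s : R) : R := 1 - tau s ^+ N.
Notation g := profile_gap.

Definition profile_moment (p : R) : R :=
  fine (\int[mu]_(s in `]0%R, +oo[) (s `^ (- p - 1) * g s)%:E).

(** The closed form from [integral_simplex_gap]. For [N = 2 * n] it is the inverse of [p] times the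
    binomial coefficient in [lambda_const]. *)
Definition simplex_moment (p : R) : R :=
  Gamma N.+1%:R * Gamma (1 - p) / (p * Gamma (N.+1%:R - p)).

Let tau_le1 s : 0 <= s -> tau s <= 1.
Proof. by move=> s0; rewrite -tau0 tau_ni. Qed.

Lemma profile_gap_ge0 s : 0 <= s -> 0 <= g s.
Proof. by move=> s0; rewrite subr_ge0 exprn_ile1// tau_le1. Qed.

Lemma measurable_profile_gap : measurable_fun [set: R] g.
Proof.
apply: measurable_funB; first exact: measurable_cst.
by apply: measurable_funX; apply: nonincreasing_measurable => // s t st; exact: tau_ni.
Qed.

Let mw p : measurable_fun [set: R] (fun s => s `^ (- p - 1) * g s).
Proof. by apply: measurable_funM; [exact: measurable_powR|exact: measurable_profile_gap].
  Qed.

Let cone w s : R := Num.max (1 - s / w) 0.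

Let cone_ge0 w s : 0 <= cone w s. Proof. by rewrite le_max lexx orbT. Qed.

Let gap_le w s : 0 < s -> cone w s <= tau s -> g s <= simplex_gap N (s / w).
Proof.
by move=> s0 h; rewrite /simplex_gap lerB// lerXn2r ?nnegrE ?cone_ge0.
Qed.

Let gap_ge w s : 0 < s -> tau s <= cone w s -> simplex_gap N (s / w) <= g s.
Proof.
by move=> s0 h; rewrite /g lerB// lerXn2r ?nnegrE ?cone_ge0.
Qed.

Let mz p w : measurable_fun [set: R] (fun s => s `^ (- p - 1) * simplex_gap N (s / w)).
Proof.
apply: measurable_funM; first exact: measurable_powR.
by apply: (measurableT_comp (measurable_simplex_gap N)); exact: measurable_funM.
Qed.

Lemma simplex_moment_scale p w : 0 < p < 1 -> 0 < w ->
  (\int[mu]_(s in `]0%R, +oo[) (s `^ (- p - 1) * simplex_gap N (s / w))%:E =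
   (w `^ (- p) * simplex_moment p)%:E)%E.
Proof.
move=> p01 w0; rewrite integral_simplex_gap_scale//.
under eq_integral do rewrite divr1.
by rewrite integral_simplex_gap.
Qed.

Lemma simplex_moment_gt0 p : 0 < p < 1 -> 0 < simplex_moment p.
Proof.
move=> /andP[p0 p1]; rewrite divr_gt0 ?mulr_gt0 ?Gamma_gt0 ?subr_gt0 ?ltr0n//.
by rewrite (lt_trans p1)// ltr1n ltnS.
Qed.

Let moment_le p (f h : R -> R) : measurable_fun [set: R] f -> measurable_fun [set: R] h ->
  (forall s, 0 < s -> 0 <= f s) -> (forall s, 0 < s -> f s <= h s) ->
  (\int[mu]_(s in `]0%R, +oo[) (s `^ (- p - 1) * f s)%:E <=
   \int[mu]_(s in `]0%R, +oo[) (s `^ (- p - 1) * h s)%:E)%E.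
Proof.
move=> mf mh f0 fh.
have mp := @measurable_powR R (- p - 1).
apply: ge0_le_integral => //.
- by move=> s /=; rewrite in_itv/= andbT => s0; rewrite lee_fin mulr_ge0 ?powR_ge0 ?f0.
- by apply: measurable_funTS; apply/measurable_EFinP; exact: measurable_funM.
- by apply: measurable_funTS; apply/measurable_EFinP; exact: measurable_funM.
by move=> s /=; rewrite in_itv/= andbT => s0; rewrite lee_fin ler_wpM2l ?powR_ge0 ?fh.
Qed.

Let msg w : measurable_fun [set: R] (fun s => simplex_gap N (s / w)).
Proof. by apply: (measurableT_comp (measurable_simplex_gap N));
  exact: measurable_funM. Qed.

(** If [tau b] is positive, the chord from 0 to [b] puts the cone of width [b] below the profile;
    the moment of that cone is finite. *)
Lemma profile_moment_fin p : 0 < p < 1 ->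
  (\int[mu]_(s in `]0%R, +oo[) (s `^ (- p - 1) * g s)%:E < +oo)%E.
Proof.
move=> p01; have [b b0 tb] := tau_pos.
have h s : 0 < s -> g s <= simplex_gap N (s / b).
  move=> s0; apply: gap_le => //; rewrite /cone ge_max tau_ge0 andbT.
  have [sb|bs] := ltP s b; last first.
    by apply: le_trans (tau_ge0 s); rewrite subr_le0 ler_pdivlMr ?mul1r.
  have l01 : 0 < s / b < 1 by rewrite divr_gt0// ltr_pdivrMr ?mul1r.
  have := tau_star l01 b0 tb; rewrite divfK ?gt_eqF//; apply: le_trans.
  by rewrite lerDl mulr_ge0// divr_ge0// ltW.
apply: le_lt_trans (@moment_le p _ _ measurable_profile_gap (msg b) _ h) _.
  by move=> s s0; exact: profile_gap_ge0 (ltW s0).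
by rewrite simplex_moment_scale// ltry.
Qed.

Lemma profile_momentE p : 0 < p < 1 ->
  (\int[mu]_(s in `]0%R, +oo[) (s `^ (- p - 1) * g s)%:E = (profile_moment p)%:E)%E.
Proof.
move=> p01; rewrite /profile_moment fineK// ge0_fin_numE ?profile_moment_fin//.
by apply: integral_ge0 => s /=; rewrite in_itv/= andbT => s0;
  rewrite lee_fin mulr_ge0 ?powR_ge0 ?profile_gap_ge0 ?(ltW s0).
Qed.

Lemma profile_moment_ge0 p : 0 <= profile_moment p.
Proof.
apply: fine_ge0; apply: integral_ge0 => s /=; rewrite in_itv/= andbT => s0.
by rewrite lee_fin mulr_ge0 ?powR_ge0 ?profile_gap_ge0 ?(ltW s0).
Qed.

(* If the profile is below the cone 1 - s/w at one point, it stays below, since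
   the chord from (0, 1) to a later point above the cone would be above it. *)
Lemma profile_crossing w : 0 < w -> exists2 a, 0 <= a &
  (forall s, 0 < s < a -> g s <= simplex_gap N (s / w)) /\
  (forall s, a < s -> simplex_gap N (s / w) <= g s).
Proof.
move=> w0; pose D := [set s | 0 < s /\ tau s <= cone w s].
have up s t : D s -> s <= t -> D t.
  move=> [s0 ts]; rewrite le_eqVlt => /predU1P[<- //|st]; have t0 := lt_trans s0 st.
  split => //; rewrite leNgt; apply/negP => tt.
  have tpos : 0 < tau t by exact: le_lt_trans tt.
  have l01 : 0 < s / t < 1 by rewrite divr_gt0// ltr_pdivrMr ?mul1r.
  have l0 : 0 < s / t by rewrite divr_gt0.
  have := tau_star l01 t0 tpos; rewrite divfK ?gt_eqF// => h.
  have : cone w s < tau s.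
    apply: lt_le_trans h; rewrite /cone gt_max; apply/andP; split; last first.
      have h1 : 0 < 1 - s / t by rewrite subr_gt0; case/andP: l01.
      exact: addr_gt0 h1 (mulr_gt0 l0 tpos).
    have : 1 - t / w < tau t by apply: le_lt_trans tt; rewrite le_max lexx.
    rewrite -(ltr_pM2l l0) => h1.
    rewrite -ltrBlDl; apply: le_lt_trans h1.
    by rewrite mulrBr mulr1 mulrA divfK ?gt_eqF// le_eqVlt; apply/orP; left; apply/eqP;
      ring.
  by rewrite ltNge ts.
have [b b0 tb] := tau_supp.
have Db : D b by split => //; rewrite tb.
have D0 : has_inf D by split; [exists b|exists 0 => s [/ltW]].
exists (inf D); first by apply: lb_le_inf => [|s [/ltW]]; first by exists b.
split => s.
  move=> /andP[s0 sa]; apply: gap_le => //; rewrite leNgt; apply/negP => h.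
  have : D s by split => //; exact: ltW.
  by move=> /(ge_inf D0.2); rewrite leNgt sa.
move=> as_; have e0 : 0 < s - inf D by rewrite subr_gt0.
have [t Dt] := inf_adherent e0 D0; rewrite addrC subrK => ts.
by have [s0 h] := up _ _ Dt (ltW ts); exact: gap_ge.
Qed.

(** At the crossing point [a] the difference [g s - simplex_gap N (s / w)] passes from nonpositive
    to nonnegative, as does s^(q-p) - a^(q-p). Their product is nonnegative; integrate it against
    s^(-q-1). *)
Lemma profile_moment_compare p q w : 0 < p -> p < q -> q < 1 -> 0 < w ->
  w `^ (- q) * simplex_moment q <= profile_moment q ->
  w `^ (- p) * simplex_moment p <= profile_moment p.
Proof.
move=> p0 pq q1 w0 hq.
have p01 : 0 < p < 1 by rewrite p0 (lt_trans pq).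
have q01 : 0 < q < 1 by rewrite (lt_trans p0).
have [a a0 [below above]] := profile_crossing w0.
have gw0 s : 0 < s -> 0 <= simplex_gap N (s / w).
  by move=> s0; apply: simplex_gap_ge0; rewrite divr_ge0 ?ltW.
have g0 s : 0 < s -> 0 <= g s by move=> s0; exact: profile_gap_ge0 (ltW s0).
pose c := a `^ (q - p).
(* The nonnegative product, with its terms moved so that both sides are sums of nonnegative
   functions. *)
have pt s : 0 < s -> s `^ (- p - 1) * simplex_gap N (s / w) + c * (s `^ (- q -
  1) * g s) <=
    s `^ (- p - 1) * g s + c * (s `^ (- q - 1) * simplex_gap N (s / w)).
  move=> s0.
  have e : s `^ (- q - 1) * s `^ (q - p) = s `^ (- p - 1).
    rewrite -powRD; last by rewrite (gt_eqF s0) implybT.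
    by congr (_ `^ _); ring.
  rewrite -e -subr_ge0.
  have -> : s `^ (- q - 1) * s `^ (q - p) * g s + c * (s `^ (- q -
    1) * simplex_gap N (s / w)) -
     (s `^ (- q - 1) * s `^ (q - p) * simplex_gap N (s / w) + c * (s `^ (- q -
       1) * g s)) =
     s `^ (- q - 1) * ((s `^ (q - p) - c) * (g s - simplex_gap N (s / w))) by ring.
  apply: mulr_ge0; first exact: powR_ge0.
  have [sa|as_|->] := ltgtP s a.
  - rewrite mulr_le0// subr_le0; last by apply: below; rewrite s0.
    by apply: ge0_ler_powR; rewrite ?nnegrE ?subr_ge0 ?(ltW pq) ?(ltW s0) ?(ltW sa).
  - rewrite mulr_ge0// subr_ge0; last exact: above.
    by apply: ge0_ler_powR; rewrite ?nnegrE ?subr_ge0 ?(ltW pq) ?(ltW s0) ?(ltW as_).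
  - by rewrite subrr mul0r.
have int_add r1 r2 (f1 f2 : R -> R) v1 v2 : measurable_fun [set: R] f1 ->
  measurable_fun [set: R] f2 ->
    (forall s, 0 < s -> 0 <= f1 s) -> (forall s, 0 < s -> 0 <= f2 s) ->
    (\int[mu]_(s in `]0%R, +oo[) (s `^ (- r1 - 1) * f1 s)%:E = v1%:E)%E ->
    (\int[mu]_(s in `]0%R, +oo[) (s `^ (- r2 - 1) * f2 s)%:E = v2%:E)%E ->
    (\int[mu]_(s in `]0%R, +oo[) (s `^ (- r1 - 1) * f1 s + c * (s `^ (- r2 -
      1) * f2 s))%:E = (v1 + c * v2)%:E)%E.
  move=> m1 m2 f10 f20 e1 e2.
  have mm r (f : R -> R) : measurable_fun [set: R] f -> measurable_fun [set: R] (fun s =>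
    s `^ (- r - 1) * f s).
    by move=> mf; apply: measurable_funM => //; exact: measurable_powR.
  have c0 : 0 <= c by exact: powR_ge0.
  under eq_integral do rewrite EFinD.
  rewrite ge0_integralD//; first last.
  - by apply: measurable_funTS; apply/measurable_EFinP; apply: measurable_funM => //;
    exact: mm.
  - by move=> s /=; rewrite in_itv/= andbT => s0;
    rewrite lee_fin !mulr_ge0 ?powR_ge0 ?f20.
  - by apply: measurable_funTS; apply/measurable_EFinP; exact: mm.
  - by move=> s /=; rewrite in_itv/= andbT => s0;
    rewrite lee_fin !mulr_ge0 ?powR_ge0 ?f10.
  rewrite EFinD EFinM -e1 -e2; congr (_ + _)%E.
  apply: (@ge0_integralZl_oo R c (fun s => s `^ (- r2 - 1) * f2 s)) => //;
    first exact: mm.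
  by move=> s s0; rewrite mulr_ge0 ?powR_ge0 ?f20.
have I1 := int_add p q _ _ _ _ (msg w) measurable_profile_gap gw0 g0
  (simplex_moment_scale p01 w0) (profile_momentE q01).
have I2 := int_add p q _ _ _ _ measurable_profile_gap (msg w) g0 gw0
  (profile_momentE p01) (simplex_moment_scale q01 w0).
have h1 : (w `^ (- p) * simplex_moment p + c * profile_moment q <=
    profile_moment p + c * (w `^ (- q) * simplex_moment q)).
  rewrite -lee_fin -I1 -I2; apply: ge0_le_integral => //.
  - move=> s /=; rewrite in_itv/= andbT => s0; rewrite lee_fin.
    by rewrite addr_ge0 ?mulr_ge0 ?powR_ge0 ?gw0 ?g0.
  - apply: measurable_funTS; apply/measurable_EFinP;
    exact: (measurable_funD (mz p w) (measurable_funM (measurable_cst c) (mw q))).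
  - apply: measurable_funTS; apply/measurable_EFinP;
    exact: (measurable_funD (mw p) (measurable_funM (measurable_cst c) (mz q w))).
  by move=> s /=; rewrite in_itv/= andbT => s0; rewrite lee_fin pt.
rewrite -(lerD2r (c * profile_moment q)); apply: (le_trans h1).
by rewrite lerD2l ler_wpM2l ?powR_ge0.
Qed.

(** The inverse width of the cone having the same moment of order -p as the profile. *)
Definition profile_size (p : R) : R := (profile_moment p / simplex_moment p) `^ p^-1.

Lemma profile_size_ge p w : 0 < p < 1 -> 0 < w ->
  w `^ (- p) * simplex_moment p <= profile_moment p -> w^-1 <= profile_size p.
Proof.
move=> p01 w0; have S0 := simplex_moment_gt0 p01; have /andP[p0 _] := p01.
rewrite -ler_pdivlMr// => h; rewrite /profile_size.
have -> : w^-1 = (w `^ (- p)) `^ p^-1.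
  by rewrite -powRrM mulNr divff ?gt_eqF// powR_inv1// ltW.
apply: ge0_ler_powR => //; rewrite ?nnegrE ?powR_ge0 ?invr_ge0 ?(ltW p0)//.
by rewrite divr_ge0 ?profile_moment_ge0// ltW.
Qed.

(** Compare with the cone of width [1 / profile_size q], whose moment of order -q equals that of the
    profile. *)
Lemma profile_size_nonincreasing p q : 0 < p -> p < q -> q < 1 ->
  profile_size q <= profile_size p.
Proof.
move=> p0 pq q1.
have p01 : 0 < p < 1 by rewrite p0 (lt_trans pq).
have q0 := lt_trans p0 pq; have q01 : 0 < q < 1 by rewrite q0.
have S0 := simplex_moment_gt0 q01.
have X0 := profile_moment_ge0 q.
(* A zero moment would require a cone of infinite width. *)
have [X_eq0|Xn0] := eqVneq (profile_moment q) 0.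
  by rewrite {1}/profile_size X_eq0 mul0r powR0 ?powR_ge0// invr_neq0// gt_eqF.
have Y0 : 0 < profile_moment q / simplex_moment q by rewrite divr_gt0// lt0r Xn0.
have s0 : 0 < profile_size q by rewrite powR_gt0.
rewrite -[profile_size q]invrK; apply: profile_size_ge => //; first by rewrite invr_gt0.
apply: (profile_moment_compare p0 pq q1); first by rewrite invr_gt0.
rewrite -(powR_inv1 (ltW s0)) -powRrM mulN1r opprK.
by rewrite /profile_size -powRrM mulVf ?gt_eqF// powRr1 ?(ltW Y0)// divfK// gt_eqF.
Qed.

(** Take for [sigma] the infimum of the chord slopes [(1 - tau s) / s]. Near 0 the slopes come
    within [delta] of it, since they increase with [s], and Bernoulli's inequality passes to the
    power [N]. Conversely [tau s <= 1 - sigma * s] everywhere, so the cone of width [1 / sigma] lies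
    above the profile. *)
Lemma profile_initial_slope : exists2 sigma, 0 <= sigma &
  (forall delta, 0 < delta -> exists2 eta, 0 < eta &
     forall s, 0 < s -> s <= eta -> g s <= N%:R * (sigma + delta) * s) /\
  (forall p, 0 < p < 1 -> sigma <= profile_size p).
Proof.
pose D := [set k | exists s, [/\ 0 < s, 0 < tau s & k = (1 - tau s) / s]].
have D_ge0 k : D k -> 0 <= k.
  by move=> [s [s0 _ ->]]; rewrite divr_ge0 ?subr_ge0 ?tau_le1 ?(ltW s0).
have D0 : has_inf D.
  by split; [have [b b0 tb] := tau_pos; exists ((1 - tau b) / b);
    exists b|exists 0 => k /D_ge0].
have sigma0 : 0 <= inf D by apply: lb_le_inf => [|k /D_ge0//]; exact: D0.1.
exists (inf D) => //; split.
  move=> delta /inf_adherent/(_ D0)[k [b [b0 tb ->]] kd].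
  exists b => // s s0 sb; have t1 := tau_le1 (ltW s0).
  (* Bernoulli's inequality. *)
  have bern M : 1 - tau s ^+ M <= M%:R * (1 - tau s).
    elim: M => [|M IH]; first by rewrite expr0 mul0r subrr.
    have : tau s * (1 - tau s ^+ M) <= 1 - tau s ^+ M.
      by rewrite ler_piMl// subr_ge0 exprn_ile1.
    rewrite exprS -natr1 mulrDl mul1r => h.
    have -> : 1 - tau s * tau s ^+ M = tau s * (1 - tau s ^+ M) + (1 - tau s) by ring.
    by rewrite lerD2r (le_trans h).
  apply: le_trans (bern N) _; rewrite -mulrA ler_wpM2l ?ler0n//.
  (* The profile lies above its chord from 0 to [b]: a nearly minimal slope at [b] controls every
     smaller [s]. *)
  have key : 1 - tau s <= (1 - tau b) / b * s.
    move: sb; rewrite le_eqVlt => /predU1P[->|sb]; first by rewrite divfK ?gt_eqF.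
    have l01 : 0 < s / b < 1 by rewrite divr_gt0// ltr_pdivrMr ?mul1r.
    have := tau_star l01 b0 tb; rewrite divfK ?gt_eqF// => h.
    rewrite lerBlDl -lerBlDr; apply: le_trans h.
    by rewrite le_eqVlt; apply/orP; left; apply/eqP; field; rewrite gt_eqF.
  by apply: le_trans key _; rewrite ler_pM2r// ltW.
move=> p p01; have [->|sn0] := eqVneq (inf D) 0; first exact: powR_ge0.
have s0 : 0 < inf D by rewrite lt0r sn0.
rewrite -[inf D]invrK; apply: profile_size_ge => //; first by rewrite invr_gt0.
rewrite -lee_fin -simplex_moment_scale ?invr_gt0// -profile_momentE//.
apply: moment_le => //.
- exact: measurable_profile_gap.
- by move=> s s1; apply: simplex_gap_ge0; rewrite divr_ge0 ?invr_ge0 ?(ltW s0) ?(ltW s1).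
move=> s s1; apply: gap_ge => //; rewrite /cone invrK.
(* Points where the profile vanishes give no slope in [D]; there the truncation of the cone at 0
   suffices. *)
have [->|tn0] := eqVneq (tau s) 0; first by rewrite le_max lexx orbT.
have ts : 0 < tau s by rewrite lt0r tn0 tau_ge0.
have : inf D <= (1 - tau s) / s by apply: ge_inf; [exact: D0.2|exists s].
by rewrite ler_pdivlMr// => h; rewrite le_max; apply/orP; left;
  rewrite lerBrDl -lerBrDr mulrC.
Qed.

End star_concave_profile.

(** * Fourier mean bodies *)

Section body_pairs_measure.
Context {R : realType} (n : nat).
Notation leb := (lebesgue_rV R n).

(* The library proves that a product of sigma-finite measures is sigma-finite,
   but the instance is not found by unification, whence this alias. *)
Definition lebesgue_pair : set ('rV[R]_n * 'rV[R]_n) -> \bar R := (leb \x leb)%E.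

Let pair0 : lebesgue_pair set0 = 0%E. Proof. exact: measure0. Qed.
Let pair_ge0 A : (0 <= lebesgue_pair A)%E. Proof. exact: measure_ge0. Qed.
Let pair_sigma_additive : semi_sigma_additive lebesgue_pair.
Proof. exact: measure_semi_sigma_additive. Qed.
HB.instance Definition _ := isMeasure.Build _ _ _ lebesgue_pair
  pair0 pair_ge0 pair_sigma_additive.

Let pair_sigma_finite : sigma_finite setT lebesgue_pair.
Proof.
have /sigma_finiteP[F [FT ndF Foo]] := sigma_finiteT leb.
exists (fun k => F k `*` F k).
  rewrite -setXTT FT predeqE => -[x y]; split.
    move=> [/= [k _ Fx] [l _ Fy]]; exists (maxn k l) => //; split.
    - by move: x Fx; exact/subsetPset/ndF/leq_maxl.
    - by move: y Fy; exact/subsetPset/ndF/leq_maxr.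
  by move=> [k _ []/= ? ?]; split; exists k.
move=> k; have [mF fF] := Foo k; split; first exact: measurableX.
by rewrite /lebesgue_pair product_measure1E// lte_mul_pinfty// ge0_fin_numE.
Qed.
HB.instance Definition _ := Measure_isSigmaFinite.Build _ _ _ lebesgue_pair
  pair_sigma_finite.

End body_pairs_measure.

Section fourier_square.
Context {R : realType} (n : nat) (K : set 'rV[R]_n) (theta : 'rV[R]_n).
Hypothesis hK : convex_body K.
Notation leb := (lebesgue_rV R n).
Notation mu2 := (@lebesgue_pair R n).

Let mK : measurable K. Proof. by have [] := convex_body_vol hK. Qed.
Let fK : (leb K < +oo)%E. Proof. by have [] := convex_body_vol hK. Qed.

Let mosc (h : R -> R) d (T : measurableType d) (D : set T) (f : T -> R) :
  continuous h -> measurable_fun setT f -> measurable_fun D (h \o f).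
Proof.
move=> ch mf; apply: measurable_funTS.
by apply: (measurableT_comp (continuous_measurable_fun ch)).
Qed.

Let iosc (h : R -> R) d (T : measurableType d) (nu : {measure set T ->
  \bar R}) (D : set T) (f : T -> R) :
  measurable D -> (nu D < +oo)%E ->
  continuous h -> (forall x, `|h x| <= 1) -> measurable_fun setT f ->
    nu.-integrable D (EFin \o (h \o f)).
Proof.
move=> mD fD ch h1 mf; apply: measurable_bounded_integrable => //; first exact: mosc.
exists 1; split; first exact: num_real.
by move=> M M1 z _; exact: le_trans (h1 _) (ltW M1).
Qed.

Let cos1 (x : R) : `|cos x| <= 1. Proof. by rewrite ler_norml cos_geN1 cos_le1. Qed.
Let sin1 (x : R) : `|sin x| <= 1. Proof. by rewrite ler_norml sin_geN1 sin_le1. Qed.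

Lemma normc_fourier_sqr (r : R) :
  complex.ComplexField.Normc.normc (fourier (char_fun K) (r *: theta)) ^+ 2 =
  (\int[leb]_(x in K) cos (r * dotp x theta)) ^+ 2 +
    (\int[leb]_(x in K) sin (r * dotp x theta)) ^+ 2.
Proof.
rewrite /complex.ComplexField.Normc.normc /fourier /Cintegral /= sqr_sqrtr ?addr_ge0
  ?sqr_ge0//.
have e x : dotp x (r *: theta) = r * dotp x theta by rewrite dotpC dotpZl dotpC.
congr (_ + _).
  congr (_ ^+ 2); rewrite [RHS]Rintegral_mkcond; apply: eq_Rintegral => x _.
  by rewrite patchE /= mulr0 subr0 e cosN indicE; case: ifPn => _; rewrite ?mulr1 ?mulr0.
rewrite -[RHS]sqrrN; congr (_ ^+ 2).
rewrite -mulN1r -RintegralZl//; last first.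
  apply: iosc => //; [exact: continuous_sin|].
  by apply: measurable_funM => //; apply: measurable_dotp.
rewrite [RHS]Rintegral_mkcond; apply: eq_Rintegral => x _.
by rewrite patchE /= mulr0 add0r e sinN indicE mulN1r; case: ifPn => _;
  rewrite ?mulr1 ?mulr0.
Qed.

(** Expand the cosine of a difference by the addition formula; over K x K each product separates. *)
Lemma cosine_transform_gap (r : R) :
  cosine_transform mu2 (K `*` K) (gap theta) r =
  (\int[leb]_(x in K) cos (r * dotp x theta)) ^+ 2 +
    (\int[leb]_(x in K) sin (r * dotp x theta)) ^+ 2.
Proof.
have md : measurable_fun setT (fun x => r * dotp x theta).
  by apply: measurable_funM => //; apply: measurable_dotp.
have mg : measurable_fun setT (fun z => r * gap theta z).
  by apply: measurable_funM => //; exact: measurable_gap.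
have mKK : measurable (K `*` K) by exact: measurableX.
have fKK : (mu2 (K `*` K) < +oo)%E by rewrite /lebesgue_pair body_pairs_volE// ltry.
have ic : leb.-integrable K (EFin \o (fun x => cos (r * dotp x theta))).
  by apply: (iosc mK fK (@continuous_cos R) cos1 md).
have is_ : leb.-integrable K (EFin \o (fun x => sin (r * dotp x theta))).
  by apply: (iosc mK fK (@continuous_sin R) sin1 md).
have iz (h : R -> R) (c : R) : leb.-integrable K (EFin \o h \o (fun x =>
  r * dotp x theta)) ->
    leb.-integrable K (EFin \o (fun x => c * h (r * dotp x theta))).
  by move=> h0; apply: eq_integrable (integrableZl _ c h0).
set C := \int[leb]_(x in K) cos _; set S := \int[leb]_(x in K) sin _.
pose F := (EFin \o (cos \o (fun z => r * gap theta z))) \_ (K `*` K).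
have iF : mu2.-integrable setT F.
  by apply/(integrable_mkcond _ mKK); exact: (iosc mKK fKK (@continuous_cos R) cos1 mg).
have FE x y : F (x, y) = if (x \in K) && (y \in K) then
    (cos (r * dotp x theta) * cos (r * dotp y theta) +
      sin (r * dotp x theta) * sin (r * dotp y theta))%:E else 0%E.
  rewrite /F patchE (_ : ((x, y) \in K `*` K) = (x \in K) && (y \in K)); last first.
    by apply/idP/andP => [/set_mem[/= h1 h2]|[/set_mem h1 /set_mem h2]]; [split;
      exact/mem_set|exact/mem_set].
  by case: ifP => // _; rewrite /= gapE mulrBr cosB.
rewrite /cosine_transform /Rintegral integral_mkcond.
rewrite -(integral12_prod_meas1 iF).
have -> : (\int[leb]_x fubini_F leb F x =
  \int[leb]_(x in K) (cos (r * dotp x theta) * C + sin (r * dotp x theta) * S)%:E)%E.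
  rewrite [RHS]integral_mkcond; apply: eq_integral => x _; rewrite patchE /fubini_F.
  case: ifPn => xK; last by rewrite integral0_eq// => y _; rewrite FE (negbTE xK).
  rewrite -RintegralZl// -RintegralZl// -RintegralD//; [|exact: iz|exact: iz].
  rewrite /Rintegral fineK; last first.
    apply: integrable_fin_num => //.
    by apply: eq_integrable (integrableD _ (iz cos _ ic) (iz sin _ is_)).
  by rewrite [RHS]integral_mkcond; apply: eq_integral => y _; rewrite FE xK patchE.
rewrite -/(Rintegral leb K _) RintegralD//.
- under eq_Rintegral do rewrite mulrC.
  under [X in _ + X]eq_Rintegral do rewrite mulrC.
  by rewrite !RintegralZl// !expr2.
- by apply: eq_integrable (integrableZr _ C ic).
- by apply: eq_integrable (integrableZr _ S is_).
Qed.

Lemma normc_fourier_sqrE (r : R) :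
  complex.ComplexField.Normc.normc (fourier (char_fun K) (r *: theta)) ^+ 2 =
  cosine_transform mu2 (K `*` K) (gap theta) r.
Proof. by rewrite normc_fourier_sqr cosine_transform_gap. Qed.

End fourier_square.

(** * The profile of a body in one direction *)

Section directional_profile.
Context {R : realType} (n : nat) (K : set 'rV[R]_n) (theta : 'rV[R]_n).
Hypotheses (n_gt0 : (0 < n)%N) (hK : convex_body K) (htheta : unit_sphere theta).
Notation T := (tail K theta).
Notation V := (vol K).

Definition profile (s : R) : R := (T s / T 0) `^ (2 * n)%:R^-1.

Lemma vol_gt0 : 0 < V. Proof. by have [] := convex_body_vol hK. Qed.

Lemma tail0_gt0 : 0 < T 0.
Proof.
have := tail0 n_gt0 hK htheta => e.
by rewrite -(@pmulrn_lgt0 R (T 0) 2)// -e exprn_gt0// vol_gt0.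
Qed.

Let N_gt0 : 0 < (2 * n)%:R :> R. Proof. by rewrite ltr0n muln_gt0. Qed.

Lemma profile0 : profile 0 = 1.
Proof. by rewrite /profile divff ?gt_eqF ?tail0_gt0// powR1. Qed.

Lemma profile_ge0 s : 0 <= profile s. Proof. exact: powR_ge0. Qed.

Lemma profile_nonincreasing s t : s <= t -> profile t <= profile s.
Proof.
move=> st; apply: ge0_ler_powR; rewrite ?nnegrE ?divr_ge0 ?tail_ge0 ?invr_ge0 ?(ltW
  N_gt0)//.
by rewrite ler_pM2r ?invr_gt0 ?tail0_gt0// tail_nonincreasing.
Qed.

Lemma profile_gt0 s : 0 < T s -> 0 < profile s.
Proof. by move=> h; rewrite powR_gt0// divr_gt0// tail0_gt0. Qed.

Lemma profile_eq0 s : T s = 0 -> profile s = 0.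
Proof. by move=> h; rewrite /profile h mul0r powR0// invr_neq0// gt_eqF. Qed.

Lemma profile_bounded_support : exists2 b, 0 < b & forall s, b <= s -> profile s = 0.
Proof.
have [b b0 h] := tail_bounded_support theta hK.
by exists b => // s /h/profile_eq0.
Qed.

Lemma profile_pos : exists2 b, 0 < b & 0 < profile b.
Proof. by have [b b0 /profile_gt0 h] := tail_gt0 n_gt0 hK htheta; exists b. Qed.

Let profileE s : profile s * T 0 `^ (2 * n)%:R^-1 = T s `^ (2 * n)%:R^-1.
Proof.
rewrite /profile -powRM ?divr_ge0 ?tail_ge0//.
by rewrite divfK// gt_eqF// tail0_gt0.
Qed.

(** [tail_brunn_minkowski] between 0 and [s], after taking the root of order 2n and dividing by that
    of [T 0]. *)
Lemma profile_star l s : 0 < l < 1 -> 0 < s -> 0 < profile s ->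
  (1 - l) + l * profile s <= profile (l * s).
Proof.
move=> l01 s0 ps; have /andP[l0 l1] := l01; have T0 := tail0_gt0.
have Ts : 0 < T s.
  by rewrite lt0r tail_ge0// andbT; apply: contraTN ps => /eqP/profile_eq0 ->;
    rewrite ltxx.
have := tail_brunn_minkowski n_gt0 hK l01 T0 Ts.
rewrite mulr0 add0r => h.
have t0 : 0 < T 0 `^ (2 * n)%:R^-1 by rewrite powR_gt0.
rewrite -(ler_pM2r t0) profileE mulrDl -mulrA profileE.
set S := (X in X <= _).
have S0 : 0 <= S by rewrite addr_ge0// mulr_ge0 ?powR_ge0 ?subr_ge0 ?ltW.
have <- : (S `^ (2 * n)%:R) `^ (2 * n)%:R^-1 = S.
  by rewrite -powRrM divff ?(gt_eqF N_gt0)// powRr1.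
by apply: ge0_ler_powR; rewrite ?nnegrE ?powR_ge0 ?tail_ge0 ?invr_ge0 ?(ltW N_gt0).
Qed.

Lemma profile_gapE s : V ^+ 2 - T s *+ 2 = V ^+ 2 * profile_gap (2 * n) profile s.
Proof.
have T0 := tail0_gt0; rewrite /profile_gap -(powR_mulrn (2 * n) (profile_ge0 s)).
rewrite /profile -powRrM mulVf ?(gt_eqF N_gt0)// powRr1 ?divr_ge0 ?tail_ge0//.
by rewrite (tail0 n_gt0 hK htheta); field; rewrite gt_eqF.
Qed.

Notation D := (K `*` K).
Notation u := (gap theta).
Notation g := (profile_gap (2 * n) profile).
Notation moment := (profile_moment (2 * n) profile).
Notation size := (profile_size (2 * n) profile).

Let N_gt0n : (0 < 2 * n)%N. Proof. by rewrite muln_gt0. Qed.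

Lemma slab_gapE s : 0 < s -> lebesgue_pair (slab D u s) = (V ^+ 2 * g s)%:E.
Proof. by move=> s0; rewrite -profile_gapE -tail_slab. Qed.

Let slope := profile_initial_slope N_gt0n profile0 profile_ge0 profile_nonincreasing
  profile_pos profile_star.

Let mD : measurable D. Proof. exact: measurable_body_pairs. Qed.
Let fD : (lebesgue_pair D < +oo)%E.
Proof. by rewrite /lebesgue_pair body_pairs_volE// ltry. Qed.
Let mu_ : measurable_fun setT u. Proof. exact: measurable_gap. Qed.

(** The set lies in every slab, and the slope bound makes the measure of a thin slab at most a
    multiple of its width. *)
Lemma gap_null : lebesgue_pair (D `&` [set z | u z = 0]) = 0%E.
Proof.
have [sigma sigma0 [h _]] := slope.
have [eta eta0 hs] := h 1 ltr01.
have mZ : measurable (D `&` [set z | u z = 0]).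
  apply: measurableI => //.
  by have := mu_ measurableT (measurable_set1 (0 : R)); rewrite setTI.
have le s : 0 < s -> (lebesgue_pair (D `&` [set z | u z = 0%R]) <= (V ^+ 2 * g s)%:E)%E.
  move=> s0; rewrite -slab_gapE//; apply: le_measure; rewrite ?inE//.
    exact: measurable_slab.
  by move=> z [Dz /= uz]; split => //=; rewrite uz normr0.
apply/eqP; rewrite eq_le measure_ge0 andbT; apply/lee_addgt0Pr => e e0; rewrite add0e.
pose c := V ^+ 2 * ((2 * n)%:R * (sigma + 1)).
have c0 : 0 <= c by rewrite /c mulr_ge0 ?sqr_ge0// mulr_ge0 ?(ltW N_gt0)// addr_ge0.
(* [c + 1] guards against [c = 0]. *)
have s0 : 0 < Num.min eta (e / (c + 1)) by rewrite lt_min eta0 divr_gt0// ltr_wpDl.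
apply: (le_trans (le _ s0)); rewrite lee_fin.
apply: (@le_trans _ _ (c * Num.min eta (e / (c + 1)))).
  by rewrite /c -mulrA ler_wpM2l ?sqr_ge0// hs// ge_min lexx.
apply: (@le_trans _ _ (c * (e / (c + 1)))).
  by rewrite ler_wpM2l// ge_min lexx orbT.
by rewrite mulrCA ler_piMr ?(ltW e0)// ler_pdivrMr ?mul1r ?ltr_wpDl// lerDl.
Qed.

Notation J p := (\int[@lebesgue_measure R]_(r in `]0%R, +oo[)
  (complex.ComplexField.Normc.normc (fourier (char_fun K) (r *: theta)) ^+ 2 * r `^ (p -
    1))%:E)%E.

Let JE p : J p = (\int[@lebesgue_measure R]_(r in `]0%R, +oo[)
  (cosine_transform (@lebesgue_pair R n) D u r * r `^ (p - 1))%:E)%E.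
Proof. by apply: eq_integral => r _; rewrite normc_fourier_sqrE. Qed.

Let G_ge0 r : 0 <= cosine_transform (@lebesgue_pair R n) D u r.
Proof. by rewrite -normc_fourier_sqrE// sqr_ge0. Qed.

Lemma fourier_moment p : 0 < p < 1 ->
  J p = (Gamma (p + 1) * cos (pi * p / 2) * (V ^+ 2 * moment p))%:E.
Proof.
move=> p01.
have e : (\int[@lebesgue_measure R]_(s in `]0%R,
  +oo[) (s `^ (- p - 1) * fine (lebesgue_pair (slab D u s)))%:E =
    (V ^+ 2 * moment p)%:E)%E.
  have M := profile_momentE N_gt0n profile0 profile_ge0 profile_nonincreasing
    profile_pos profile_star p01.
  rewrite EFinM -M -(@ge0_integralZl_oo R (V ^+ 2) (fun s => s `^ (- p - 1) * g s));
    first last.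
  - move=> s s0; apply: mulr_ge0; first exact: powR_ge0.
    exact: (profile_gap_ge0 _ profile0 profile_ge0 profile_nonincreasing (ltW s0)).
  - apply: measurable_funM; first exact: measurable_powR.
    exact: (measurable_profile_gap _ profile_nonincreasing).
  - exact: sqr_ge0.
  by apply: eq_integral_oo => s s0; rewrite slab_gapE//= mulrCA.
have fin := ltry (V ^+ 2 * moment p); rewrite -e in fin.
rewrite JE (integral_cosine_transform_slab mD fD mu_ G_ge0 gap_null p01 fin).
by rewrite e -EFinM.
Qed.

(** One [sigma], fixed before [delta] and [p], serves as the link between the body at 1 and the
    bodies at smaller exponents. *)
Lemma fourier_moment1_le : exists2 sigma, 0 <= sigma &
  (forall delta, 0 < delta ->
     (J 1 <= (V ^+ 2 * ((2 * n)%:R * (sigma + delta)) * (pi / 2))%:E)%E) /\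
  (forall p, 0 < p < 1 -> sigma <= size p).
Proof.
have [sigma sigma0 [h1 h2]] := slope; exists sigma => //; split => // delta d0.
have [eta eta0 hs] := h1 delta d0.
have c0 : 0 <= V ^+ 2 * ((2 * n)%:R * (sigma + delta)).
  by rewrite mulr_ge0 ?sqr_ge0// mulr_ge0 ?(ltW N_gt0)// addr_ge0// ltW.
rewrite JE; apply: (integral_cosine_transform1_le mD fD mu_ G_ge0 gap_null c0 eta0).
move=> s s0 se; have -> : fine (lebesgue_pair (slab D u s)) =
  V ^+ 2 * g s by rewrite slab_gapE.
by rewrite -mulrA ler_wpM2l ?sqr_ge0// hs.
Qed.

Lemma size_nonincreasing p q : 0 < p -> p < q -> q < 1 -> size q <= size p.
Proof.
exact: (profile_size_nonincreasing N_gt0n profile0 profile_ge0 profile_nonincreasing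
  profile_bounded_support profile_pos profile_star).
Qed.

Lemma fourier_radial_lt1 p : 0 < p < 1 ->
  fourier_radial p K theta =
  ((p / V * (Gamma (p + 1) * cos (pi * p / 2) * (V ^+ 2 * moment p))) `^ p^-1)%:E.
Proof. by move=> p01; rewrite /fourier_radial fourier_moment// -EFinM poweR_EFin. Qed.

End directional_profile.

(** [A / B] will be the binomial coefficient and [c] the factor with Gamma and cosine. All is
    collected under one power, where [c] and the powers of [V] cancel. *)
Lemma powR_normalisation (R : realType) (r V A B c p M : R) :
  0 < V -> 0 < A -> 0 < B -> 0 < c -> 0 < p -> 0 <= M ->
  (A / B / c) `^ r * V `^ (- r) * (p / V * (c * (V ^+ 2 * M))) `^ r =
    (M / (B / (p * A))) `^ r.
Proof.
move=> V0 A0 B0 c0 p0 M0.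
have -> : V `^ (- r) = V^-1 `^ r by rewrite -(powR_inv1 (ltW V0)) -powRrM mulN1r.
have P1 : 0 <= A / B / c by apply/ltW/divr_gt0 => //; exact: divr_gt0.
have P2 : 0 <= V^-1 by rewrite invr_ge0 ltW.
have P3 : 0 <= p / V * (c * (V ^+ 2 * M)).
  apply: mulr_ge0; first exact/ltW/divr_gt0.
  by apply: mulr_ge0; [exact: ltW|apply: mulr_ge0 => //; exact: sqr_ge0].
rewrite -(powRM _ P1 P2) -(powRM _ (mulr_ge0 P1 P2) P3); congr (_ `^ _).
by field; rewrite !lt0r_neq0.
Qed.

Section normalisation.
Context {R : realType} (n : nat) (K : set 'rV[R]_n) (p : R).
Hypotheses (hK : convex_body K) (p01 : 0 < p < 1).
Notation V := (vol K).

Let p_gt0 : 0 < p. Proof. by case/andP: p01. Qed.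
Let p_lt1 : p < 1. Proof. by case/andP: p01. Qed.

Let c_gt0 : 0 < Gamma (p + 1) * cos (pi * p / 2).
Proof.
apply: mulr_gt0; first by apply: Gamma_gt0; rewrite addr_gt0.
apply: cos_gt0_pihalf; apply/andP; split.
  by apply: (@lt_trans _ _ 0); rewrite ?oppr_lt0 ?divr_gt0 ?mulr_gt0 ?pi_gt0.
by rewrite ltr_pM2r// gtr_pMr// pi_gt0.
Qed.

Let A_gt0 : 0 < Gamma ((2 * n).+1%:R - p).
Proof. by apply: Gamma_gt0; rewrite subr_gt0 (lt_le_trans p_lt1)// ler1n. Qed.

Let B_gt0 : 0 < Gamma (2 * n).+1%:R * Gamma (1 - p).
Proof. by apply: mulr_gt0; apply: Gamma_gt0; [rewrite ltr0n|rewrite subr_gt0]. Qed.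

Let lambdaE : lambda_const n p =
  (Gamma ((2 * n).+1%:R - p) / (Gamma (2 * n).+1%:R * Gamma (1 - p)) /
   (Gamma (p + 1) * cos (pi * p / 2))) `^ p^-1.
Proof.
have e1 : (2 * n)%:R - p + 1 = (2 * n).+1%:R - p by rewrite -[in RHS]natr1; ring.
have e2 : (2 * n)%:R + 1 = (2 * n).+1%:R :> R by exact: natr1.
have e3 : (2 * n)%:R - p - (2 * n)%:R + 1 = 1 - p by ring.
by rewrite /lambda_const (lt_eqF p_lt1) /gbinom e1 e2 e3.
Qed.

Lemma mean_body_scale_gt0 : 0 < lambda_const n p * V `^ (- p^-1).
Proof.
apply: mulr_gt0; last by apply: powR_gt0; exact: vol_gt0.
rewrite lambdaE; apply: powR_gt0; apply: divr_gt0 => //; exact: divr_gt0.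
Qed.

(** With [M] the moment of the profile, the right side is [profile_size]: the normalisation by
    [lambda_const] and the volume leaves exactly the quantity compared between exponents. *)
Lemma mean_body_scale_radial (M : R) : 0 <= M ->
  lambda_const n p * V `^ (- p^-1) *
    (p / V * (Gamma (p + 1) * cos (pi * p / 2) * (V ^+ 2 * M))) `^ p^-1 =
  (M / simplex_moment (2 * n) p) `^ p^-1.
Proof. by move=> M0; rewrite lambdaE; apply: powR_normalisation => //;
  exact: vol_gt0. Qed.

End normalisation.

Section scaled_radius.
Context {R : realType} (n : nat) (K : set 'rV[R]_n) (theta : 'rV[R]_n).
Hypotheses (n_gt0 : (0 < n)%N) (hK : convex_body K) (htheta : unit_sphere theta).
Notation V := (vol K).
Notation size := (profile_size (2 * n) (profile K theta)).

Lemma scaled_radius_lt1 (p t : R) : 0 < p < 1 ->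
  (t%:E <= fourier_radial p K theta)%E = (lambda_const n p * V `^ (- p^-1) * t <= size p).
Proof.
move=> p01; rewrite fourier_radial_lt1// lee_fin.
rewrite -(ler_pM2l (mean_body_scale_gt0 hK p01)) (mean_body_scale_radial hK p01)//.
apply: (profile_moment_ge0 _ (profile0 n_gt0 hK htheta)) => *; first exact: profile_ge0.
exact: profile_nonincreasing.
Qed.

Lemma scaled_radius_1 (p t : R) : 0 < p < 1 ->
  (t%:E <= fourier_radial 1 K theta)%E -> lambda_const n 1 * V `^ (- 1^-1) * t <= size p.
Proof.
move=> p01; have V0 := vol_gt0 hK.
have [sigma sigma0 [h1 h2]] := fourier_moment1_le n_gt0 hK htheta.
rewrite /fourier_radial invr1 poweRe1; last first.
  apply: mule_ge0; first by rewrite lee_fin divr_ge0// ltW.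
  by apply: integral_ge0 => r _; rewrite lee_fin mulr_ge0 ?powR_ge0 ?sqr_ge0.
(* It suffices to reach [sigma + delta] for every positive [delta]. *)
move=> ht; apply: le_trans (h2 p p01); apply/ler_addgt0Pr => delta d0.
have := le_trans ht (lee_wpmul2l _ (h1 delta d0)).
rewrite lee_fin divr_ge0 ?(ltW V0)// => /(_ isT); rewrite -EFinM lee_fin => h.
have n0 : 0 < n%:R :> R by rewrite ltr0n.
have c0 : 0 < (pi * n%:R)^-1 * V^-1.
  by rewrite mulr_gt0 ?invr_gt0// mulr_gt0// pi_gt0.
rewrite /lambda_const eqxx powR_inv1 ?(ltW V0)//.
(* The bound on the radius is n pi V (sigma + delta), so the factor 1 / (pi n V) leaves exactly
   [sigma + delta]; this explains the value of [lambda_const] at 1. *)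
apply: (le_trans (ler_wpM2l (ltW c0) h)); rewrite le_eqVlt; apply/orP; left; apply/eqP.
rewrite natrM; move: (pi_gt0 R); move: (@pi R) => P P0.
by field; rewrite (lt0r_neq0 n0) (lt0r_neq0 V0) (lt0r_neq0 P0).
Qed.

End scaled_radius.

Theorem corollary13 (R : realType) (n : nat) (p q : R) (K : set 'rV[R]_n)
    (hn : (0 < n)%N) (hp : 0 < p) (hpq : p < q) (hq : q <= 1)
    (hK : convex_body K) :
  dilate (lambda_const n q * vol K `^ (- q^-1)) (fourier_mean_body q K) `<=`
  dilate (lambda_const n p * vol K `^ (- p^-1)) (fourier_mean_body p K).
Proof.
move=> _ [_ [theta [t [htheta t0 ht ->]]] <-].
have p01 : 0 < p < 1 by rewrite hp (lt_le_trans hpq).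
have cp0 := mean_body_scale_gt0 hK p01.
set cp := lambda_const n p * _ in cp0 *; set cq := lambda_const n q * _.
have cq0 : 0 <= cq.
  rewrite mulr_ge0 ?powR_ge0// /lambda_const; case: ifP => _; last exact: powR_ge0.
  by rewrite invr_ge0 mulr_ge0// pi_ge0.
have key : cq * t <= profile_size (2 * n) (profile K theta) p.
  move: hq; rewrite le_eqVlt => /predU1P[q1|q1].
    by move: ht; rewrite /cq q1; exact: scaled_radius_1.
  have q01 : 0 < q < 1 by rewrite (lt_trans hp).
  apply: le_trans (size_nonincreasing hn hK htheta hp hpq q1).
  by rewrite -scaled_radius_lt1.
(* The same point on the same ray, its parameter rescaled by the quotient of the two dilation
   factors; [key] puts it below the radius at [p]. *)
exists ((cq * t / cp) *: theta); last by rewrite !scalerA mulrCA divff ?gt_eqF// mulr1.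
exists theta, (cq * t / cp); split => //;
  first exact: divr_ge0 (mulr_ge0 cq0 t0) (ltW cp0).
by rewrite scaled_radius_lt1// -/cp mulrCA divff ?gt_eqF// mulr1.
Qed.
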